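(* Let $B\subset A$ be an inclusion of simple unital $C^*$-algebras with a conditional expectation of index-finite type. Let $1\le p,q,r\le\infty$ with $\frac1p+\frac1q=\frac1r+1$. (i) For any $x,y\in B'\cap A_1$, $\ \lVert x*y\rVert_r\le\dfrac{\delta}{\kappa_0^+}\lVert x\rVert_p\lVert y\rVert_q$. (ii) For any $w,z\in A'\cap A_2$, $\ \lVert w*z\rVert_r\le\dfrac{\delta}{\kappa_0^-}\lVert w\rVert_p\lVert z\rVert_q$.
   Context: Setting. $B\subset A$ is an inclusion of simple unital $C^*$-algebras (common unit) admitting a conditional expectation of index-finite type. A conditional expectation $E:A\to B$ is of index-finite type if it has a quasi-basis, i.e. a finite set $\{\lambda_1,\dots,\lambda_m\}\subset A$ with $x=\sum_i\lambda_iE(\lambda_i^*x)=\sum_iE(x\lambda_i)\lambda_i^*$ for all $x\in A$; its Watatani index is $\sum_i\lambda_i\lambda_i^*$ (a positive scalar here). $E_0:A\to B$ is the minimal conditional expectation (the unique one of smallest index), $[A:B]_0$ is its index, $\tau=[A:B]_0^{-1}$, $\delta=\sqrt{[A:B]_0}$. Put $A_{-1}=B$, $A_0=A$; for $n\ge1$, $A_n$ is the $C^*$-basic construction of $A_{n-2}\subset A_{n-1}$ with respect to $E_{n-1}$, with Jones projection $e_n\in A_n$ (so $e_nxe_n=E_{n-1}(x)e_n$ for $x\in A_{n-1}$ and $A_n=\mathrm{span}\,A_{n-1}e_nA_{n-1}$), and $E_n:A_n\to A_{n-1}$ is the dual (minimal) conditional expectation, $E_n(xe_ny)=\tau xy$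 for $x,y\in A_{n-1}$. For $C\subset D$, $C'\cap D=\{d\in D: dc=cd\ \forall c\in C\}$; the relative commutants $B'\cap A_n$ are finite-dimensional. $\mathrm{tr}$ is the faithful tracial state on $B'\cap A_n$ given by the restriction of $E_0\circ E_1\circ\cdots\circ E_n$; these are compatible for varying $n$ and are restricted to the subalgebras $A'\cap A_n$. Norms. $\lVert x\rVert_p=\mathrm{tr}(|x|^p)^{1/p}$ for $1\le p<\infty$; $\lVert x\rVert_\infty$ is the operator norm. Fourier transform and convolution. $v_n=e_ne_{n-1}\cdots e_1$. $E^{B'\cap A_n}_{A'\cap A_n}$ is the $\mathrm{tr}$-preserving conditional expectation; $E^{B'\cap A_n}_{A'\cap A_n}(x)=\tau\sum_i\lambda_ix\lambda_i^*$ for any quasi-basis $\{\lambda_i\}$ of $E_0$. $\mathcal F_n:B'\cap A_n\to A'\cap A_{n+1}$, $\mathcal F_n(x)=\tau^{-\frac{n+2}{2}}E^{B'\cap A_{n+1}}_{A'\cap A_{n+1}}(xv_{n+1})$, a bijection with inverse $\mathcal F_n^{-1}(w)=\tau^{-\frac{n+2}{2}}E_{n+1}(wv_{n+1}^* )$. For $x,y\in B'\cap A_n$, $x*y=\mathcal F_n^{-1}\big(\mathcal F_n(y)\mathcal F_n(x)\big)$; for $w,z\in A'\cap A_{n+1}$, $w*z=\mathcal F_n\big(\mathcal F_n^{-1}(z)\mathcal F_n^{-1}(w)\big)$. Here $n=1$. Constants. $\kappa_0^+=\min\{\mathrm{tr}(p):p\text{ a nonzero projection in }B'\cap A\}$,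 $\kappa_0^-=\min\{\mathrm{tr}(q):q\text{ a nonzero projection in }A'\cap A_1\}$. *)

(* Defs.v *)
From HB Require Import structures.
From mathcomp Require Import all_boot all_order all_algebra.
From mathcomp Require Import all_classical all_reals all_analysis.
From mathcomp Require Import complex.

Set Implicit Arguments.
Unset Strict Implicit.
Unset Printing Implicit Defensive.

Import Order.TTheory GRing.Theory Num.Theory.
Import numFieldNormedType.Exports.

Local Open Scope classical_set_scope.
Local Open Scope ring_scope.

(* Unital C*-algebras over R[i]; [GRing.Algebra] includes 1 != 0.  The library
   hierarchies do not allow a join of [GRing.Algebra] with the normed modules,
   hence the norm and its completeness are part of the mixin. *)
HB.mixin Record isCStarAlgebra (R : realType) A & GRing.Algebra R[i] A := {
  star : A -> A ;
  cnorm : A -> R ;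
  starK : involutive star ;
  starD : {morph star : x y / x + y} ;
  starZ : forall (z : R[i]) (x : A), star (z *: x) = z^* *: star x ;
  starM : forall x y : A, star (x * y) = star y * star x ;
  cnorm0_eq0 : forall x : A, cnorm x = 0 -> x = 0 ;
  cnormD : forall x y : A, cnorm (x + y) <= cnorm x + cnorm y ;
  cnormZ : forall (z : R[i]) (x : A),
    cnorm (z *: x) = complex.Re `|z| * cnorm x ;
  cnormM : forall x y : A, cnorm (x * y) <= cnorm x * cnorm y ;
  cstar_identity : forall x : A, cnorm (star x * x) = cnorm x ^+ 2 ;
  cnorm_complete : forall u : nat -> A,
    (forall eps : R, 0 < eps -> exists N : nat, forall m n : nat,
       (N <= m)%N -> (N <= n)%N -> cnorm (u m - u n) < eps) ->
    exists l : A, forall eps : R, 0 < eps -> exists N : nat, forall n : nat,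
       (N <= n)%N -> cnorm (u n - l) < eps
}.

#[short(type="cstarAlgType")]
HB.structure Definition CStarAlgebra (R : realType) :=
  { A of GRing.Algebra R[i] A & isCStarAlgebra R A }.

Definition positive (R : realType) (A : cstarAlgType R) (a : A) : Prop :=
  exists y : A, a = star y * y.

Definition projection (R : realType) (A : cstarAlgType R) (p : A) : Prop :=
  p * p = p /\ star p = p.

Definition two_sided_ideal (R : realType) (A : cstarAlgType R) (I : set A) :
    Prop :=
  [/\ I 0, (forall x y, I x -> I y -> I (x + y)) &
      forall a x b, I x -> I (a * x * b)].

Definition norm_closed (R : realType) (A : cstarAlgType R) (I : set A) : Prop :=
  forall x : A,
    (forall eps : R, 0 < eps -> exists2 y, I y & cnorm (x - y) < eps) -> I x.

Definition simple_cstar (R : realType) (A : cstarAlgType R) : Prop :=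
  forall I : set A, norm_closed I -> two_sided_ideal I -> I = [set 0] \/ I = setT.

(* Inclusions of C*-algebras with common unit are represented by injective
   unital *-homomorphisms. *)
Definition star_embedding (R : realType) (B A : cstarAlgType R)
    (i : {lrmorphism B -> A}) : Prop :=
  injective i /\ forall b, i (star b) = star (i b).

(* i(B)' \cap D *)
Definition relcomm (R : realType) (B D : cstarAlgType R) (i : B -> D) :
    set D :=
  [set d | forall b, d * i b = i b * d].

Definition cond_exp (R : realType) (B A : cstarAlgType R)
    (i : {lrmorphism B -> A}) (E : {linear A -> B}) : Prop :=
  [/\ forall b, E (i b) = b,
      forall b x b', E (i b * x * i b') = b * E x * b' &
      forall x, positive (E (star x * x))].

Definition quasi_basis (R : realType) (B A : cstarAlgType R)
    (i : {lrmorphism B -> A}) (E : {linear A -> B})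
    (m : nat) (l : 'I_m -> A) : Prop :=
  forall x, x = \sum_k l k * i (E (star (l k) * x)) /\
            x = \sum_k i (E (x * l k)) * star (l k).

(* E is a conditional expectation of index-finite type whose Watatani index is
   the scalar c. *)
Definition has_index (R : realType) (B A : cstarAlgType R)
    (i : {lrmorphism B -> A}) (E : {linear A -> B}) (c : R) : Prop :=
  cond_exp i E /\
  exists (m : nat) (l : 'I_m -> A),
    quasi_basis i E l /\ \sum_k l k * star (l k) = (c%:C)%C%:A.

Definition minimal_cond_exp (R : realType) (B A : cstarAlgType R)
    (i : {lrmorphism B -> A}) (E0 : {linear A -> B}) (c : R) : Prop :=
  has_index i E0 c /\
  forall (E : {linear A -> B}) (c' : R), has_index i E c' -> c <= c'.

(* (D, e) is the C*-basic construction of i : B -> A with respect to E, with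
   j : A -> D: the algebra D acts faithfully, by adjointable B-linear
   operators, on A seen as a right Hilbert B-module with inner product
   <x, y> = E(x^* y); A acts by left multiplication, the Jones projection e
   acts as E, and D is spanned by A e A.  When E is of index-finite type A is
   complete for the Hilbert module norm and the span of A e A is closed, so no
   completion is needed. *)
Definition basic_construction (R : realType) (B A D : cstarAlgType R)
    (i : {lrmorphism B -> A}) (E : {linear A -> B})
    (j : {lrmorphism A -> D}) (e : D) : Prop :=
  (exists act : D -> A -> A,
    [/\ (forall t x y b, act t (x * i b + y) = act t x * i b + act t y),
        (forall (z : R[i]) s t x, act (z *: s + t) x = z *: act s x + act t x),
        (forall s t x, act (s * t) x = act s (act t x)) &
        (forall t x y, E (star (act t x) * y) = E (star x * act (star t) y))] /\
    [/\ injective act,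
        (forall a x, act (j a) x = a * x) &
        (forall x, act e x = i (E x))]) /\
  (forall t : D, exists (m : nat) (a b : 'I_m -> A),
      t = \sum_k j (a k) * e * j (b k)).

Definition dual_cond_exp (R : realType) (A D : cstarAlgType R)
    (j : {lrmorphism A -> D}) (e : D) (tau : R) (E : {linear D -> A}) : Prop :=
  cond_exp j E /\
  forall x y, E (j x * e * j y) = (tau%:C)%C *: (x * y).

(* For T with scalar values on a relative commutant, the scalar tr x with
   T x = tr x . 1 *)
Definition trace_of (R : realType) (D B : cstarAlgType R) (T : D -> B) (x : D) :
    R[i] :=
  xget 0 [set z : R[i] | T x = z%:A].

(* P restricts to a tr-preserving conditional expectation from the *-subalgebra
   M onto its *-subalgebra N; its values off M are irrelevant. *)
Definition trace_cond_exp (R : realType) (D : cstarAlgType R) (tr : D -> R[i])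
    (M N : set D) (P : D -> D) : Prop :=
  [/\ (forall x, M x -> N (P x)),
      (forall x, N x -> P x = x),
      (forall (z : R[i]) x y, M x -> M y -> P (z *: x + y) = z *: P x + P y) &
      (forall a x b, N a -> M x -> N b -> P (a * x * b) = a * P x * b)] /\
  [/\ (forall x, M x -> exists2 y, N y & P (star x * x) = star y * y) &
      (forall x, M x -> tr (P x) = tr x)].

Definition spectrum (R : realType) (A : cstarAlgType R) (a : A) : set R[i] :=
  [set z | ~ exists b : A, b * (z%:A - a) = 1 /\ (z%:A - a) * b = 1].

Definition poly_at (R : realType) (A : cstarAlgType R) (P : {poly R}) (a : A) :
    A :=
  horner_alg a (map_poly (real_complex R) P).

(* Continuous functional calculus of a self-adjoint a: b = f(a) is the norm
   limit of P(a) when the real polynomials P tend to f uniformly on the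
   spectrum of a. *)
Definition is_funcalc (R : realType) (A : cstarAlgType R) (f : R -> R)
    (a b : A) : Prop :=
  forall eps : R, 0 < eps -> exists P : {poly R},
    (forall t : R, spectrum a (t%:C)%C -> `|P.[t] - f t| <= eps) /\
    cnorm (poly_at P a - b) <= eps.

Definition funcalc (R : realType) (A : cstarAlgType R) (f : R -> R) (a : A) :
    A :=
  xget 0 [set b | is_funcalc f a b].

Definition cabs (R : realType) (A : cstarAlgType R) (x : A) : A :=
  funcalc Num.sqrt (star x * x).

(* The value at p = -oo is a dummy. *)
Definition pnorm (R : realType) (A : cstarAlgType R) (tr : A -> R[i])
    (p : \bar R) (x : A) : R :=
  match p with
  | s%:E => complex.Re (tr (funcalc (fun t => t `^ s) (cabs x))) `^ s^-1
  | +oo%E => cnorm x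
  | -oo%E => 0
  end.

(* x |-> tau^(-3/2) P (x v), with v = e_2 e_1 *)
Definition fourier (R : realType) (A1 A2 : cstarAlgType R) (tau : R)
    (j : A1 -> A2) (P : A2 -> A2) (v : A2) (x : A1) : A2 :=
  ((tau `^ (- (3 / 2)))%:C)%C *: P (j x * v).

Definition inv_fourier (R : realType) (A1 A2 : cstarAlgType R) (tau : R)
    (E : A2 -> A1) (v : A2) (w : A2) : A1 :=
  ((tau `^ (- (3 / 2)))%:C)%C *: E (w * star v).

Definition convolution (R : realType) (X Y : cstarAlgType R)
    (F : X -> Y) (G : Y -> X) (x y : X) : X :=
  G (F y * F x).

Definition proj_traces (R : realType) (D : cstarAlgType R) (tr : D -> R[i])
    (M : set D) : set R :=
  [set t | exists p, [/\ M p, p != 0, projection p & t = complex.Re (tr p)]].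

Definition is_min (R : realType) (S : set R) (m : R) : Prop :=
  S m /\ lbound S m.

(* Main.v *)
(* A Bessel inequality bounds orthonormal families for [E0] by the index, hence
   self-adjoint elements of the relative commutants have finite spectrum; a
   variation of [E0] at its minimum shows that [\sum_k l_k x l_k^*] is a multiple
   of [E0 x] on the relative commutant, which makes the traces tracial.

   One has [x * y = delta E2 (F y1 x F(y2)^* )] for [y = y1 y2^*], and dually with the
   inverse Fourier transform.  So [T(x, y, w) = tr ((x * y) w)] is nonnegative on
   positive elements and satisfies a Cauchy-Schwarz inequality in its three
   arguments at once.  When one argument is [1], [T] is at most [delta / kappa]
   times the product of the traces of the two others: by spectral decomposition
   this reduces to projections of [B' \cap A] and of [A' \cap A1], whose minimal
   traces agree.  Decomposing [x], [y] and [x * y] into partial isometries, these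
   three bounds control the marginals of a nonnegative kernel, and the weighted
   AM-GM inequality gives Young's inequality for it. *)

Require Import Defs.
From HB Require Import structures.
From mathcomp Require Import all_boot all_order all_algebra.
From mathcomp Require Import all_classical all_reals all_analysis.
From mathcomp Require Import complex.
From mathcomp Require Import ring lra.

Set Implicit Arguments.
Unset Strict Implicit.
Unset Printing Implicit Defensive.

Import Order.TTheory GRing.Theory Num.Theory.
Import numFieldNormedType.Exports.

Local Open Scope classical_set_scope.
Local Open Scope ring_scope.

(** A common route to such inequalities is to prove end-point cases and interpolate. Here testing
    [x * y] against a norming element [w] turns the claim into a sum over three finite families of
    singular values. The obstacle is that [T] need not be positive on partial isometries:
    Cauchy-Schwarz bounds it there by the mean of its values on range and on support projections,
    and both families have controlled marginals. The factor [delta] is the scalar in the formula for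
    [x * y]; [1 / kappa] comes from [kappa f(p) <= tr p f(1)] for a projection [p] and a positive
    functional [f]. The other powers of the index cancel. Minimality of [E0] enters once, as the
    identity [mi_trace], which passes directly to dual and to composed expectations. Finite
    dimension of the relative commutants is replaced by finiteness of the spectrum of their
    self-adjoint elements; functional calculus then becomes polynomial interpolation, and the order
    structure is built from real polynomials in one self-adjoint element. *)

Notation rc := (real_complex _).

(** * Norm and spectral radius *)

Section Norm.
Variables (R : realType) (A : cstarAlgType R).
Implicit Types (x y a b : A) (z : R[i]) (c : R).

Lemma star_inj : injective (@star R A).
Proof. exact: (can_inj starK). Qed.

Lemma star0 : star 0 = 0 :> A.
Proof. by apply: (addrI (star 0)); rewrite -starD !addr0. Qed.

Lemma starN x : star (- x) = - star x.
Proof. by apply: (addrI (star x)); rewrite -starD !subrr star0. Qed.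

Lemma starB x y : star (x - y) = star x - star y.
Proof. by rewrite starD starN. Qed.

Lemma star1 : star 1 = 1 :> A.
Proof. by rewrite -[RHS]starK -[star 1 in RHS]mulr1 starM starK mulr1. Qed.

Lemma star_sum (I : Type) (r : seq I) (P : pred I) (F : I -> A) :
  star (\sum_(i <- r | P i) F i) = \sum_(i <- r | P i) star (F i).
Proof. by apply: (big_morph _ starD star0). Qed.

Lemma conj_rc c : ((rc c : R[i])^* = rc c)%R.
Proof. by apply/CrealP; rewrite complex_real. Qed.

Lemma starZr c x : star (rc c *: x) = rc c *: star x.
Proof. by rewrite starZ conj_rc. Qed.

Lemma starX x n : star (x ^+ n) = star x ^+ n.
Proof. by elim: n => [|n IH]; rewrite ?expr0 ?star1 // exprS exprSr starM IH. Qed.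

Lemma cnorm0 : cnorm (0 : A) = 0.
Proof. by rewrite -(scale0r (0 : A)) cnormZ normr0 mul0r. Qed.

Lemma norm_rc c : complex.Re `|rc c : R[i]| = `|c|.
Proof. by rewrite normc_def /= expr0n addr0 sqrtr_sqr. Qed.

Lemma normc_rc c : `|rc c : R[i]| = rc `|c|.
Proof. by rewrite normc_def /= expr0n addr0 sqrtr_sqr. Qed.

Lemma mulCii : 'i * 'i = -1 :> R[i].
Proof. by rewrite -expr2 sqrCi. Qed.

Lemma cnormZr c x : cnorm (rc c *: x) = `|c| * cnorm x.
Proof. by rewrite cnormZ norm_rc. Qed.

Lemma cnormN x : cnorm (- x) = cnorm x.
Proof. by rewrite -scaleN1r cnormZ normrN1 mul1r. Qed.

Lemma cnorm_ge0 x : 0 <= cnorm x.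
Proof.
have := cnormD x (- x); rewrite subrr cnorm0 cnormN -mulr2n -mulr_natl.
by rewrite pmulr_rge0.
Qed.

Lemma cnormB x y : cnorm (x - y) <= cnorm x + cnorm y.
Proof. by rewrite -(cnormN y) cnormD. Qed.

Lemma cnorm_eq0 x : (cnorm x == 0) = (x == 0).
Proof. by apply/eqP/eqP => [/cnorm0_eq0|->] //; rewrite cnorm0. Qed.

Lemma cnorm_gt0 x : (0 < cnorm x) = (x != 0).
Proof. by rewrite lt_def cnorm_ge0 andbT cnorm_eq0. Qed.

Lemma cnorm1 : cnorm (1 : A) = 1.
Proof.
have := cstar_identity (1 : A); rewrite star1 mulr1 => /eqP.
rewrite expr2 -[X in X == _]mulr1 (inj_eq (mulfI _)) ?cnorm_eq0 ?oner_eq0 //.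
by move=> /eqP.
Qed.

Lemma cnorm_sum (I : Type) (r : seq I) (P : pred I) (F : I -> A) :
  cnorm (\sum_(i <- r | P i) F i) <= \sum_(i <- r | P i) cnorm (F i).
Proof.
elim/big_rec2: _ => [|i y x _ h]; first by rewrite cnorm0.
by apply: le_trans (cnormD _ _) _; rewrite lerD2l.
Qed.

Lemma cnormX x n : cnorm (x ^+ n) <= cnorm x ^+ n.
Proof.
elim: n => [|n IH]; first by rewrite expr0 cnorm1.
rewrite !exprS; apply: le_trans (cnormM _ _) _.
by apply: ler_wpM2l => //; exact: cnorm_ge0.
Qed.

Lemma cnorm_star x : cnorm (star x) = cnorm x.
Proof.
suff H y : cnorm y <= cnorm (star y) by apply/eqP; rewrite eq_le H -{2}(starK x) H.
have [->|y0] := eqVneq y 0; first by rewrite star0.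
have := cnormM (star y) y; rewrite cstar_identity expr2.
by rewrite ler_pM2r // cnorm_gt0.
Qed.

Definition selfadj a := star a = a.

Lemma selfadj_sq a : selfadj a -> cnorm (a * a) = cnorm a ^+ 2.
Proof. by move=> h; rewrite -{1}h cstar_identity. Qed.

Lemma selfadj_mulss x : selfadj (star x * x).
Proof. by rewrite /selfadj starM starK. Qed.

Lemma selfadjD x y : selfadj x -> selfadj y -> selfadj (x + y).
Proof. by rewrite /selfadj starD => -> ->. Qed.

Lemma selfadjB x y : selfadj x -> selfadj y -> selfadj (x - y).
Proof. by rewrite /selfadj starB => -> ->. Qed.

Lemma selfadjZ c x : selfadj x -> selfadj (rc c *: x).
Proof. by rewrite /selfadj starZr => ->. Qed.

Lemma selfadj1 : selfadj 1.
Proof. exact: star1. Qed.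

Lemma selfadj_rc c : selfadj (rc c)%:A.
Proof. exact: selfadjZ selfadj1. Qed.

Lemma selfadjX x n : selfadj x -> selfadj (x ^+ n).
Proof. by rewrite /selfadj starX => ->. Qed.

Definition invertible a := exists b, b * a = 1 /\ a * b = 1.

Lemma invertibleM a b : invertible a -> invertible b -> invertible (a * b).
Proof.
move=> [a' [h1 h2]] [b' [h3 h4]]; exists (b' * a'); split.
  by rewrite mulrA -(mulrA b') h1 mulr1.
by rewrite mulrA -(mulrA a) h4 mulr1.
Qed.

Lemma invertibleZ z a : z != 0 -> invertible a -> invertible (z *: a).
Proof.
move=> z0 [b [h1 h2]]; exists (z^-1 *: b).
by rewrite -!scalerAl -!scalerAr h1 h2 !scalerA mulVf // divff // scale1r.
Qed.

Lemma invertible_comm a b : a * b = b * a -> invertible (a * b) -> invertible a.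
Proof.
move=> hc [d [h1 h2]]; exists (b * d).
have h3 : d * b * a = 1 by rewrite -mulrA -hc.
split; last by rewrite mulrA.
have -> : b * d = d * b; last by [].
by rewrite -[LHS]mul1r -h3 -!mulrA (mulrA a) h2 mulr1.
Qed.

Lemma geometric_small (rho eps : R) : 0 <= rho -> rho < 1 -> 0 < eps ->
  exists N, rho ^+ N < eps.
Proof.
move=> r0 r1 e0.
have hr : `|rho| < 1 by rewrite ger0_norm.
have /cvgrPdist_lt /(_ _ e0) [N _ /(_ N (leqnn _))] := cvg_expr hr.
by rewrite /= sub0r normrN ger0_norm ?exprn_ge0 // => h; exists N.
Qed.

Lemma neumann_le y (m n : nat) : cnorm y < 1 -> (m <= n)%N ->
  cnorm (\sum_(m <= k < n) y ^+ k) <= cnorm y ^+ m / (1 - cnorm y).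
Proof.
move=> y1 mn.
apply: le_trans (cnorm_sum _ _ _) _.
apply: (@le_trans _ _ (\sum_(m <= k < n) cnorm y ^+ k)).
  by apply: ler_sum => k _; exact: cnormX.
rewrite ler_pdivlMr ?subr_gt0 //.
have -> : (\sum_(m <= k < n) cnorm y ^+ k) * (1 - cnorm y)
          = cnorm y ^+ m - cnorm y ^+ n.
  rewrite mulr_suml -[RHS]opprK opprB -(telescope_sumr _ mn) -sumrN.
  by apply: eq_bigr => k _; rewrite exprS; ring.
by rewrite gerBl exprn_ge0 // cnorm_ge0.
Qed.

Lemma neumann y : cnorm y < 1 -> invertible (1 - y).
Proof.
move=> y1; set u := fun n : nat => \sum_(0 <= k < n) y ^+ k.
have y0 := cnorm_ge0 y.
have d0 : 0 < 1 - cnorm y by rewrite subr_gt0.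
have small eps : 0 < eps -> exists N, forall n, (N <= n)%N ->
    cnorm y ^+ n / (1 - cnorm y) < eps.
  move=> e0; have [N hN] := geometric_small y0 y1 (mulr_gt0 e0 d0).
  exists N => n hn; rewrite ltr_pdivrMr //; apply: le_lt_trans hN.
  by apply: ler_wiXn2l => //; exact: ltW.
have [l hl] : exists l : A, forall eps : R, 0 < eps ->
    exists N : nat, forall n : nat, (N <= n)%N -> cnorm (u n - l) < eps.
  apply: cnorm_complete => eps /small [N hN]; exists N => m n hm hn.
  wlog mn : m n hm hn / (m <= n)%N => [H|].
    have [/H|/ltnW /H] := leqP m n; first exact.
    by rewrite -(cnormN (u n - u m)) opprB; apply.
  rewrite -cnormN opprB /u (big_cat_nat (n := m)) //= addrAC subrr add0r.
  exact: le_lt_trans (neumann_le y1 mn) (hN _ hm).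
have hu n : (1 - y) * u n = 1 - y ^+ n.
  elim: n => [|n IH]; first by rewrite /u big_geq // mulr0 expr0 subrr.
  rewrite /u big_nat_recr //= mulrDr IH mulrBl mul1r -exprS.
  by rewrite addrA subrK.
have hu' n : u n * (1 - y) = 1 - y ^+ n.
  elim: n => [|n IH]; first by rewrite /u big_geq // mul0r expr0 subrr.
  rewrite /u big_nat_recr //= mulrDl IH mulrBr mulr1 -exprSr.
  by rewrite addrA subrK.
suff key (f : A -> A) (C : R) : (forall n, f (u n) = 1 - y ^+ n) -> 0 < C ->
    (forall v w, cnorm (f v - f w) <= C * cnorm (v - w)) -> f l = 1.
  have C0 : 0 < cnorm (1 - y) + 1 by rewrite ltr_wpDl // cnorm_ge0.
  exists l; split.
    apply: (key (fun v => v * (1 - y)) (cnorm (1 - y) + 1)) => // v w.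
    rewrite -mulrBl mulrC; apply: le_trans (cnormM _ _) _.
    by rewrite ler_wpM2l ?cnorm_ge0 // lerDl.
  apply: (key (fun v => (1 - y) * v) (cnorm (1 - y) + 1)) => // v w.
  rewrite -mulrBr; apply: le_trans (cnormM _ _) _.
  by rewrite ler_wpM2r ?cnorm_ge0 // lerDl.
move=> hf C0 hC; apply/eqP; rewrite -subr_eq0 -cnorm_eq0 eq_le cnorm_ge0 andbT.
apply/ler_addgt0Pr => e e0; rewrite add0r.
have [N1 h1] := hl _ (divr_gt0 (divr_gt0 e0 (ltr0n R 2)) C0).
have [N2 h2] := geometric_small y0 y1 (divr_gt0 e0 (ltr0n R 2)).
pose n := maxn N1 N2.
have -> : f l - 1 = (f l - f (u n)) - y ^+ n by rewrite hf; rewrite opprB addrA addrAC addrK.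
apply: le_trans (cnormB _ _) _; rewrite [leRHS](splitr e); apply: lerD.
  apply: le_trans (hC _ _) _; rewrite -cnormN opprB mulrC.
  by rewrite -ler_pdivlMr // ltW // h1 // leq_maxl.
apply: le_trans (cnormX _ _) _; apply: le_trans (ltW h2).
by apply: ler_wiXn2l (leq_maxr _ _) => //; exact: ltW.
Qed.

Lemma spectrumE a z : spectrum a z <-> ~ invertible (z%:A - a).
Proof. by []. Qed.

Lemma spectrum_le a c : spectrum a (rc c) -> `|c| <= cnorm a.
Proof.
move=> /spectrumE hs; rewrite leNgt; apply/negP => lt; apply: hs.
have c0 : c != 0 by apply: contraTneq lt => ->; rewrite normr0 -leNgt cnorm_ge0.
have rc0 : (rc c : R[i]) != 0 by rewrite fmorph_eq0.
have -> : (rc c)%:A - a = rc c *: (1 - (rc c)^-1 *: a).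
  by rewrite scalerBr scalerA divff // scale1r.
apply: invertibleZ => //; apply: neumann.
by rewrite -fmorphV cnormZr normfV mulrC ltr_pdivrMr ?normr_gt0 // mul1r.
Qed.

Lemma cnorm_scalar z : cnorm (z%:A : A) = complex.Re `|z|.
Proof. by rewrite cnormZ cnorm1 mulr1. Qed.

Lemma star_scalar z : star (z%:A : A) = (z^*)%:A.
Proof. by rewrite starZ star1. Qed.

(* The Cayley transform [(v + i) (v - i)^-1 = 1 + 2 i h] is unitary. *)
Lemma invertible_subi v : selfadj v ->
  exists h, [/\ h * (v - 'i%:A) = 1, (v - 'i%:A) * h = 1 & cnorm h <= 1].
Proof.
move=> sv; set t := cnorm v ^+ 2.
have t0 : 0 <= t by rewrite exprn_ge0 // cnorm_ge0.
(* A Neumann series around [- i] would require [|v| < 1]. Moving the centre to [- i (1 + t)] with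
   [t = |v|^2] works for every [v]: the remainder [y = v + i t] has [|y|^2 = |v^2 + t^2| <= t + t^2
   < (1 + t)^2]. *)
set w := ('i * rc (1 + t) : R[i]).
have t1 : 0 < 1 + t by rewrite ltr_pwDl.
have w0 : w != 0 by rewrite mulf_neq0 ?neq0Ci // fmorph_eq0 gt_eqF.
have Nw : complex.Re `|w^-1| = (1 + t)^-1.
  by rewrite normfV normrM normCi mul1r normc_rc -fmorphV ger0_norm // ltW.
set y := v + ('i * rc t)%:A.
have Ny : cnorm y < 1 + t.
  rewrite -(ltr_pXn2r (_ : 0 < 2)%N) ?nnegrE ?cnorm_ge0 ?(ltW t1) //.
  have -> : cnorm y ^+ 2 = cnorm (v * v + (rc (t ^+ 2))%:A).
    rewrite -cstar_identity /y starD sv star_scalar rmorphM /= conjCi conj_rc.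
    congr cnorm; rewrite mulrDl !mulrDr -!scalerAr -!scalerAl !mul1r !mulr1.
    rewrite -addrA; congr (_ + _); rewrite addrA -scalerDl mulNr addrN.
    rewrite scale0r add0r scalerA; congr (_ *: _).
    by rewrite mulrN mulrACA mulCii mulN1r opprK -rmorphM -expr2.
  apply: le_lt_trans (cnormD _ _) _.
  rewrite cnorm_scalar norm_rc (selfadj_sq sv) -/t ger0_norm ?(exprn_ge0 _ t0) //.
  by rewrite sqrrD expr1n mul1r; nra.
have e : v - 'i%:A = - w *: (1 - w^-1 *: y).
  rewrite scaleNr -scalerN opprB scalerBr scalerA divff // scale1r /y.
  rewrite -addrA; congr (_ + _); rewrite -!scaleNr -scalerDl; congr (_ *: _).
  by rewrite /w rmorphD rmorph1; ring.
have [h [h1 h2]] : invertible (v - 'i%:A).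
  rewrite e; apply: invertibleZ; first by rewrite oppr_eq0.
  by apply: neumann; rewrite cnormZ Nw mulrC ltr_pdivrMr // mul1r.
exists h; split => //.
set u := (v + 'i%:A) * h.
have hu : u = 1 + (2 * 'i) *: h.
  have e2 : v + 'i%:A = v - 'i%:A + (2 * 'i)%:A.
    by rewrite -addrA -scaleNr -scalerDl; congr (_ + _ *: _); ring.
  by rewrite /u e2 mulrDl h2 mulr_algl.
have u1 : cnorm u = 1.
  apply/eqP; rewrite -(eqrXn2 (ltn0Sn 1)) ?cnorm_ge0 // expr1n -cstar_identity.
  rewrite /u starM starD sv star_scalar conjCi scaleNr -mulrA (mulrA _ (v + _) h).
  have -> : (v - 'i%:A) * (v + 'i%:A) = (v + 'i%:A) * (v - 'i%:A).
    rewrite mulrDr [RHS]mulrDl mulr_algl mulr_algr; congr (_ + _).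
    by rewrite mulrBl mulrBr mulr_algl mulr_algr.
  rewrite -mulrA h2 mulr1.
  have -> : star h * (v + 'i%:A) = star ((v - 'i%:A) * h).
    by rewrite starM starB sv star_scalar conjCi scaleNr opprK.
  by rewrite h2 star1 cnorm1.
have : cnorm ((2 * 'i) *: h) <= 2.
  have -> : (2 * 'i) *: h = u - 1 by rewrite hu addrAC subrr add0r.
  by apply: le_trans (cnormB _ _) _; rewrite u1 cnorm1.
rewrite cnormZ normrM normCi mulr1.
have -> : complex.Re `|2 : R[i]| = 2.
  have -> : (2 : R[i]) = rc 2 by rewrite rmorph_nat.
  by rewrite norm_rc ger0_norm.
by move=> h3; rewrite -(ler_pM2l (ltr0n R 2)) mulr1.
Qed.

(** [1 + v^2] factors as [(v - i) (v + i)], so [star h * h] inverts it when [h] inverts [v - i]; the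
    C*-identity squares the bound on [h]. *)
Lemma invertible_sq1 v : selfadj v ->
  exists g, [/\ g * (1 + v * v) = 1, (1 + v * v) * g = 1 & cnorm g <= 1].
Proof.
move=> sv; have [h [h1 h2 h3]] := invertible_subi sv.
have h1' : (v + 'i%:A) * star h = 1.
  transitivity (star (h * (v - 'i%:A))); last by rewrite h1 star1.
  by rewrite starM starB sv star_scalar conjCi scaleNr opprK.
have h2' : star h * (v + 'i%:A) = 1.
  transitivity (star ((v - 'i%:A) * h)); last by rewrite h2 star1.
  by rewrite starM starB sv star_scalar conjCi scaleNr opprK.
have e1 : 1 + v * v = (v - 'i%:A) * (v + 'i%:A).
  rewrite mulrBl !mulrDr -!scalerAr -!scalerAl !mul1r !mulr1 scalerA.
  by rewrite mulCii scaleN1r opprD opprK addrA addrK addrC.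
exists (star h * h); split.
- by rewrite e1 -mulrA (mulrA h) h1 mul1r h2'.
- by rewrite e1 -mulrA (mulrA _ (star h)) h1' mul1r h2.
- by rewrite cstar_identity expr2 mulr_ile1 ?cnorm_ge0.
Qed.

(** For [z = p + i q] with [q != 0], [z - a] is [- q] times [v - i] with [v = (a - p) / q]
    self-adjoint, and [invertible_subi] inverts the latter. *)
Lemma spectrum_real a z : selfadj a -> spectrum a z -> z = rc (complex.Re z).
Proof.
move=> sa; case: z => p q /spectrumE hs.
have [->|q0] := eqVneq q 0; first by [].
exfalso; apply: hs; set z := (p +i* q)%C.
have ez : z = rc p + 'i * rc q by rewrite [LHS]complexE.
pose v := rc q^-1 *: (a - (rc p)%:A).
have sv : selfadj v by apply/selfadjZ/selfadjB => //; exact: selfadj_rc.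
have [h [h1 h2 _]] := invertible_subi sv.
have rq0 : (rc q : R[i]) != 0 by rewrite fmorph_eq0.
have -> : z%:A - a = - rc q *: (v - 'i%:A).
  rewrite scalerBr /v scalerA mulNr fmorphV divff // scaleN1r opprB scalerA.
  by rewrite ez scalerDl mulNr scaleNr opprK (mulrC 'i) addrAC.
by apply: invertibleZ; [rewrite oppr_eq0|exists h].
Qed.

End Norm.

(** * Polynomials in a self-adjoint element and the spectral radius *)

Section Polynomial.
Variables (R : realType) (A : cstarAlgType R).
Implicit Types (a : A) (P Q : {poly R}).

Lemma poly_atD P Q a : poly_at (P + Q) a = poly_at P a + poly_at Q a.
Proof. by rewrite /poly_at !rmorphD. Qed.

Lemma poly_atB P Q a : poly_at (P - Q) a = poly_at P a - poly_at Q a.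
Proof. by rewrite /poly_at !rmorphB. Qed.

Lemma poly_atM P Q a : poly_at (P * Q) a = poly_at P a * poly_at Q a.
Proof. by rewrite /poly_at !rmorphM. Qed.

Lemma poly_at0 a : poly_at 0 a = 0.
Proof. by rewrite /poly_at !rmorph0. Qed.

Lemma poly_at1 a : poly_at 1 a = 1.
Proof. by rewrite /poly_at !rmorph1. Qed.

Lemma poly_atX a : poly_at 'X a = a.
Proof. by rewrite /poly_at map_polyX horner_algX. Qed.

Lemma poly_atC (c : R) a : poly_at c%:P a = (rc c)%:A.
Proof. by rewrite /poly_at map_polyC horner_algC. Qed.

Lemma poly_atZ (c : R) P a : poly_at (c *: P) a = rc c *: poly_at P a.
Proof. by rewrite -mul_polyC poly_atM poly_atC mulr_algl. Qed.

Lemma poly_atXn P a n : poly_at (P ^+ n) a = poly_at P a ^+ n.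
Proof. by rewrite /poly_at !rmorphXn. Qed.

Lemma poly_at_sum (I : Type) (r : seq I) (S : pred I) (F : I -> {poly R}) a :
  poly_at (\sum_(i <- r | S i) F i) a = \sum_(i <- r | S i) poly_at (F i) a.
Proof. by rewrite /poly_at !rmorph_sum. Qed.

Lemma poly_atC_comm P Q a :
  poly_at P a * poly_at Q a = poly_at Q a * poly_at P a.
Proof. by rewrite -!poly_atM mulrC. Qed.

Lemma poly_at_comp P Q a : poly_at (P \Po Q) a = poly_at P (poly_at Q a).
Proof.
elim/poly_ind: P => [|P c IH]; first by rewrite comp_poly0 !poly_at0.
rewrite comp_poly_MXaddC !poly_atD !poly_atM IH !poly_atC poly_atX.
by [].
Qed.

Lemma poly_at_comm P a b : a * b = b * a -> poly_at P a * b = b * poly_at P a.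
Proof.
move=> h; elim/poly_ind: P => [|P c IH]; first by rewrite !poly_at0 mulr0 mul0r.
rewrite poly_atD poly_atM poly_atX poly_atC mulrDl mulrDr.
by rewrite -mulrA h mulrA IH -mulrA mulr_algl mulr_algr.
Qed.

Lemma selfadj_poly P a : selfadj a -> selfadj (poly_at P a).
Proof.
move=> sa; elim/poly_ind: P => [|P c IH]; first by rewrite poly_at0 /selfadj star0.
rewrite poly_atD poly_atC; apply: selfadjD; last exact: selfadj_rc.
by rewrite /selfadj mulrC {1}poly_atM starM IH poly_atX sa -{2}(poly_atX a) -poly_atM mulrC.
Qed.

(* [P(a)] is the real part of the normal element [P(a) + i Q(a)]. *)
Lemma cnorm_poly_sumsq P Q a : selfadj a ->
  cnorm (poly_at P a) ^+ 2 <= cnorm (poly_at (P * P + Q * Q) a).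
Proof.
move=> sa; set p := poly_at P a; set q := poly_at Q a.
have sp : selfadj p by exact: selfadj_poly.
have sq : selfadj q by exact: selfadj_poly.
pose c := p + 'i *: q.
have sc : star c = p - 'i *: q by rewrite starD starZ conjCi sp sq scaleNr.
have -> : poly_at (P * P + Q * Q) a = star c * c.
  rewrite poly_atD !poly_atM -/p -/q sc mulrBl !mulrDr -!scalerAr -!scalerAl.
  rewrite scalerA mulCii scaleN1r /p /q (poly_atC_comm Q P) opprD opprK addrA.
  by rewrite addrK.
rewrite cstar_identity ler_sqr ?nnegrE ?cnorm_ge0 //.
have : cnorm (rc 2 *: p) <= 2 * cnorm c.
  have -> : rc 2 *: p = c + star c.
    by rewrite sc addrCA addrK rmorph_nat scaler_nat.
  apply: le_trans (cnormD _ _) _.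
  by rewrite cnorm_star mulr_natl mulr2n.
by rewrite cnormZr ger0_norm // ler_pM2l.
Qed.

(** The companion [sqrt 2 X] is chosen for [(1 - X^2)^2 + 2 X^2 = 1 + X^4]. Spectral theory would
    give the bound 1 but rests on this lemma; [sqrt 2 < 2] is enough for [not_invertible_1Bsq]. *)
Lemma cnorm_1Bsq (v : A) : selfadj v -> cnorm v <= 1 -> cnorm (1 - v * v) ^+ 2 <= 2.
Proof.
move=> sv v1.
have := @cnorm_poly_sumsq (1 - 'X * 'X) (Num.sqrt 2 *: 'X) v sv.
rewrite poly_atB poly_at1 poly_atM poly_atX => /le_trans; apply.
have -> : (1 - 'X * 'X) * (1 - 'X * 'X)
    + (Num.sqrt 2 *: 'X) * (Num.sqrt 2 *: 'X) = 1 + 'X ^+ 4 :> {poly R}.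
  rewrite -scalerAl -scalerAr scalerA -[Num.sqrt 2 * _]expr2 sqr_sqrtr //.
  by rewrite (_ : 2 *: _ = 'X * 'X + 'X * 'X); [ring | rewrite scaler_nat mulr2n].
rewrite poly_atD poly_at1 poly_atXn poly_atX.
apply: le_trans (cnormD _ _) _; rewrite cnorm1 [leRHS](_ : 2 = 1 + 1) // lerD2l.
by apply: le_trans (cnormX _ _) _; rewrite exprn_ile1 ?cnorm_ge0.
Qed.

Lemma cnorm_1Dsq (v : A) : selfadj v -> 2 * cnorm v <= cnorm (1 + v * v).
Proof.
move=> sv.
have := @cnorm_poly_sumsq (2 *: 'X) (1 - 'X * 'X) v sv.
have -> : 2 *: 'X * (2 *: 'X) + (1 - 'X * 'X) * (1 - 'X * 'X)
    = (1 + 'X * 'X) * (1 + 'X * 'X) :> {poly R}.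
  by rewrite scaler_nat; ring.
rewrite poly_atM poly_atZ poly_atD poly_at1 poly_atM poly_atX.
rewrite selfadj_sq; last by apply: selfadjD; rewrite /selfadj ?star1 ?starM ?sv.
by rewrite ler_sqr ?nnegrE ?cnorm_ge0 // cnormZr ger0_norm.
Qed.

(* If [1 - x x] had an inverse, the inverses [d_n] of [1 - x ^+ (2 ^ n)] would
   satisfy [d_(n+1) = (d_n + (1 + x ^+ (2 ^ n))^-1) / 2], so their norms would
   get close to [1], while [2 <= |1 + x ^+ (2 ^ n)| <= sqrt 2 * |d_n|]. *)
Lemma not_invertible_1Bsq (x : A) :
  selfadj x -> cnorm x = 1 -> ~ invertible (1 - x * x).
Proof.
move=> sx x1 [d0 [h1 h2]].
pose v n := x ^+ (2 ^ n).
have sv n : selfadj (v n) by exact: selfadjX.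
have vS n : v n.+1 = v n * v n by rewrite /v expnS mulnC exprM expr2.
have v1 n : cnorm (v n) = 1.
  by elim: n => [//|n IH]; rewrite vS selfadj_sq // IH expr1n.
have key n : exists d, [/\ d * (1 - v n * v n) = 1, (1 - v n * v n) * d = 1 &
    cnorm d <= 1 + cnorm d0 / 2 ^+ n].
  elim: n => [|n [d [e1 e2 e3]]].
    by exists d0; rewrite expr0 divr1 lerDr ler01.
  have [g [f1 f2 f3]] := invertible_sq1 (sv n).
  exists (rc (1/2) *: (d + g)); rewrite vS.
  have q1 : 1 - v n * v n * (v n * v n) = (1 + v n * v n) * (1 - v n * v n).
    by rewrite mulrBr mulr1 mulrDl mul1r opprD addrA addrK.
  have q2 : 1 - v n * v n * (v n * v n) = (1 - v n * v n) * (1 + v n * v n).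
    by rewrite mulrDr mulr1 mulrBl mul1r addrA subrK.
  have half : rc (1/2) *: ((1 + v n * v n) + (1 - v n * v n)) = 1 :> A.
    rewrite addrACA subrr addr0 scalerDr -scalerDl -rmorphD.
    by rewrite (_ : 1/2 + 1/2 = 1) ?rmorph1 ?scale1r //; lra.
  split.
  - rewrite -scalerAl -[RHS]half mulrDl {1}q2 {1}q1 !mulrA e1 f1 !mul1r.
    by [].
  - rewrite -scalerAr -[RHS]half mulrDr {1}q1 {1}q2 -!mulrA e2 f2 !mulr1.
    by [].
  - rewrite cnormZr ger0_norm //.
    apply: le_trans (ler_wpM2l _ (cnormD _ _)) _ => //.
    apply: le_trans (ler_wpM2l _ (lerD e3 f3)) _ => //.
    rewrite exprS invfM; set z := cnorm d0 / 2 ^+ n.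
    have -> : cnorm d0 * (2^-1 * (2 ^+ n)^-1) = z / 2 by rewrite /z; ring.
    by lra.
(* The threshold has to be below [sqrt 2 - 1]: with [1 / 4], [|d_N| < 5 / 4] and
   [sqrt 2 * 5 / 4 < 2]. *)
have [N hN] : exists N, cnorm d0 / 2 ^+ N < 1 / 4.
  have d00 : 0 < cnorm d0 + 1 by rewrite ltr_wpDl ?cnorm_ge0.
  have [N hN] := @geometric_small R (1/2) (1 / 4 / (cnorm d0 + 1)) ltac:(lra) ltac:(lra)
    ltac:(by rewrite !divr_gt0).
  exists N; move: hN; rewrite ltr_pdivlMr // expr_div_n expr1n !div1r mulrC.
  by apply: le_lt_trans; rewrite ler_wpM2r ?invr_ge0 ?exprn_ge0 // lerDl.
have [d [e1 e2 e3]] := key N.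
have n1 := cnorm_1Dsq (sv N).
have e4 : 1 + v N * v N = (1 - v N.+1 * v N.+1) * d.
  rewrite vS; have -> : 1 - v N * v N * (v N * v N) = (1 + v N * v N) * (1 - v N * v N).
    by rewrite mulrBr mulr1 mulrDl mul1r opprD addrA addrK.
  by rewrite -mulrA e2 mulr1.
have n2 : cnorm (1 - v N.+1 * v N.+1) ^+ 2 <= 2 by apply: cnorm_1Bsq; rewrite ?v1.
have := cnormM (1 - v N.+1 * v N.+1) d; rewrite -e4.
move: n1 n2; rewrite v1; set s := cnorm (1 - _); set t := cnorm (1 + _).
have s0 : 0 <= s by exact: cnorm_ge0.
have d00 : 0 <= cnorm d by exact: cnorm_ge0.
move: e3 hN; set w := cnorm d0 / _; set dd := cnorm d in d00 *.
move=> e3 hN n1 n2 n3.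
have : 4 <= (s * dd) ^+ 2 by nra.
rewrite exprMn.
have : dd ^+ 2 <= 25 / 16 by nra.
have : 0 <= dd ^+ 2 by rewrite sqr_ge0.
have : 0 <= s ^+ 2 by rewrite sqr_ge0.
nra.
Qed.

(** If neither 1 nor -1 were in the spectrum of the normalised element [x], then
    [1 - x x = (1 - x) (1 + x)] would be invertible. In particular the spectrum is not empty, which
    [spectral_mapping] uses for constant polynomials. *)
Lemma spectral_radius a : selfadj a ->
  exists2 l : R, spectrum a (rc l) & `|l| = cnorm a.
Proof.
move=> sa; have [a0|a0] := eqVneq a 0.
  exists 0; last by rewrite a0 normr0 cnorm0.
  apply/spectrumE; rewrite a0 rmorph0 scale0r subr0 => -[b [_]].
  by rewrite mul0r => /esym/eqP; rewrite oner_eq0.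
set t := cnorm a; have t0 : 0 < t by rewrite cnorm_gt0.
pose x := rc t^-1 *: a.
have sx : selfadj x by exact: selfadjZ.
have x1 : cnorm x = 1.
  by rewrite cnormZr ger0_norm ?invr_ge0 ?ltW // mulVf // gt_eqF.
have rt0 : (rc t : R[i]) != 0 by rewrite fmorph_eq0 gt_eqF.
have ax : a = rc t *: x by rewrite scalerA fmorphV divff // scale1r.
have [h1|h1] := pselect (invertible (1 - x)); last first.
  exists t; last by rewrite ger0_norm // ltW.
  apply/spectrumE => h; apply: h1.
  have -> : 1 - x = rc t^-1 *: ((rc t)%:A - a).
    by rewrite /x scalerBr scalerA -rmorphM mulVf ?gt_eqF // rmorph1 scale1r.
  by apply: invertibleZ => //; rewrite fmorph_eq0 invr_eq0 gt_eqF.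
exists (- t); last by rewrite normrN ger0_norm // ltW.
apply/spectrumE => h.
have h2 : invertible (1 + x).
  have -> : 1 + x = (- rc t^-1) *: ((rc (- t))%:A - a).
    rewrite scalerBr scalerA !rmorphN mulrNN fmorphV mulVf // scale1r.
    by rewrite scaleNr opprK /x fmorphV.
  by apply: invertibleZ => //; rewrite oppr_eq0 fmorph_eq0 invr_eq0 gt_eqF.
apply: (not_invertible_1Bsq sx x1).
have -> : 1 - x * x = (1 - x) * (1 + x).
  by rewrite mulrBl mul1r mulrDr mulr1 opprD addrA addrK.
exact: invertibleM.
Qed.

End Polynomial.

(** * Spectrum, positivity and functional calculus *)

Section Spectrum.
Variables (R : realType) (A : cstarAlgType R).
Implicit Types (a b x y : A) (P Q : {poly R}) (s t m : R).

Lemma poly_at_CsubX m a : poly_at (m%:P - 'X) a = (rc m)%:A - a.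
Proof. by rewrite poly_atB poly_atC poly_atX. Qed.

Lemma horner_CsubX m t : (m%:P - 'X).[t] = m - t.
Proof. by rewrite hornerD hornerN hornerC hornerX. Qed.

Lemma spectrum_poly_at P a t :
  spectrum a (rc t) -> spectrum (poly_at P a) (rc P.[t]).
Proof.
move=> /spectrumE h; apply/spectrumE => hi; apply: h.
have /factor_theorem [Q hQ] : root (P - P.[t]%:P) t.
  by rewrite /root hornerD hornerN hornerC subrr.
have e : (rc P.[t])%:A - poly_at P a = ((rc t)%:A - a) * poly_at Q a.
  rewrite -(poly_atC P.[t] a) -poly_atB -opprB hQ -mulrN opprB mulrC.
  by rewrite poly_atM poly_atB poly_atC poly_atX.
apply: (@invertible_comm _ _ _ (poly_at Q a)); last by rewrite -e.
by rewrite -poly_at_CsubX poly_atC_comm.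
Qed.

Lemma invertible_prod (T : eqType) (r : seq T) (F : T -> A) :
  (forall z, z \in r -> invertible (F z)) -> invertible (\prod_(z <- r) F z).
Proof.
elim: r => [|z r IH] h; first by rewrite big_nil; exists 1; rewrite !mulr1.
rewrite big_cons; apply: invertibleM; first by apply: h; rewrite mem_head.
by apply: IH => w hw; apply: h; rewrite inE hw orbT.
Qed.

Lemma spectral_mapping P a s : selfadj a -> spectrum (poly_at P a) (rc s) ->
  exists2 t, spectrum a (rc t) & P.[t] = s.
Proof.
move=> sa /spectrumE hs.
have [P0|Q0] := eqVneq (P - s%:P) 0.
  have [l hl _] := spectral_radius sa; exists l => //.
  by move/eqP: P0; rewrite subr_eq0 => /eqP ->; rewrite hornerC.
pose Qc := map_poly rc (P - s%:P) : {poly R[i]}.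
have [r hr] := closed_field_poly_normal Qc.
have e : poly_at P a - (rc s)%:A = lead_coef Qc *: \prod_(z <- r) (a - z%:A).
  rewrite -(poly_atC s a) -poly_atB /poly_at -/Qc {1}hr linearZ rmorph_prod /=.
  rewrite mulr_algl; congr (_ *: _); apply: eq_bigr => z _.
  by rewrite rmorphB /= horner_algX horner_algC.
have : exists2 z, z \in r & spectrum a z.
  apply: contrapT => hz; apply: hs; rewrite -opprB e -scaleNr.
  apply: invertibleZ.
    by rewrite oppr_eq0 lead_coef_eq0 /Qc map_poly_eq0.
  apply: invertible_prod => z zr; apply: contrapT => hi; apply: hz.
  exists z => //; apply/spectrumE => hi'; apply: hi.
  by rewrite -opprB -scaleN1r; apply: invertibleZ; rewrite ?oppr_eq0 ?oner_eq0.
case=> z zr hz; have ez := spectrum_real sa hz.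
exists (complex.Re z); first by rewrite -ez.
have : root Qc z by rewrite hr rootZ ?lead_coef_eq0 /Qc ?map_poly_eq0 // root_prod_XsubC.
rewrite ez /root /Qc horner_map fmorph_eq0 hornerD hornerN hornerC subr_eq0.
by move=> /eqP.
Qed.

Lemma cnorm_poly_at P a : selfadj a ->
  exists2 t, spectrum a (rc t) & `|P.[t]| = cnorm (poly_at P a).
Proof.
move=> sa; have [l hl <-] := spectral_radius (selfadj_poly P sa).
by have [t ht <-] := spectral_mapping sa hl; exists t.
Qed.

Lemma eq_poly_at P Q a : selfadj a ->
  (forall t, spectrum a (rc t) -> P.[t] = Q.[t]) -> poly_at P a = poly_at Q a.
Proof.
move=> sa h; apply/eqP; rewrite -subr_eq0 -poly_atB -cnorm_eq0.
have [t /h ht <-] := cnorm_poly_at (P - Q) sa.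
by rewrite hornerD hornerN ht subrr normr0.
Qed.

(** Positivity read off the spectrum. Unlike [positive] it translates into a norm condition, hence
    is visibly stable under sums; [pos_mulss] shows that every [star y * y] satisfies it. *)
Definition pos a := selfadj a /\ forall t, spectrum a (rc t) -> 0 <= t.

Lemma pos_poly P a : selfadj a ->
  (forall t, spectrum a (rc t) -> 0 <= P.[t]) -> pos (poly_at P a).
Proof.
move=> sa h; split; first exact: selfadj_poly.
by move=> s /(spectral_mapping sa) [t /h ht <-].
Qed.

Lemma pos_sq a : selfadj a -> pos (a * a).
Proof.
move=> sa; have := @pos_poly ('X * 'X) a sa.
rewrite poly_atM poly_atX; apply => t _.
by rewrite hornerM hornerX -expr2 sqr_ge0.
Qed.

Lemma posZ s a : 0 <= s -> pos a -> pos (rc s *: a).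
Proof.
move=> s0 [sa h]; have := @pos_poly (s *: 'X) a sa.
rewrite poly_atZ poly_atX; apply => t /h ht.
by rewrite hornerZ hornerX mulr_ge0.
Qed.

Lemma pos_of_norm m a : selfadj a -> cnorm ((rc m)%:A - a) <= m -> pos a.
Proof.
move=> sa h; split=> // t ht.
have := spectrum_poly_at (P := m%:P - 'X) ht.
rewrite poly_at_CsubX horner_CsubX => /spectrum_le /le_trans /(_ h).
by rewrite ler_norml => /andP[_]; rewrite gerBl.
Qed.

Lemma norm_of_pos m a : pos a -> cnorm a <= m -> cnorm ((rc m)%:A - a) <= m.
Proof.
move=> [sa pa] h; rewrite -poly_at_CsubX.
have [t ht <-] := cnorm_poly_at (m%:P - 'X) sa; rewrite horner_CsubX.
have t0 := pa _ ht; have := le_trans (spectrum_le ht) h.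
rewrite ger0_norm // => tm; rewrite ger0_norm ?subr_ge0 //.
by rewrite gerBl.
Qed.

(** By [norm_of_pos] and [pos_of_norm], a self-adjoint [a] with [|a| <= m] is positive exactly when
    [|m - a| <= m], and this condition adds up by the triangle inequality. *)
Lemma posD a b : pos a -> pos b -> pos (a + b).
Proof.
move=> pa pb; apply: (@pos_of_norm (cnorm a + cnorm b)).
  by apply: selfadjD; [case: pa|case: pb].
rewrite rmorphD scalerDl opprD addrACA; apply: le_trans (cnormD _ _) _.
by apply: lerD; apply: norm_of_pos.
Qed.

Lemma pos0 : pos (0 : A).
Proof. by rewrite -(mulr0 (0 : A)); apply: pos_sq; exact: star0. Qed.

Lemma pos_sum (I : Type) (r : seq I) (S : pred I) (F : I -> A) :
  (forall i, pos (F i)) -> pos (\sum_(i <- r | S i) F i).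
Proof.
by move=> h; elim/big_rec: _ => [|i x _ hx]; [exact: pos0|exact: posD].
Qed.

Lemma pos_scalar (z : R[i]) : pos (z%:A : A) -> 0 <= z.
Proof.
move=> [sz h].
have ez : z = rc (complex.Re z).
  apply: (spectrum_real sz); apply/spectrumE; rewrite subrr => -[b []].
  by rewrite mulr0 => /esym/eqP; rewrite oner_eq0.
have /h : spectrum (z%:A : A) (rc (complex.Re z)).
  apply/spectrumE; rewrite -ez subrr => -[b []].
  by rewrite mulr0 => /esym/eqP; rewrite oner_eq0.
by rewrite ez /= lecR.
Qed.

Lemma pos_le_norm m a : pos a -> pos ((rc m)%:A - a) -> cnorm a <= m.
Proof.
move=> [sa pa] [_ pb]; have [t ht <-] := spectral_radius sa.
have := spectrum_poly_at (P := m%:P - 'X) ht.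
rewrite poly_at_CsubX horner_CsubX => /pb; rewrite subr_ge0.
by rewrite ger0_norm // pa.
Qed.

Lemma norm_sub_pos a : selfadj a -> pos ((rc (cnorm a))%:A - a).
Proof.
move=> sa; rewrite -poly_at_CsubX; apply: pos_poly => // t /spectrum_le.
by rewrite horner_CsubX subr_ge0; apply: le_trans; exact: ler_norm.
Qed.

Lemma pos_antisym a : pos a -> pos (- a) -> a = 0.
Proof.
move=> pa pb; apply/eqP; rewrite -cnorm_eq0 eq_le cnorm_ge0 andbT.
by apply: pos_le_norm => //; rewrite rmorph0 scale0r add0r.
Qed.

Lemma poly_at_intertwine P x y z : x * y = y * z ->
  poly_at P x * y = y * poly_at P z.
Proof.
move=> h; elim/poly_ind: P => [|P c IH]; first by rewrite !poly_at0 mulr0 mul0r.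
rewrite !poly_atD !poly_atM !poly_atX !poly_atC mulrDl mulrDr.
by rewrite -mulrA h mulrA IH -mulrA mulr_algl mulr_algr.
Qed.

(** [h] and [k] are, up to sign, twice the real and the imaginary part of [z]; in [h h + k k] the
    terms [z z] and [star z * star z] cancel. *)
Lemma pos_mulss_add z : pos (star z * z + z * star z).
Proof.
pose h := z + star z; pose k := 'i *: (z - star z).
have sh : selfadj h by rewrite /selfadj /h starD starK addrC.
have sk : selfadj k.
  by rewrite /selfadj /k starZ conjCi starB starK scaleNr -scalerN opprB.
have -> : star z * z + z * star z = rc (1 / 2) *: (h * h + k * k).
  have -> : h * h + k * k = rc 2 *: (star z * z + z * star z).
    rewrite /h /k -scalerAl -scalerAr scalerA mulCii scaleN1r rmorph_nat.
    set X := z * z + star z * star z; set Y := star z * z + z * star z.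
    have -> : (z + star z) * (z + star z) = X + Y.
      rewrite mulrDl !mulrDr /X /Y [in RHS](addrC (star z * z)) [in RHS]addrACA.
      by rewrite [in RHS](addrC (star z * star z)).
    have -> : (z - star z) * (z - star z) = X - Y.
      rewrite mulrBl !mulrBr opprB /X /Y opprD -!addrA; congr (_ + _).
      by rewrite addrC -addrA; congr (_ + _); rewrite addrC.
    by rewrite opprB addrC addrA subrK scaler_nat mulr2n.
  by rewrite scalerA -rmorphM divrK ?unitfE // scale1r.
by apply: posZ; [rewrite divr_ge0|apply: posD; apply: pos_sq].
Qed.

(* If [t0 < 0] were in the spectrum of [a = y^* y], then [z = y P(a)] with
   [P = ((|a| - X) / (|a| - t0)) ^+ N] makes both [z^* z] and [z z^*] smaller
   than [- t0 / 2], while [t0] is in the spectrum of [z^* z]; but the sum of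
   [z^* z] and [z z^*] is a sum of two squares. *)
Lemma pos_mulss y : pos (star y * y).
Proof.
split=> [|t0 ht0]; first exact: selfadj_mulss.
rewrite leNgt; apply/negP => t0neg.
set a := star y * y in ht0; set b := y * star y.
have sa : selfadj a by exact: selfadj_mulss.
have sb : selfadj b by rewrite /selfadj starM starK.
set c := cnorm a.
have cb : cnorm b = c.
  by rewrite /c /b -{1}(starK y) !cstar_identity cnorm_star.
have c0 : 0 < c.
  by apply: lt_le_trans (spectrum_le ht0); rewrite normr_gt0 lt_eqF.
have d0 : 0 < c - t0 by rewrite subr_gt0 (lt_trans t0neg).
have [N hN] : exists N, (c / (c - t0)) ^+ N < - t0 / 2 / c.
  apply: geometric_small.
  - by rewrite divr_ge0 // ltW.
  - by rewrite ltr_pdivrMr // mul1r ltrBrDl gtrDr.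
  - by rewrite !divr_gt0 // oppr_gt0.
pose P : {poly R} := ((c - t0)^-1 *: (c%:P - 'X)) ^+ N.
have hP t : P.[t] = ((c - t) / (c - t0)) ^+ N.
  by rewrite /P horner_exp hornerZ horner_CsubX mulrC.
have small x : selfadj x -> cnorm x = c ->
    pos ((rc (- t0 / 2))%:A - poly_at ('X * P * P) x).
  move=> sx cx; rewrite -(poly_atC _ x) -poly_atB; apply: pos_poly => // t ht.
  rewrite hornerD hornerN hornerC !hornerM hornerX subr_ge0.
  have [t1|t1] := leP t 0.
    apply: (@le_trans _ _ 0); last by rewrite divr_ge0 // oppr_ge0 ltW.
    by rewrite -mulrA -expr2 mulr_le0_ge0 // sqr_ge0.
  have tc : t <= c by rewrite -cx; apply: le_trans (spectrum_le ht); exact: ler_norm.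
  have P0 : 0 <= P.[t] by rewrite hP exprn_ge0 // divr_ge0 ?(ltW d0) // subr_ge0.
  have P1 : P.[t] <= (c / (c - t0)) ^+ N.
    have [c1 d1 t0c] : [/\ 0 <= c, 0 <= c - t0 & t0 <= c].
      by split; apply/ltW => //; exact: lt_trans c0.
    rewrite hP lerXn2r ?nnegrE ?divr_ge0 ?subr_ge0 //.
    by rewrite ler_pM2r ?invr_gt0 // gerBl ltW.
  have P2 : P.[t] <= 1.
    rewrite hP; apply: exprn_ile1.
      by rewrite divr_ge0 ?(ltW d0) // subr_ge0.
    by rewrite ler_pdivrMr // mul1r lerB // (le_trans (ltW t0neg)) // ltW.
  have P3 : P.[t] * c <= - t0 / 2.
    by rewrite -ler_pdivlMr //; apply: le_trans P1 (ltW hN).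
  by nra.
pose z := y * poly_at P a.
have e1 : star z * z = poly_at ('X * P * P) a.
  rewrite /z starM (selfadj_poly P sa) !mulrA -(mulrA _ (star y)) -/a.
  by rewrite !poly_atM poly_atX -(poly_at_comm P (erefl (a * a))).
have e2 : z * star z = poly_at ('X * P * P) b.
  have yab : y * poly_at P a = poly_at P b * y.
    by rewrite (@poly_at_intertwine P b y a) // /a /b mulrA.
  rewrite /z starM (selfadj_poly P sa) yab !mulrA -(mulrA _ y) yab !mulrA.
  rewrite -(mulrA _ y) -/b !poly_atM poly_atX.
  by rewrite -mulrA !(poly_at_comm P (erefl (b * b))) mulrA (poly_at_comm P (erefl (b * b))).
(* In order terms [star z * z >= - z * star z >= t0 / 2], whereas [t0 < t0 / 2] is in the spectrum
   of [star z * z]. *)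
have pX : pos (poly_at ((- t0 / 2)%:P + 'X * P * P) a).
  have := posD (pos_mulss_add z) (small b sb cb).
  by rewrite e1 e2 addrA addrAC addrK poly_atD poly_atC addrC.
have := pX.2 _ (spectrum_poly_at ht0).
rewrite hornerD hornerC !hornerM hornerX hP divff ?gt_eqF // expr1n !mulr1.
lra.
Qed.

Lemma pos_positive a : positive a -> pos a.
Proof. by move=> [y ->]; exact: pos_mulss. Qed.

(** For self-adjoint central [b] and a spectral point [t], the closed ideal generated by [w = t - b]
    is proper: some [w c] at distance less than 1 from 1 would be invertible, and [w] with it. By
    simplicity the ideal is zero. General [b] is treated through its real and imaginary parts. *)
Lemma center_of_simple : simple_cstar A ->
  forall b, (forall x, b * x = x * b) -> exists z : R[i], b = z%:A.
Proof.
move=> simA; suff H b : selfadj b -> (forall x, b * x = x * b) ->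
    exists t, b = (rc t)%:A.
  move=> b hb; have hb' x : star b * x = x * star b.
    by apply: star_inj; rewrite !starM starK hb.
  have [t ht] : exists t, b + star b = (rc t)%:A.
    apply: H; first by rewrite /selfadj starD starK addrC.
    by move=> x; rewrite mulrDl mulrDr hb hb'.
  have [s hs] : exists s, 'i *: (b - star b) = (rc s)%:A.
    apply: H.
      by rewrite /selfadj starZ conjCi starB starK scaleNr -scalerN opprB.
    by move=> x; rewrite -scalerAl -scalerAr mulrBl mulrBr hb hb'.
  exists (rc (1/2) * (rc t - 'i * rc s)); rewrite -scalerA scalerBl -ht -scalerA -hs.
  rewrite scalerA mulCii scaleN1r opprK addrACA subrr addr0.
  rewrite scalerDr -scalerDl -rmorphD (_ : 1/2 + 1/2 = 1) ?rmorph1 ?scale1r //.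
  by lra.
move=> sb hb; have [t ht _] := spectral_radius sb; exists t.
set w := (rc t)%:A - b.
have hw x : w * x = x * w by rewrite mulrBl mulrBr mulr_algl mulr_algr hb.
(* Since [w] is central, the closure of [w A] is already two-sided. *)
pose I : set A := [set x | forall eps : R, 0 < eps ->
  exists c, cnorm (x - w * c) < eps].
have Iw x : I (w * x) by move=> e e0; exists x; rewrite subrr cnorm0.
have : I = [set 0] \/ I = setT.
  apply: simA.
    move=> x hx e e0; have e20 : 0 < e / 2 by rewrite divr_gt0.
    have [y Iy xy] := hx _ e20; have [c hc] := Iy _ e20; exists c.
    rewrite -(subrK y x) -addrA; apply: le_lt_trans (cnormD _ _) _.
    by rewrite (splitr e) ltrD.
  split=> [e e0|x y Ix Iy e e0|x y z Iy e e0].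
  - by exists 0; rewrite mulr0 subrr cnorm0.
  - have e20 : 0 < e / 2 by rewrite divr_gt0.
    have [c hc] := Ix _ e20; have [d hd] := Iy _ e20; exists (c + d).
    rewrite mulrDr opprD addrACA; apply: le_lt_trans (cnormD _ _) _.
    by rewrite (splitr e) ltrD.
  - have x0 : 0 < cnorm x + 1 by rewrite ltr_wpDl ?cnorm_ge0.
    have z0 : 0 < cnorm z + 1 by rewrite ltr_wpDl ?cnorm_ge0.
    have [c hc] := Iy _ (divr_gt0 (divr_gt0 e0 x0) z0).
    exists (x * c * z).
    have -> : w * (x * c * z) = x * (w * c) * z by rewrite !mulrA hw.
    rewrite -mulrBl -mulrBr.
    apply: le_lt_trans (cnormM _ _) _.
    apply: (@le_lt_trans _ _ ((cnorm x + 1) * cnorm (y - w * c) * (cnorm z + 1))).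
      apply: ler_pM; rewrite ?cnorm_ge0 ?lerDl //.
      apply: le_trans (cnormM _ _) _.
      by apply: ler_pM; rewrite ?cnorm_ge0 ?lerDl.
    by rewrite -ltr_pdivlMr // mulrC -ltr_pdivlMr // mulrAC.
case=> hI.
  have : I w by rewrite -(mulr1 w); exact: Iw.
  by rewrite hI /= /w => /eqP; rewrite subr_eq0 => /eqP.
exfalso; have /(_ 1 ltr01) [c hc] : I 1 by rewrite hI.
move/spectrumE: ht; apply; rewrite -/w.
apply: (@invertible_comm _ _ _ c); first exact: hw.
by rewrite -[w * c](subKr 1); apply: neumann.
Qed.

End Spectrum.

(** * Functional calculus on a finite spectrum *)

Section FunctionalCalculus.
Variables (R : realType) (A : cstarAlgType R).
Implicit Types (a b : A) (s : seq R) (f : R -> R).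

Lemma is_funcalc_uniq f a b b' : selfadj a ->
  is_funcalc f a b -> is_funcalc f a b' -> b = b'.
Proof.
move=> sa h h'; apply/eqP; rewrite -subr_eq0 -cnorm_eq0 eq_le cnorm_ge0 andbT.
apply/ler_addgt0Pr => e e0; rewrite add0r.
have e4 : 0 < e / 4 by rewrite divr_gt0.
have [P [hP nP]] := h _ e4; have [Q [hQ nQ]] := h' _ e4.
have -> : b - b' = - (poly_at P a - b) + poly_at (P - Q) a + (poly_at Q a - b').
  by rewrite poly_atB opprB !subrKA.
have n3 : cnorm (poly_at (P - Q) a) <= e / 4 + e / 4.
  have [t ht <-] := cnorm_poly_at (P - Q) sa.
  rewrite hornerD hornerN -(subrKA (f t)); apply: le_trans (ler_normD _ _) _.
  by apply: lerD; [exact: hP|rewrite distrC; exact: hQ].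
apply: le_trans (cnormD _ _) _; apply: le_trans (lerD (cnormD _ _) nQ) _.
rewrite cnormN; lra.
Qed.

Definition finspec a s := uniq s /\ forall t : R, spectrum a (rc t) <-> t \in s.

(** Evaluated at a self-adjoint element with spectrum [s], this is the spectral projection of [l] in
    [s]. *)
Definition lagrange s (l : R) : {poly R} :=
  \prod_(m <- s | m != l) ((l - m)^-1 *: ('X - m%:P)).

Lemma lagrangeE s l m : m \in s -> (lagrange s l).[m] = (m == l)%:R.
Proof.
move=> ms; rewrite /lagrange horner_prod; have [->|ml] := eqVneq m l.
  rewrite big1_seq // => k /andP[kl _].
  by rewrite hornerZ hornerXsubC mulVf // subr_eq0 eq_sym.
rewrite (big_rem m ms) /= ml hornerZ hornerXsubC subrr mulr0 mul0r //.
Qed.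

Definition interp s f : {poly R} := \sum_(l <- s) f l *: lagrange s l.

Lemma interpE s f m : uniq s -> m \in s -> (interp s f).[m] = f m.
Proof.
move=> us ms; rewrite /interp horner_sum (bigD1_seq m) //= hornerZ lagrangeE //.
rewrite eqxx mulr1 big1 ?addr0 // => l lm.
by rewrite hornerZ lagrangeE // eq_sym (negPf lm) mulr0.
Qed.

Lemma is_funcalc_interp f a s : finspec a s ->
  is_funcalc f a (poly_at (interp s f) a).
Proof.
move=> [us hs] e e0; exists (interp s f); split.
  by move=> t /hs ts; rewrite interpE // subrr normr0 ltW.
by rewrite subrr cnorm0 ltW.
Qed.

Lemma funcalcE f a b : selfadj a -> is_funcalc f a b -> funcalc f a = b.
Proof.
move=> sa h; apply: xget_unique => // c hc.
exact: is_funcalc_uniq sa hc h.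
Qed.

Lemma funcalc_interp f a s : selfadj a -> finspec a s ->
  funcalc f a = poly_at (interp s f) a.
Proof. by move=> sa fs; apply: funcalcE => //; exact: is_funcalc_interp. Qed.

(** Needed for [|x|^r], which is defined by two calculi in a row, a square root and a power. The
    inner function may identify spectral points, hence the removal of duplicates from the nodes of
    the outer one. *)
Lemma funcalc_comp f g a s : selfadj a -> finspec a s ->
  funcalc g (funcalc f a) = poly_at (interp s (g \o f)) a.
Proof.
move=> sa fs; have [us hs] := fs; rewrite (funcalc_interp f sa fs).
apply: funcalcE; first exact: selfadj_poly.
set Pf := interp s f.
pose s' := undup [seq f l | l <- s].
have hs' t : spectrum (poly_at Pf a) (rc t) -> t \in s'.
  move=> /(spectral_mapping sa) [l /hs ls <-]; rewrite interpE //.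
  by rewrite mem_undup map_f.
move=> e e0; exists (interp s' g); split.
  by move=> t /hs' ts; rewrite interpE ?undup_uniq // subrr normr0 ltW.
rewrite -poly_at_comp [X in X - _](_ : _ = poly_at (interp s (g \o f)) a).
  by rewrite subrr cnorm0 ltW.
apply: eq_poly_at => // t /hs ts.
by rewrite horner_comp !interpE ?undup_uniq // mem_undup map_f.
Qed.

Lemma finspec_of_root a (P : {poly R}) : selfadj a -> P != 0 -> poly_at P a = 0 ->
  exists s, finspec a s.
Proof.
move=> sa P0 h.
have rP t : spectrum a (rc t) -> root P t.
  move=> /(spectrum_poly_at (P := P)) /spectrumE; rewrite h subr0 => hi.
  apply/rootP; apply: contrapT => /eqP hn; apply: hi.
  exists (rc P.[t]^-1)%:A.
  by rewrite mulr_algl mulr_algr !scalerA -rmorphM mulVf // rmorph1 scale1r.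
have [r hr] := closed_field_poly_normal (map_poly rc P : {poly R[i]}).
exists (undup [seq t <- [seq complex.Re z | z <- r] | `[< spectrum a (rc t) >]]).
split=> [|t]; first exact: undup_uniq.
rewrite mem_undup mem_filter; split=> [ht|/andP[/asboolP]//].
apply/andP; split; first exact/asboolP.
have : root (map_poly rc P : {poly R[i]}) (rc t).
  by rewrite fmorph_root; exact: rP.
rewrite hr rootZ ?lead_coef_eq0 ?map_poly_eq0 // root_prod_XsubC => hin.
by apply/mapP; exists (rc t).
Qed.

End FunctionalCalculus.

(** * Conditional expectations of index-finite type *)

(** One half of [quasi_basis]; [qbasis_r] recovers the other by taking adjoints. The index type is
    arbitrary so that composed expectations can be indexed by pairs. *)
Definition qbasis (R : realType) (B A : cstarAlgType R) (i : B -> A)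
    (E : A -> B) (I : finType) (l : I -> A) : Prop :=
  forall x, x = \sum_k l k * i (E (star (l k) * x)).

(** The consequence of simplicity that makes [E x] a scalar for [x] in the relative commutant. *)
Definition scalar_center (R : realType) (B : cstarAlgType R) : Prop :=
  forall b : B, (forall x, b * x = x * b) -> exists z : R[i], b = z%:A.

(** The last field is the form of finite dimension on which the singular value decomposition
    relies. *)
Record tracial_alg (R : realType) (D : cstarAlgType R) (M : set D)
    (tr : D -> R[i]) : Prop := TracialAlg {
  tracial_1 : M 1;
  tracial_D : forall x y, M x -> M y -> M (x + y);
  tracial_Z : forall z x, M x -> M (z *: x);
  tracial_M : forall x y, M x -> M y -> M (x * y);
  tracial_S : forall x, M x -> M (star x);
  trD : forall x y, M x -> M y -> tr (x + y) = tr x + tr y;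
  trZ : forall z x, M x -> tr (z *: x) = z * tr x;
  trC : forall x y, M x -> M y -> tr (x * y) = tr (y * x);
  tr_ge0 : forall x, M x -> 0 <= tr (star x * x);
  tr_eq0 : forall x, M x -> tr (star x * x) = 0 -> x = 0;
  tr1 : tr 1 = 1;
  tracial_finspec : forall a, M a -> selfadj a -> exists s, finspec a s
}.

Lemma scalerI1 (R : realType) (A : cstarAlgType R) :
  injective (fun z : R[i] => z%:A : A).
Proof.
move=> z w /eqP; rewrite -subr_eq0 -scalerBl scaler_eq0 oner_eq0 orbF subr_eq0.
by move=> /eqP.
Qed.

Lemma addrr_inj (R : realType) (A : cstarAlgType R) (x y : A) :
  x + x = y + y -> x = y.
Proof.
move=> h; apply: (@scalerI _ _ (2 : R[i])); first by rewrite pnatr_eq0.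
by rewrite !scaler_nat !mulr2n.
Qed.

Section ConditionalExpectation.
Variables (R : realType) (B A : cstarAlgType R).
Variables (i : {lrmorphism B -> A}) (E : {linear A -> B}).
Hypotheses (hi : star_embedding i) (hE : cond_exp i E).
Implicit Types (x y z : A) (b : B).

Lemma embed_star b : i (star b) = star (i b).
Proof. by case: hi => _; apply. Qed.

Lemma embed_inj : injective i.
Proof. by case: hi. Qed.

Lemma embed_scalar (z : R[i]) : i z%:A = z%:A.
Proof. by rewrite linearZ rmorph1. Qed.

Lemma expE b : E (i b) = b.
Proof. by case: hE. Qed.

Lemma exp1 : E 1 = 1.
Proof. by rewrite -(expE 1) rmorph1. Qed.

Lemma expM b x b' : E (i b * x * i b') = b * E x * b'.
Proof. by case: hE. Qed.

Lemma expMl b x : E (i b * x) = b * E x.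
Proof. by have := expM b x 1; rewrite rmorph1 !mulr1. Qed.

Lemma expMr x b : E (x * i b) = E x * b.
Proof. by have := expM 1 x b; rewrite rmorph1 !mul1r. Qed.

Lemma exp_pos x : pos (E (star x * x)).
Proof. by apply: pos_positive; case: hE. Qed.

(** Polarisation: positivity makes the value of [E] at [star (1 + y) * (1 + y)] self-adjoint, hence
    also [E y + E (star y)]; this is used for [x] and for [i x]. *)
Lemma exp_star x : E (star x) = star (E x).
Proof.
have H y : star (E y) + star (E (star y)) = E y + E (star y).
  have [h _] := exp_pos (1 + y); have [h' _] := exp_pos y.
  move: h; rewrite /selfadj starD star1 mulrDl !mul1r mulrDr mulr1 !linearD /=.
  rewrite exp1 !starD star1 h' -!addrA => /addrI.
  by rewrite !addrA => /addIr.
have h1 := H x; have := H ('i *: x).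
rewrite starZ conjCi !linearZ /= !starZ rmorphN /= conjCi opprK => h2.
have {h2} h2 : - star (E x) + star (E (star x)) = E x - E (star x).
  have := congr1 (fun v => - 'i *: v) h2.
  by rewrite !scalerDr !scalerA mulrNN !mulNr !mulCii !opprK !scale1r !scaleN1r.
have := congr2 +%R h1 h2; rewrite addrACA subrr add0r addrACA subrr addr0.
by move=> /addrr_inj h3; apply: star_inj; rewrite starK.
Qed.

Lemma trace_ofE (hZ : scalar_center B) x : relcomm i x ->
  E x = (trace_of E x)%:A.
Proof.
move=> hx; apply: (@xgetPex _ 0 [set z : R[i] | E x = z%:A]).
by apply: hZ => b; rewrite -expMl -expMr hx.
Qed.

Lemma trace_of_eq x (z : R[i]) : E x = z%:A -> trace_of E x = z.
Proof.
move=> h; apply: xget_unique => // w /=; rewrite h => /esym.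
by apply: scalerI1.
Qed.

Section QuasiBasis.
Variables (I : finType) (l : I -> A).
Hypothesis (hq : qbasis i E l).

Lemma qbasis_r x : x = \sum_k i (E (x * l k)) * star (l k).
Proof.
apply: star_inj; rewrite star_sum {1}[star x]hq; apply: eq_bigr => k _.
by rewrite starM starK -embed_star -exp_star starM.
Qed.

Lemma exp_nondegl a : (forall x, E (a * x) = 0) -> a = 0.
Proof.
by move=> h; rewrite (qbasis_r a) big1 // => k _; rewrite h rmorph0 mul0r.
Qed.

Lemma exp_nondegr a : (forall x, E (x * a) = 0) -> a = 0.
Proof.
by move=> h; rewrite (hq a) big1 // => k _; rewrite h rmorph0 mulr0.
Qed.

(* If [E (z^* z) = 0] then, with [w = x - s z E (z^* x)],
   [0 <= E (w^* w) = E (x^* x) - 2 s E (z^* x)^* E (z^* x)] for all [s]. *)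
Lemma exp_faithful z : E (star z * z) = 0 -> z = 0.
Proof.
move=> hz; apply: star_inj; rewrite star0; apply: exp_nondegl => x.
set b := E (star z * x); set g := E (star x * x).
have key (s : R) : pos (g - rc (2 * s) *: (star b * b)).
  have := exp_pos (x - z * i (rc s *: b)).
  rewrite starB starM mulrBl !mulrBr !mulrA linearZ /= starZr -embed_star.
  rewrite -!scalerAl -!scalerAr !linearB /= !linearZ /= -/g.
  rewrite !expMr -!mulrA !expMl -/b.
  have -> : E (star x * z) = star b by rewrite /b -exp_star starM starK.
  rewrite hz mulr0 mul0r !oppr0 !scaler0 addr0 -addrA -scalerDl.
  by have -> : rc s + rc s = rc (2 * s) :> R[i] by rewrite -rmorphD mulr_natl mulr2n.
apply/eqP; rewrite -cnorm_eq0; apply: contrapT => /negP b0.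
have {}b0 : 0 < cnorm b by rewrite cnorm_gt0 -cnorm_eq0.
have b2 : 0 < cnorm b ^+ 2 by rewrite exprn_gt0.
(* Chosen so that [2 s |b|^2 = 2 (|g| + 1)], which exceeds the bound [|g|] imposed by [key]. *)
pose s := (cnorm g + 1) / cnorm b ^+ 2.
have s0 : 0 <= s by rewrite divr_ge0 ?ltW // ltr_wpDl ?cnorm_ge0.
have sb : s * cnorm b ^+ 2 = cnorm g + 1 by rewrite divfK ?gt_eqF.
move: s s0 sb => s s0 sb.
have := @pos_le_norm _ _ (cnorm g) (rc (2 * s) *: (star b * b)).
have hN : cnorm (rc (2 * s) *: (star b * b)) = 2 * (cnorm g + 1).
  rewrite cnormZr cstar_identity ger0_norm ?mulr_ge0 //.
  by rewrite -mulrA sb.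
rewrite hN => h; have : 2 * (cnorm g + 1) <= cnorm g.
  apply: h; first by apply: posZ (pos_mulss b); rewrite mulr_ge0.
  have -> : (rc (cnorm g))%:A - rc (2 * s) *: (star b * b)
     = ((rc (cnorm g))%:A - g) + (g - rc (2 * s) *: (star b * b)).
    by rewrite subrKA.
  by apply: posD => //; apply: norm_sub_pos; case: (exp_pos x).
have := cnorm_ge0 g; lra.
Qed.

Section Index.
Variable (c : R).
Hypothesis (hc : \sum_k l k * star (l k) = (rc c)%:A).

(* Removing from the quasi-basis its component along an orthonormal family
   [x] decreases the index by [\sum_a x_a x_a^*]. *)
Lemma bessel (J : finType) (x : J -> A) :
  (forall a a', E (star (x a) * x a') = (a == a')%:R) ->
  (forall a, E (x a * star (x a)) = 1) -> (#|J|%:R <= c)%R.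
Proof.
move=> ho h1.
pose y a k := i (E (star (x a) * l k)).
pose p k := \sum_a x a * y a k.
pose S := \sum_a x a * star (x a).
have sS : star S = S by rewrite star_sum; apply: eq_bigr => a _; rewrite starM starK.
have e1 : \sum_k p k * star (l k) = S.
  under eq_bigr do rewrite mulr_suml.
  rewrite exchange_big; apply: eq_bigr => a _.
  rewrite [in RHS](qbasis_r (star (x a))) mulr_sumr.
  by apply: eq_bigr => k _; rewrite mulrA.
have e2 : \sum_k l k * star (p k) = S.
  rewrite -sS -e1 star_sum; apply: eq_bigr => k _.
  by rewrite starM starK.
have hy (a b : J) : \sum_k y a k * star (y b k) = i (a == b)%:R.
  rewrite -ho [in RHS](hq (x b)) mulr_sumr !linear_sum /=.
  apply: eq_bigr => k _; rewrite mulrA expMr rmorphM /y.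
  by rewrite -embed_star -exp_star starM starK.
have e3 : \sum_k p k * star (p k) = S.
  transitivity (\sum_a \sum_b x a * (\sum_k y a k * star (y b k)) * star (x b)).
    under eq_bigr do rewrite /p star_sum mulr_suml.
    rewrite exchange_big; apply: eq_bigr => a _.
    under eq_bigr do rewrite mulr_sumr.
    rewrite exchange_big; apply: eq_bigr => b _.
    rewrite mulr_sumr mulr_suml; apply: eq_bigr => k _.
    by rewrite starM !mulrA.
  apply: eq_bigr => a _; rewrite (bigD1 a) //= [X in _ + X]big1 ?addr0 => [|b ba].
    by rewrite hy eqxx rmorph1 mulr1.
  by rewrite hy eq_sym (negPf ba) rmorph0 mulr0 mul0r.
have e4 : \sum_k (l k - p k) * star (l k - p k) = (rc c)%:A - S.
  under eq_bigr do rewrite starB mulrBl !mulrBr.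
  by rewrite big_split /= sumrN !big_split /= !sumrN hc e1 e2 e3 subrr subr0.
(* The second hypothesis turns [E S] into the cardinal of [J]. It is separate from the first because
   [E] is not known to be tracial at this point. *)
have : pos (E ((rc c)%:A - S)).
  rewrite -e4 linear_sum; apply: pos_sum => k.
  by rewrite -{1}(starK (l k - p k)); exact: exp_pos.
rewrite linearB linearZ /= exp1 /S linear_sum (eq_bigr (fun=> 1)) //.
have -> : \sum_(j : J) (1 : B) = (#|J|%:R : R[i])%:A by rewrite sumr_const scaler_nat.
rewrite -scalerBl => /pos_scalar.
by rewrite subr_ge0 -(rmorph_nat rc) lecR.
Qed.

Lemma index_ge1 : 1 <= c.
Proof.
have := @bessel unit (fun=> 1); rewrite card_unit; apply.
  by move=> [] []; rewrite star1 mulr1 exp1.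
by move=> _; rewrite star1 mulr1 exp1.
Qed.

Section Relcomm.
Hypothesis (hZ : scalar_center B).
Let M := relcomm i.
Let tr := trace_of E.

Lemma relcomm1 : M 1.
Proof. by move=> b; rewrite mulr1 mul1r. Qed.

Lemma relcommD x y : M x -> M y -> M (x + y).
Proof. by move=> hx hy b; rewrite mulrDl mulrDr hx hy. Qed.

Lemma relcommZ (z : R[i]) x : M x -> M (z *: x).
Proof. by move=> hx b; rewrite -scalerAl -scalerAr hx. Qed.

Lemma relcommM x y : M x -> M y -> M (x * y).
Proof. by move=> hx hy b; rewrite -mulrA hy !mulrA hx. Qed.

Lemma relcommS x : M x -> M (star x).
Proof. by move=> hx b; apply: star_inj; rewrite !starM starK -embed_star hx. Qed.

Lemma relcomm_poly (P : {poly R}) x : M x -> M (poly_at P x).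
Proof. by move=> hx b; rewrite (poly_at_comm P (hx b)). Qed.

Lemma trace_selfadj x : M x -> selfadj x -> tr x = rc (complex.Re (tr x)).
Proof.
move=> Mx sx; apply: (@spectrum_real _ B (tr x)%:A).
  by rewrite -(trace_ofE hZ Mx) /selfadj -exp_star sx.
by apply/spectrumE; rewrite subrr => -[b []]; rewrite mulr0 => /esym/eqP; rewrite oner_eq0.
Qed.

(* Otherwise Gram-Schmidt, applied to the powers of [a], would give arbitrarily
   long orthonormal families, which [bessel] excludes. *)
Lemma relcomm_finspec a : M a -> selfadj a -> exists s, finspec a s.
Proof.
move=> Ma sa.
suff [P P0 hP] : exists2 P : {poly R}, P != 0 & poly_at P a = 0.
  exact: finspec_of_root hP.
apply: contrapT => hno.
have nz P : P != 0 -> poly_at P a != 0.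
  by move=> P0; apply/eqP => hP; apply: hno; exists P.
pose f P := complex.Re (tr (poly_at P a)).
have fE P : E (poly_at P a) = (rc (f P))%:A.
  have MP := relcomm_poly P Ma.
  by rewrite /f -trace_selfadj // ?(trace_ofE hZ MP) //; exact: selfadj_poly.
have finj (u v : R) : (rc u)%:A = (rc v)%:A :> B -> u = v.
  by move=> /scalerI1 /complexI.
have fD P Q : f (P + Q) = f P + f Q.
  by apply: finj; rewrite -fE poly_atD linearD /= !fE rmorphD scalerDl.
have fZ u P : f (u *: P) = u * f P.
  by apply: finj; rewrite -fE poly_atZ linearZ /= !fE rmorphM scalerA.
have fsum (J : Type) (r : seq J) (F : J -> {poly R}) : f (\sum_(j <- r) F j) = \sum_(j <-
  r) f (F j).
  apply: (big_morph f fD); apply: finj.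
  by rewrite -fE poly_at0 linear0 rmorph0 scale0r.
have fpos P : P != 0 -> 0 < f (P * P).
  move=> P0; have e : E (star (poly_at P a) * poly_at P a) = (rc (f (P * P)))%:A.
    by rewrite (selfadj_poly P sa) -poly_atM fE.
  have := exp_pos (poly_at P a); rewrite e => /pos_scalar; rewrite lecR => h.
  rewrite lt_def h andbT; apply/eqP => h0; move/eqP: (nz P P0); apply.
  by apply: exp_faithful; rewrite e h0 rmorph0 scale0r.
have orth n : exists Q : nat -> {poly R}, forall j, (j < n)%N ->
    (size (Q j) <= j.+1)%N /\ forall k, (k < n)%N -> f (Q j * Q k) = (j == k)%:R.
  elim: n => [|n [Q hQ]]; first by exists (fun=> 0).
  (* Since [Q j] has degree at most [j], [T] is monic of degree [n], hence nonzero, and [fpos]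
     allows its normalisation. *)
  pose T := 'X^n - \sum_(j <- index_iota 0 n) f ('X^n * Q j) *: Q j.
  pose S : {poly R} := \sum_(j <- index_iota 0 n) f ('X^n * Q j) *: Q j.
  have szS : (size S <= n)%N.
    apply: (leq_trans (size_sum _ _ _)).
    apply/bigmax_leqP_seq => j; rewrite mem_index_iota => /andP[_ jn] _.
    by apply: leq_trans (size_scale_leq _ _) _; apply: leq_trans (proj1 (hQ _ jn)) _.
  have szT : size T = n.+1.
    by rewrite /T size_polyDl size_polyXn // size_polyN ltnS.
  have T0 : T != 0 by rewrite -size_poly_eq0 szT.
  have TQ k : (k < n)%N -> f (T * Q k) = 0.
    move=> kn; rewrite /T mulrBl fD -scaleN1r fZ mulr_suml fsum.
    rewrite (eq_big_seq (fun j => f ('X^n * Q j) * (j == k)%:R)); last first.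
      move=> j; rewrite mem_index_iota => /andP[_ jn].
      by rewrite -scalerAl fZ (proj2 (hQ _ jn)).
    rewrite (bigD1_seq k) ?iota_uniq ?mem_index_iota //= eqxx mulr1.
    rewrite big1 ?addr0 ?mulN1r ?subrr // => j jk.
    by rewrite (negPf jk) mulr0.
  have t0 := fpos _ T0; set t := Num.sqrt (f (T * T)).
  have t1 : 0 < t by rewrite sqrtr_gt0.
  have tt : t^-1 * (t^-1 * f (T * T)) = 1.
    by rewrite mulrA -invfM -expr2 sqr_sqrtr ?ltW // mulVf // gt_eqF.
  exists (fun j => if j == n then t^-1 *: T else Q j) => j jn.
  have [->|jn'] := eqVneq j n.
    split; first by apply: leq_trans (size_scale_leq _ _) _; rewrite szT.
    move=> k kn; have [_|kn'] := eqVneq k n.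
      by rewrite -scalerAl -scalerAr !fZ.
    have {kn kn'} kn : (k < n)%N by rewrite ltn_neqAle kn' -ltnS.
    by rewrite -scalerAl fZ TQ // mulr0.
  have {jn jn'} jn : (j < n)%N by rewrite ltn_neqAle jn' -ltnS.
  split; first exact: (proj1 (hQ _ jn)).
  move=> k kn; have [->|kn'] := eqVneq k n.
    by rewrite mulrC -scalerAl fZ TQ // mulr0 (ltn_eqF jn).
  by apply: (proj2 (hQ _ jn)); rewrite ltn_neqAle kn' -ltnS.
have bound n : (n%:R <= c)%R.
  have [Q hQ] := orth n.
  have h j k : (j < n)%N -> (k < n)%N -> E (poly_at (Q j) a * poly_at (Q k) a) = (j == k)%:R.
    move=> jn kn; rewrite -poly_atM fE (proj2 (hQ _ jn)) //.
    by rewrite !rmorph_nat scaler_nat.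
  have := @bessel 'I_n (fun j => poly_at (Q j) a); rewrite card_ord; apply.
    by move=> j k; rewrite (selfadj_poly _ sa) h.
  by move=> j; rewrite (selfadj_poly _ sa) h // eqxx.
have [n hn] : exists n : nat, c < n%:R.
  by exists (Num.bound c); apply: archi_boundP; apply: le_trans index_ge1.
by have := bound n; rewrite leNgt hn.
Qed.

End Relcomm.
End Index.

Section Trace.
Variable (c : R).
Hypothesis (c0 : c != 0).
Hypothesis (hmin : forall x, relcomm i x ->
  \sum_k l k * x * star (l k) = rc c *: i (E x)).

(* [theta] is the modular automorphism of [E] on the relative commutant:
   [E (x y) = E (theta y x)].  The map [x |-> \sum_k l_k x l_k^*] has the inverse
   modular automorphism, hence [theta] is an involution by [hmin]; being also
   positive, it is trivial. *)
Lemma exp_trace x y : relcomm i y -> E (x * y) = E (y * x).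
Proof.
pose th y := \sum_k i (E (l k * y)) * star (l k).
have thE y' : relcomm i y' -> forall x', E (x' * y') = E (th y' * x').
  move=> hy x'; rewrite {1}(hq x') mulr_suml /th mulr_suml !linear_sum /=.
  apply: eq_bigr => k _.
  by rewrite -mulrA -(hy _) mulrA expMr -mulrA expMl.
have thM y' : relcomm i y' -> relcomm i (th y').
  move=> hy b; apply/eqP; rewrite -subr_eq0; apply/eqP; apply: exp_nondegl => x'.
  by rewrite mulrBl linearB /= -!mulrA expMl -!thE // -mulrA expMl subrr.
pose th' y := star (th (star y)).
have thE' y' : relcomm i y' -> forall x', E (y' * x') = E (x' * th' y').
  move=> hy x'; apply: star_inj; rewrite -!exp_star !starM starK.
  by rewrite thE //; exact: relcommS.
have thM' y' : relcomm i y' -> relcomm i (th' y').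
  by move=> hy; apply/relcommS/thM/relcommS.
have thK y' : relcomm i y' -> th' (th y') = y'.
  move=> hy; apply/eqP; rewrite -subr_eq0; apply/eqP; apply: exp_nondegr => x'.
  by rewrite mulrBr linearB /= -(thE' _ (thM _ hy)) (thE _ hy) subrr.
have thK' y' : relcomm i y' -> th (th' y') = y'.
  move=> hy; apply/eqP; rewrite -subr_eq0; apply/eqP; apply: exp_nondegl => x'.
  by rewrite mulrBl linearB /= -(thE _ (thM' _ hy)) (thE' _ hy) subrr.
(* Expand [y' * star (l k)] in the quasi-basis, with index [j]. Summing over [k] first then produces
   [l j * th' y']: [y'] has moved to the left of [x'] at the price of the twist [th']. *)
have hsum x' y' : relcomm i x' -> relcomm i y' ->
    \sum_k l k * (x' * y') * star (l k) = \sum_k l k * (th' y' * x') * star (l k).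
  move=> hx hy.
  transitivity (\sum_k \sum_j l k * i (E (y' * star (l k) * l j)) * x' * star (l j)).
    apply: eq_bigr => k _; have -> : l k * (x' * y') * star (l k) = l k * (x' * (y' * star (l k))).
      by rewrite !mulrA.
    rewrite [in LHS](qbasis_r (y' * star (l k))).
    rewrite !mulr_sumr; apply: eq_bigr => j _.
    by rewrite !mulrA -(mulrA (l k) x') hx !mulrA.
  rewrite exchange_big; apply: eq_bigr => j _.
  rewrite mulrA -!mulr_suml; congr (_ * _ * _).
  rewrite [RHS]hq; apply: eq_bigr => k _; congr (_ * i _).
  by rewrite -mulrA thE' // mulrA.
have E' x' y' : relcomm i x' -> relcomm i y' -> E (x' * y') = E (th' y' * x').
  move=> hx hy; apply: embed_inj; apply: (@scalerI _ _ (rc c)).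
    by rewrite fmorph_eq0.
  rewrite -!hmin; [exact: hsum|apply: relcommM => //; exact: thM'|exact: relcommM].
have theq y' : relcomm i y' -> th y' = th' y'.
  move=> hy; apply/eqP; rewrite -subr_eq0; apply/eqP; apply: star_inj.
  rewrite star0; apply: exp_faithful; set d := th y' - th' y'.
  have Md : relcomm i d by apply: relcommD; [exact: thM|rewrite -scaleN1r; apply: relcommZ;
    exact: thM'].
  rewrite starK {1}/d mulrBl linearB /= -thE // -E' //; last exact: relcommS.
  by rewrite subrr.
suff thid y' : relcomm i y' -> th y' = y' by move=> hy; rewrite thE // thid.
(* As [th] is an involution, [th z = - z], and the modular relation gives
   [E (star z * z) = - E (z * star z)]. Both expectations are positive, so they vanish. *)
move=> hy; apply/esym/eqP; rewrite -subr_eq0; apply/eqP; set z := _ - _.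
have Mz : relcomm i z by apply: relcommD => //; rewrite -scaleN1r; apply: relcommZ; exact: thM.
have thz : th z = - z.
  have thB : th z = th y' - th (th y').
    rewrite /th -sumrB; apply: eq_bigr => k _.
    by rewrite mulrBr linearB rmorphB mulrBl.
  by rewrite thB (theq _ (thM _ hy)) (thK _ hy) opprB.
apply: exp_faithful; apply: pos_antisym; first exact: exp_pos.
rewrite thE // thz mulNr linearN opprK -{1}(starK z); exact: exp_pos.
Qed.

Lemma relcomm_tracial (d : R) : \sum_k l k * star (l k) = (rc d)%:A ->
  scalar_center B -> tracial_alg (relcomm i) (trace_of E).
Proof.
move=> hd hZ; split.
- exact: relcomm1.
- exact: relcommD.
- exact: relcommZ.
- exact: relcommM.
- exact: relcommS.
- move=> x y hx hy; apply: trace_of_eq; rewrite linearD /= scalerDl.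
  by rewrite -!trace_ofE.
- by move=> z x hx; apply: trace_of_eq; rewrite linearZ /= -scalerA -trace_ofE.
- by move=> x y hx hy; rewrite /trace_of exp_trace.
- move=> x hx; apply: (@pos_scalar _ B); rewrite -trace_ofE //; first exact: exp_pos.
  by apply: relcommM => //; exact: relcommS.
- move=> x hx h; apply: exp_faithful; rewrite trace_ofE //; first by rewrite h scale0r.
  by apply: relcommM => //; exact: relcommS.
- by apply: trace_of_eq; rewrite exp1 scale1r.
- by move=> a; apply: (relcomm_finspec hd hZ).
Qed.

End Trace.
End QuasiBasis.
End ConditionalExpectation.

(** * Minimal conditional expectations *)

Section SpectralProjections.
Variables (R : realType) (A : cstarAlgType R).
Implicit Types (a x : A) (s : seq R).

Lemma proj_lagrange a s (l : R) : selfadj a -> finspec a s -> l \in s ->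
  projection (poly_at (lagrange s l) a).
Proof.
move=> sa [us hs] ls; split; last exact: selfadj_poly.
rewrite -poly_atM; apply: eq_poly_at => // t /hs ts.
by rewrite hornerM lagrangeE //; case: eqP; rewrite ?mulr0 ?mulr1.
Qed.

Lemma proj_lagrange_orth a s (l m : R) : selfadj a -> finspec a s -> l != m ->
  poly_at (lagrange s l) a * poly_at (lagrange s m) a = 0.
Proof.
move=> sa [us hs] lm; rewrite -poly_atM -(poly_at0 a); apply: eq_poly_at => //.
move=> t /hs ts; rewrite hornerM !lagrangeE // horner0.
by case: eqP => [->|]; rewrite ?mul0r // (negPf lm) mulr0.
Qed.

Lemma spectral_dec a s (f : R -> R) : selfadj a -> finspec a s ->
  poly_at (interp s f) a = \sum_(l <- s) rc (f l) *: poly_at (lagrange s l) a.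
Proof.
by move=> sa fs; rewrite /interp poly_at_sum; apply: eq_bigr => l _; rewrite poly_atZ.
Qed.

Lemma poly_at_interp a s (P : {poly R}) : selfadj a -> finspec a s ->
  poly_at P a = poly_at (interp s (horner P)) a.
Proof.
move=> sa [us hs]; apply: eq_poly_at => // t /hs ts.
by rewrite interpE.
Qed.

Lemma selfadj_spectral a s : selfadj a -> finspec a s ->
  a = \sum_(l <- s) rc l *: poly_at (lagrange s l) a.
Proof.
move=> sa fs; rewrite -{1}(poly_atX a) (poly_at_interp _ sa fs) spectral_dec //.
by apply: eq_bigr => l _; rewrite hornerX.
Qed.

Lemma spectral_resolution a s : selfadj a -> finspec a s ->
  1 = \sum_(l <- s) poly_at (lagrange s l) a.
Proof.
move=> sa fs; rewrite -(poly_at1 a) (poly_at_interp _ sa fs) spectral_dec //.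
by apply: eq_bigr => l _; rewrite hornerC rmorph1 scale1r.
Qed.

(** An induction principle: finite spectral decomposition carries a linear property from projections
    to self-adjoint elements, and real and imaginary parts carry it to all of [M]. *)
Lemma proj_span (M : set A) (K : A -> Prop) :
  (forall x y, M x -> M y -> M (x + y)) ->
  (forall (z : R[i]) x, M x -> M (z *: x)) ->
  (forall x, M x -> M (star x)) ->
  (forall (P : {poly R}) x, M x -> M (poly_at P x)) ->
  (forall a, M a -> selfadj a -> exists s, finspec a s) ->
  (forall x y, M x -> M y -> K x -> K y -> K (x + y)) ->
  (forall (z : R[i]) x, M x -> K x -> K (z *: x)) ->
  (forall p, M p -> projection p -> K p) ->
  forall x, M x -> K x.
Proof.
move=> MD MZ MS MP Mf KD KZ Kp.
have Ka a : M a -> selfadj a -> K a.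
  move=> Ma sa; have [s fs] := Mf a Ma sa.
  rewrite (selfadj_spectral sa fs).
  suff [] : M (\sum_(l <- s) rc l *: poly_at (lagrange s l) a) /\
    K (\sum_(l <- s) rc l *: poly_at (lagrange s l) a) by [].
  have: {subset s <= s} by []; elim: {1 3 5}s => [_|l r IH hr].
    rewrite big_nil -(scale0r a); split; first exact: MZ.
    rewrite scale0r; apply: Kp; first by rewrite -(scale0r a); exact: MZ.
    by split; rewrite ?mulr0 ?star0.
  have [|M1 K1] := IH; first by move=> m hm; apply: hr; rewrite inE hm orbT.
  have ls : l \in s by apply: hr; rewrite mem_head.
  rewrite big_cons; split; first by apply: MD => //; apply/MZ/MP.
  apply: KD => //; first by apply/MZ/MP.
  by apply: KZ; [exact: MP|apply: Kp; [exact: MP|exact: proj_lagrange]].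
move=> x Mx.
have MSx := MS _ Mx.
have -> : x = rc (1/2) *: (x + star x) + (- 'i * rc (1/2)) *: ('i *: (x - star x)).
  have e : - 'i * rc (1/2) * 'i = rc (1/2) :> R[i].
    by rewrite mulrAC mulNr mulCii opprK [LHS]mul1r.
  rewrite [X in _ + X]scalerA e -scalerDr.
  rewrite addrACA subrr addr0 scalerDr -scalerDl -rmorphD.
  by rewrite (_ : 1/2 + 1/2 = 1) ?rmorph1 ?scale1r //; lra.
have M1 : M (x + star x) by exact: MD.
have M2 : M ('i *: (x - star x)) by apply/MZ/MD => //; rewrite -scaleN1r; exact: MZ.
apply: KD; [exact: MZ|exact: MZ| |]; apply: KZ => //; apply: Ka => //.
  by rewrite /selfadj starD starK addrC.
by rewrite /selfadj starZ conjCi starB starK scaleNr -scalerN opprB.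
Qed.

End SpectralProjections.

Section RelcommSum.
Variables (R : realType) (B A D : cstarAlgType R).
Variables (i : {lrmorphism B -> A}) (E : {linear A -> B}).
Variables (g : {lrmorphism A -> D}).
Hypotheses (hi : star_embedding i) (hE : cond_exp i E).
Variables (I : finType) (l : I -> A).
Hypothesis (hq : qbasis i E l).

(** Expanding [star (l k) * a] on one side and [a * l j] on the other gives the same matrix with
    entries [E (star (l k) * a * l j)] in [B], and these commute with [x]. The embedding [g] admits
    [x] from algebras higher in the tower. *)
Lemma qbasis_sum_comm x : relcomm (g \o i) x ->
  relcomm g (\sum_k g (l k) * x * g (star (l k))).
Proof.
move=> hx a; rewrite mulr_suml mulr_sumr.
transitivity (\sum_k \sum_j g (l k) * x * g (i (E (star (l k) * a * l j))) * g (star (l j))).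
  apply: eq_bigr => k _; rewrite -mulrA -rmorphM [in LHS](qbasis_r hi hE hq (star (l k) * a)).
  rewrite rmorph_sum mulr_sumr; apply: eq_bigr => j _.
  by rewrite rmorphM mulrA.
rewrite exchange_big; apply: eq_bigr => j _.
rewrite -mulr_suml !mulrA -rmorphM {1}(hq (a * l j)); congr (_ * _).
rewrite rmorph_sum mulr_suml; apply: eq_bigr => k _.
by rewrite -mulrA hx mulrA /= rmorphM mulrA.
Qed.

End RelcommSum.

Lemma star_embedding_comp (R : realType) (B A D : cstarAlgType R)
    (i : {lrmorphism B -> A}) (j : {lrmorphism A -> D}) :
  star_embedding i -> star_embedding j ->
  star_embedding (j \o i : {lrmorphism B -> D}).
Proof.
move=> hi hj; split=> [x y /(proj1 hj) /(proj1 hi)//|b] /=.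
by rewrite (embed_star hi) (embed_star hj).
Qed.

(** Minimality in its infinitesimal form [mi_trace]. This form is inherited up the tower by
    computation, whereas a minimum over all expectations would have to be established anew at each
    stage. *)
Record min_index (R : realType) (B A : cstarAlgType R) (i : {lrmorphism B -> A})
    (E : {linear A -> B}) (I : finType) (l : I -> A) (c : R) : Prop := MinIndex {
  mi_star : star_embedding i;
  mi_exp : cond_exp i E;
  mi_qbasis : qbasis i E l;
  mi_index : \sum_k l k * star (l k) = (rc c)%:A;
  mi_trace : forall x, relcomm i x ->
    \sum_k l k * x * star (l k) = rc c *: i (E x)
}.

Section MinIndex.
Variables (R : realType) (B A D : cstarAlgType R).
Variables (i : {lrmorphism B -> A}) (E : {linear A -> B}).
Variables (I : finType) (l : I -> A) (c : R).
Hypothesis (H : min_index i E l c).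

Lemma mi_ge1 : 1 <= c.
Proof. by case: H => h1 h2 h3 h4 _; exact: (index_ge1 h1 h2 h3 h4). Qed.

Lemma mi_tracial : scalar_center B -> tracial_alg (relcomm i) (trace_of E).
Proof.
case: H => h1 h2 h3 h4 h5; apply: (relcomm_tracial h1 h2 h3 _ h5 h4).
by rewrite gt_eqF // (lt_le_trans ltr01 mi_ge1).
Qed.

(** [mi_trace] composes because the inner sum lands in the relative commutant of [A], where the
    identity for [F] applies. With [mi_tracial] this yields the traces on the [B' \cap A_n]. *)
Lemma min_index_comp (j : {lrmorphism A -> D}) (F : {linear D -> A})
    (J : finType) (m : J -> D) (d : R) : min_index j F m d ->
  min_index (j \o i : {lrmorphism B -> D}) (E \o F : {linear D -> B})
    (fun p : J * I => m p.1 * j (l p.2)) (d * c).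
Proof.
case=> k1 k2 k3 k4 k5; case: H => h1 h2 h3 h4 h5.
have js a : j (star a) = star (j a) by exact: embed_star k1 a.
split.
- exact: star_embedding_comp.
- split=> [b|b x b'|x] /=.
  + by rewrite (expE k2) (expE h2).
  + by rewrite (expM k2) (expM h2).
  + by have [_ _ /(_ x) [y ->]] := k2; have [_ _ /(_ y)] := h2.
- move=> x; rewrite {1}[x]k3.
  rewrite -(pair_bigA _ (fun a b => m a * j (l b) * j (i (E (F (star (m a * j (l b)) * x)))))) /=.
  apply: eq_bigr => a _; rewrite {1}(h3 (F (star (m a) * x))) rmorph_sum mulr_sumr.
  apply: eq_bigr => b _; rewrite rmorphM starM -js -(mulrA (j (star (l b)))).
  by rewrite (expMl k2) !mulrA.
- rewrite -(pair_bigA _ (fun a b => m a * j (l b) * star (m a * j (l b)))) /=.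
  transitivity (\sum_a m a * (rc c)%:A * star (m a)).
    apply: eq_bigr => a _; rewrite -(embed_scalar j) -h4 rmorph_sum mulr_sumr mulr_suml.
    by apply: eq_bigr => b _; rewrite starM -js rmorphM !mulrA.
  under eq_bigr do rewrite mulr_algr -scalerAl.
  by rewrite -scaler_sumr k4 scalerA rmorphM mulrC.
- move=> x hx.
  rewrite -(pair_bigA _ (fun a b => m a * j (l b) * x * star (m a * j (l b)))) /=.
  transitivity (\sum_a m a * (\sum_b j (l b) * x * j (star (l b))) * star (m a)).
    apply: eq_bigr => a _; rewrite mulr_sumr mulr_suml.
    by apply: eq_bigr => b _; rewrite starM js !mulrA.
  rewrite k5; last exact: (qbasis_sum_comm h1 h2 h3 hx).
  have -> : F (\sum_b j (l b) * x * j (star (l b))) = \sum_b l b * F x * star (l b).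
    by rewrite linear_sum; apply: eq_bigr => b _; rewrite (expM k2).
  rewrite h5; last first.
    by move=> b; rewrite -(expMr k2) -(expMl k2); congr (F _); exact: hx.
  by rewrite linearZ scalerA rmorphM.
Qed.

End MinIndex.

(* A perturbation of [E] by the positive element [(1 + t p) ^ 2] of the relative
   commutant. *)
Definition cut_exp (R : realType) (B A : cstarAlgType R) (E : {linear A -> B})
    (s : A) (a : R[i]) (x : A) : B := a *: E (s * x * s).

Lemma cut_exp_linear (R : realType) (B A : cstarAlgType R)
    (E : {linear A -> B}) (s : A) (a : R[i]) : linear (cut_exp E s a).
Proof.
move=> z x y; rewrite /cut_exp mulrDr mulrDl -scalerAr -scalerAl linearP scalerDr.
by rewrite !scalerA mulrC.
Qed.

HB.instance Definition _ (R : realType) (B A : cstarAlgType R)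
    (E : {linear A -> B}) (s : A) (a : R[i]) :=
  GRing.isLinear.Build R[i] A B _ (cut_exp E s a) (cut_exp_linear E s a).

(** * First variation of the index *)

Section Minimality.
Variables (R : realType) (B A : cstarAlgType R).
Variables (i : {lrmorphism B -> A}) (E : {linear A -> B}) (c : R).
Hypotheses (hi : star_embedding i) (hE : minimal_cond_exp i E c).
Hypotheses (ZB : scalar_center B) (ZA : scalar_center A).

(** The difference of the two sides is [u (phi - theta)] plus a quadratic term, and it is
    nonnegative for small [u] of either sign, so the linear coefficient vanishes. The [u] chosen
    below keeps the quadratic term under half of the linear one. *)
Lemma perturbation_limit (phi theta : R) :
  (forall u : R, -1 < u -> (1 + u) <= (1 + u * phi) * (1 + u - u * theta)) ->
  phi = theta.
Proof.
move=> h.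
have key u : -1 < u -> 0 <= u * (phi - theta + u * (phi - phi * theta)).
  move=> /h; rewrite -subr_ge0.
  have -> // : (1 + u * phi) * (1 + u - u * theta) - (1 + u)
    = u * (phi - theta + u * (phi - phi * theta)) by ring.
set b := phi - phi * theta in key; set a := phi - theta in key.
apply/eqP; rewrite -subr_eq0 -/a; apply/eqP.
have K0 : 0 < `|b| + 1 by rewrite ltr_wpDl.
have [bl br] : - `|b| <= b /\ b <= `|b| by move: (lexx `|b|); rewrite ler_norml => /andP[].
move: `|b| K0 bl br => B' K0 bl br.
have [a0|a0|//] := ltgtP a 0.
  pose u := Num.min (1/2) (- a / (2 * (B' + 1))).
  have u0 : 0 < u.
    by rewrite lt_min divr_gt0 //= divr_gt0 ?oppr_gt0 // mulr_gt0.
  have u1 : u <= 1/2 by rewrite ge_min lexx.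
  have u2 : u * (2 * (B' + 1)) <= - a by rewrite -ler_pdivlMr ?mulr_gt0 // ge_min lexx orbT.
  have := key u _; rewrite pmulr_rge0 // => k.
  have : 0 <= a + u * b by apply: k; lra.
  nra.
pose u := Num.min (1/2) (a / (2 * (B' + 1))).
have u0 : 0 < u.
  by rewrite lt_min divr_gt0 //= divr_gt0 // mulr_gt0.
have u1 : u <= 1/2 by rewrite ge_min lexx.
have u2 : u * (2 * (B' + 1)) <= a by rewrite -ler_pdivlMr ?mulr_gt0 // ge_min lexx orbT.
have := key (- u) _; rewrite nmulr_rge0 ?oppr_lt0 // => k.
have : a + - u * b <= 0 by apply: k; lra.
nra.
Qed.

(** By linearity it suffices to treat a projection [p], with [E p = phi] and [T p = c theta]. For
    [s^2 = 1 + u p] the map [x -> E (s x s) / N] is again an expectation with scalar index, and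
    comparing that index with [c] for all [u > -1] forces [theta = phi]. *)
Lemma minimal_min_index : exists (m : nat) (l : 'I_m -> A), min_index i E l c.
Proof.
have [[cE [m [l [qb idx]]]] hmin] := hE.
have hq : qbasis i E l by move=> x; case: (qb x).
exists m, l; split => //.
have c1 := index_ge1 hi cE hq idx.
pose T x := \sum_k l k * x * star (l k).
have MT x : relcomm i x -> exists z : R[i], T x = z%:A.
  move=> hx; apply: ZA => a.
  exact: (@qbasis_sum_comm _ _ _ A i E (@idfun A : {lrmorphism A -> A}) hi cE _ l hq x hx a).
have TS x : star (T x) = T (star x).
  by rewrite star_sum; apply: eq_bigr => k _; rewrite !starM starK mulrA.
have TD x y : T (x + y) = T x + T y.
  by rewrite -big_split; apply: eq_bigr => k _; rewrite mulrDr mulrDl.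
have TZ (z : R[i]) x : T (z *: x) = z *: T x.
  by rewrite scaler_sumr; apply: eq_bigr => k _; rewrite -scalerAr -scalerAl.
apply: (@proj_span _ A (relcomm i) (fun x => T x = rc c *: i (E x))).
- exact: relcommD.
- exact: relcommZ.
- exact: relcommS hi.
- exact: relcomm_poly.
- move=> a; exact: (relcomm_finspec hi cE hq idx ZB).
- by move=> x y _ _ hx hy; rewrite TD hx hy !linearD.
- by move=> z x _ hx; rewrite TZ hx !linearZ /= !scalerA mulrC.
move=> p Mp [pp ps].
have EP : E p = (trace_of E p)%:A by exact: trace_ofE cE ZB _ Mp.
set phi := complex.Re (trace_of E p).
have phiE : E p = (rc phi)%:A by rewrite EP (trace_selfadj cE ZB Mp ps).
have phi0 : 0 <= phi.
  have : pos (E (star p * p)) by exact: exp_pos cE p.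
  by rewrite ps pp phiE => /pos_scalar; rewrite lecR.
have [z hz] := MT _ Mp.
pose theta := complex.Re z / c.
have c0 : c != 0 by rewrite gt_eqF // (lt_le_trans ltr01).
have thetaE : T p = (rc (c * theta))%:A.
  rewrite hz mulrC divfK //; congr (_ *: _); apply: (@spectrum_real _ A z%:A).
    by rewrite -hz /selfadj TS ps.
  by apply/spectrumE; rewrite subrr => -[b []]; rewrite mulr0 => /esym/eqP; rewrite oner_eq0.
suff e : theta = phi by rewrite thetaE e phiE embed_scalar scalerA rmorphM.
symmetry; apply: perturbation_limit => u u1.
have v0 : 0 < 1 + u by lra.
(* [s] is the square root of [1 + u p] and [s'] its inverse; their products stay in the span of 1
   and [p], where [spoly] computes them. *)
pose r := Num.sqrt (1 + u).
have r0 : 0 < r by rewrite sqrtr_gt0.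
have rr : r * r = 1 + u by rewrite -expr2 sqr_sqrtr // ltW.
pose s := 1 + rc (r - 1) *: p.
pose s' := 1 - rc ((r - 1) / r) *: p.
have spoly (a b : R) : (1 + rc a *: p) * (1 + rc b *: p) = 1 + rc (a + b + a * b) *: p.
  rewrite mulrDl !mulrDr !mul1r mulr1 -scalerAl -scalerAr pp scalerA -addrA.
  by rewrite -!scalerDl !rmorphD rmorphM; congr (_ + _ *: _); ring.
have s'E : s' = 1 + rc (- ((r - 1) / r)) *: p by rewrite rmorphN scaleNr.
have e0 : r - 1 + - ((r - 1) / r) + (r - 1) * - ((r - 1) / r) = 0.
  by field; rewrite gt_eqF.
have ss' : s * s' = 1 by rewrite s'E /s spoly e0 rmorph0 scale0r addr0.
have s's : s' * s = 1.
  by rewrite s'E /s spoly [- _ + _]addrC [- _ * _]mulrC e0 rmorph0 scale0r addr0.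
have ss : s * s = 1 + rc u *: p.
  by rewrite /s spoly; congr (_ + rc _ *: _); rewrite -[u](addKr 1) -rr; ring.
have s's' : s' * s' = 1 + rc (- u / (1 + u)) *: p.
  rewrite s'E spoly; congr (_ + rc _ *: _); rewrite -[u](addKr 1) -rr; field.
  by rewrite addNKr mulf_neq0 ?gt_eqF.
have Ms : relcomm i s by apply: relcommD; [exact: relcomm1|exact: relcommZ].
have Ms' : relcomm i s' by rewrite s'E; apply: relcommD; [exact: relcomm1|exact: relcommZ].
have sS : star s = s by rewrite starD star1 starZr ps.
have sS' : star s' = s' by rewrite s'E starD star1 starZr ps.
pose N := 1 + u * phi.
have N0 : 0 < N.
  have [u0|u0] := leP 0 u; first by rewrite ltr_pwDl // mulr_ge0.
  have phi1 : phi <= 1.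
    have := exp_pos cE (1 - p).
    rewrite starB star1 ps mulrBl mul1r mulrBr mulr1 pp subrr subr0 linearB /=.
    have -> : E 1 - E p = (rc (1 - phi))%:A.
      by rewrite (exp1 cE) phiE rmorphB rmorph1 scalerBl scale1r.
    by move=> /pos_scalar; rewrite lecR subr_ge0.
  by rewrite /N; nra.
pose a : R[i] := rc N^-1.
pose E' : {linear A -> B} := cut_exp E s a.
have Nrc : rc N != 0 :> R[i] by rewrite fmorph_eq0 gt_eqF.
have aN : a * rc N = 1 by rewrite /a -rmorphM mulVf ?rmorph1 // gt_eqF.
have Ess : E (s * s) = (rc N)%:A.
  by rewrite ss linearD linearZ /= (exp1 cE) phiE scalerA -rmorphM /N rmorphD scalerDl
    rmorph1 scale1r.
have cE' : cond_exp i E'.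
  split=> [b|b x b'|x]; rewrite /E' /= /cut_exp.
  - by rewrite Ms -mulrA (expMl cE) Ess -scalerAr mulr1 scalerA aN scale1r.
  - rewrite !mulrA Ms -!mulrA -Ms (mulrA x) (mulrA s) (mulrA _ _ (i b')) mulrA.
    by rewrite (expM cE) -scalerAr -scalerAl.
  - have [_ _ /(_ (x * s)) [y hy]] := cE.
    exists (rc (Num.sqrt N^-1) *: y); rewrite starZr -scalerAl -scalerAr scalerA.
    rewrite -rmorphM -expr2 sqr_sqrtr ?invr_ge0 ?(ltW N0) // -hy starM sS.
    by rewrite !mulrA.
pose l' k := rc (Num.sqrt N) *: (l k * s').
have rNN : rc (Num.sqrt N) * rc (Num.sqrt N) = rc N :> R[i].
  by rewrite -rmorphM -expr2 sqr_sqrtr // ltW.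
have hq' : qbasis i E' l'.
  move=> x; rewrite -[LHS]mulr1 -ss' mulrA {1}(hq (x * s)) mulr_suml.
  apply: eq_bigr => k _; rewrite /E' /= /cut_exp /l'.
  have -> : s * (star (rc (Num.sqrt N) *: (l k * s')) * x) * s
      = rc (Num.sqrt N) *: (star (l k) * (x * s)).
    by rewrite starZr starM sS' -!scalerAl -scalerAr -scalerAl !mulrA ss' mul1r.
  have sc : rc (Num.sqrt N) * a * rc (Num.sqrt N) = 1 by rewrite mulrAC rNN mulrC.
  have -> (y : A) : i (a *: E (rc (Num.sqrt N) *: y))
      = (a * rc (Num.sqrt N)) *: i (E y) by rewrite linearZ /= linearZ /= linearZ /= scalerA.
  rewrite -scalerAl -scalerAr scalerA (mulrA (rc _)) sc scale1r.
  by rewrite !mulrA -(mulrA _ s') Ms' mulrA.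
(* The index of the perturbed expectation is [N T(s' s')] with [s' s' = 1 - u / (1 + u) p]; it is a
   scalar because [T p] is central in [A]. *)
have idx' : \sum_k l' k * star (l' k) = (rc (N * (c - u / (1 + u) * (c * theta))))%:A.
  transitivity (rc N *: T (s' * s')).
    rewrite scaler_sumr; apply: eq_bigr => k _; rewrite /l' starZr starM sS'.
    by rewrite -scalerAl -scalerAr scalerA rNN !mulrA.
  rewrite s's' TD TZ thetaE.
  have -> : T 1 = (rc c)%:A by rewrite -idx; apply: eq_bigr => k _; rewrite mulr1.
  rewrite scalerA -scalerDl -rmorphM -rmorphD scalerA -rmorphM.
  by rewrite mulNr mulNr.
have := hmin E' (N * (c - u / (1 + u) * (c * theta))).
have hi' : has_index i E' (N * (c - u / (1 + u) * (c * theta))).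
  split=> //; exists m, l'; split=> // x; split; first exact: hq'.
  exact: (qbasis_r hi cE' hq').
move=> /(_ hi').
have -> : N * (c - u / (1 + u) * (c * theta)) = c * (N * (1 + u - u * theta) / (1 + u)).
  by field; rewrite gt_eqF.
rewrite -{1}(mulr1 c) ler_pM2l ?(lt_le_trans ltr01) //.
by rewrite ler_pdivlMr // mul1r.
Qed.

End Minimality.

(** * The basic construction *)

(** The relations that are kept once the action on the Hilbert module is forgotten; [jones_pull]
    brings any [t e] down to [A e]. *)
Record jones (R : realType) (B A D : cstarAlgType R) (i : {lrmorphism B -> A})
    (E : {linear A -> B}) (I : finType) (l : I -> A) (c : R)
    (j : {lrmorphism A -> D}) (e : D) (F : {linear D -> A}) : Prop := Jones {
  jones_base : min_index i E l c;
  jones_star : star_embedding j;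
  jones_exp : cond_exp j F;
  jones_idem : e * e = e;
  jones_adj : star e = e;
  jones_comm : forall b, e * j (i b) = j (i b) * e;
  jones_sand : forall x, e * j x * e = j (i (E x)) * e;
  jones_one : \sum_k j (l k) * e * j (star (l k)) = 1;
  jones_pull : forall t, t * e = rc c *: (j (F (t * e)) * e);
  jones_dual : forall x y, F (j x * e * j y) = rc c^-1 *: (x * y)
}.

Section JonesProjection.
Variables (R : realType) (B A D : cstarAlgType R).
Variables (i : {lrmorphism B -> A}) (E : {linear A -> B}).
Variables (I : finType) (l : I -> A) (c : R).
Variables (j : {lrmorphism A -> D}) (e : D) (F : {linear D -> A}).

Lemma jones_of_basic_construction :
  min_index i E l c -> star_embedding j -> basic_construction i E j e ->
  dual_cond_exp j e c^-1 F -> jones i E l c j e F.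
Proof.
move=> H hj [[act [[a1 a2 a3 a4] [ainj aj ae]]] _] [cF dF].
have [hi cE hq _ _] := H; have c1 := mi_ge1 H.
have c0 : c != 0 by rewrite gt_eqF // (lt_le_trans ltr01).
have act0 t : act t 0 = 0.
  have := a1 t 0 0 1; rewrite mul0r addr0 rmorph1 mulr1 => /eqP.
  by rewrite -{1}[act t 0]addr0 (inj_eq (addrI _)) eq_sym => /eqP.
have actM t x b : act t (x * i b) = act t x * i b.
  by have := a1 t x 0 b; rewrite act0 !addr0.
have actE t s : (forall x, act t x = act s x) -> t = s.
  by move=> h; apply: ainj; apply/funext => x.
have actD s t x : act (s + t) x = act s x + act t x.
  by have := a2 1 s t x; rewrite !scale1r.
have act00 x : act 0 x = 0.
  have := actD 0 0 x; rewrite addr0 => /eqP.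
  by rewrite -{1}[act 0 x]addr0 (inj_eq (addrI _)) eq_sym => /eqP.
have act_sum (J : finType) (G : J -> D) x : act (\sum_k G k) x = \sum_k act (G k) x.
  by apply: (big_morph (fun t => act t x)) => // s t; exact: actD.
have actj1 x : act 1 x = x by rewrite -(rmorph1 j) aj mul1r.
have ee : e * e = e by apply: actE => x; rewrite a3 !ae (expE cE).
have ecomm b : e * j (i b) = j (i b) * e.
  by apply: actE => x; rewrite !a3 aj !ae aj (expMl cE) rmorphM.
have esand x : e * j x * e = j (i (E x)) * e.
  apply: actE => y; rewrite !a3 !ae aj (expMr cE) rmorphM.
  by rewrite aj.
have eone : \sum_k j (l k) * e * j (star (l k)) = 1.
  apply: actE => x; rewrite act_sum actj1 [RHS]hq; apply: eq_bigr => k _.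
  by rewrite !a3 !aj ae.
split=> //.
- apply: actE => y; rewrite ae; apply/eqP; rewrite -subr_eq0; apply/eqP.
  apply: (exp_nondegr hq) => x.
  rewrite mulrBr linearB /= -{1}(starK x) -a4 ae -(embed_star hi) -(exp_star cE).
  by rewrite starK (expMl cE) (expMr cE) subrr.
- move=> t.
  (* The range of [e] is [i B], on which the right [B]-linear operator [t] is determined by its
     value at 1. *)
  have h : t * e = j (act t 1) * e.
    by apply: actE => x; rewrite !a3 aj ae -actM mul1r.
  rewrite {2}h -[j (act t 1) * e]mulr1 -(rmorph1 j) dF mulr1 linearZ /= -scalerAl.
  by rewrite scalerA -rmorphM divff // rmorph1 scale1r.
Qed.

Hypothesis (H : jones i E l c j e F).

Lemma jones_c_gt0 : 0 < c.
Proof. by apply: lt_le_trans ltr01 (mi_ge1 (jones_base H)). Qed.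

Lemma jones_c_unit : rc c * rc c^-1 = 1 :> R[i].
Proof. by rewrite -rmorphM divff ?rmorph1 // gt_eqF // jones_c_gt0. Qed.

Lemma jones_pull_l t : e * t = rc c *: (e * j (F (e * t))).
Proof.
have [_ hj cF _ ae _ _ _ hp _] := H.
apply: star_inj; rewrite starM ae hp starZr starM ae -(embed_star hj).
by rewrite -(exp_star cF) starM ae.
Qed.

Lemma jones_exp_e : F e = (rc c^-1)%:A.
Proof. by have := jones_dual H 1 1; rewrite rmorph1 !mulr1 mul1r. Qed.

Lemma jones_inj x : j x * e = 0 -> x = 0.
Proof.
move=> h; have := jones_dual H x 1; rewrite rmorph1 mulr1 h linear0 mulr1.
by move=> /esym/eqP; rewrite scaler_eq0 fmorph_eq0 invr_eq0 (gt_eqF jones_c_gt0) => /eqP.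
Qed.

(** In the module picture this is the value of the operator [a] at the vector 1. On the relative
    commutant of [A] it inverts [rmul_proj]. *)
Definition pushdown (a : D) : A := rc c *: F (a * e).

Lemma pushdownE a : a * e = j (pushdown a) * e.
Proof. by rewrite {1}(jones_pull H) /pushdown linearZ /= scalerAl. Qed.

Lemma pushdown_relcomm a : relcomm j a -> relcomm i (pushdown a).
Proof.
move=> ha b; apply/eqP; rewrite -subr_eq0; apply/eqP/jones_inj.
rewrite rmorphB mulrBl !rmorphM -mulrA -(jones_comm H) mulrA -pushdownE.
by rewrite -mulrA (jones_comm H) mulrA ha -!mulrA pushdownE subrr.
Qed.

(* The image in the relative commutant of [A] of right multiplication by [p]. *)
Definition rmul_proj (p : A) : D := \sum_k j (l k * p) * e * j (star (l k)).

Lemma rmul_pushdown a : relcomm j a -> rmul_proj (pushdown a) = a.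
Proof.
move=> ha; rewrite -[RHS]mulr1 -(jones_one H) mulr_sumr; apply: eq_bigr => k _.
by rewrite rmorphM -(mulrA _ _ e) -pushdownE !mulrA ha.
Qed.

(** The [c] of [mi_trace] cancels the [c^-1] of the dual expectation. So [rmul_proj] preserves
    traces, which is why the two minimal traces agree. *)
Lemma exp_rmul p : relcomm i p -> F (rmul_proj p) = i (E p).
Proof.
move=> hp; rewrite linear_sum.
under eq_bigr do rewrite /= (jones_dual H).
rewrite -scaler_sumr (mi_trace (jones_base H)) // scalerA mulrC.
by rewrite jones_c_unit scale1r.
Qed.

Lemma rmul_relcomm p : relcomm i p -> relcomm j (rmul_proj p).
Proof.
move=> hp; have [hi cE hq _ _] := jones_base H.
have := @qbasis_sum_comm _ _ _ D i E j hi cE I l hq (j p * e).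
have -> : \sum_k j (l k) * (j p * e) * j (star (l k)) = rmul_proj p.
  by apply: eq_bigr => k _; rewrite rmorphM !mulrA.
apply=> b /=; rewrite -mulrA (jones_comm H) !mulrA -!rmorphM.
by rewrite hp.
Qed.

Lemma rmul_e p : relcomm i p -> rmul_proj p * e = j p * e.
Proof.
move=> hp; rewrite mulr_suml.
have [_ _ hq _ _] := jones_base H.
rewrite -[in RHS](mul1r p) [in RHS](hq 1) mulr_suml rmorph_sum mulr_suml.
apply: eq_bigr => k _.
by rewrite -!mulrA (mulrA e) (jones_sand H) mulrA -rmorphM mulr1 -mulrA hp mulrA.
Qed.

Lemma relcomm_expand a : relcomm j a -> a = \sum_k j (l k) * (a * e) * j (star (l k)).
Proof.
move=> ha; rewrite -[LHS]mulr1 -(jones_one H) mulr_sumr; apply: eq_bigr => k _.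
by rewrite !mulrA ha.
Qed.

(** Right multiplication by [star p] is the adjoint for the inner product [E (star x * y)] because
    [E] is tracial on the relative commutant. *)
Lemma rmul_star p : relcomm i p -> star (rmul_proj p) = rmul_proj (star p).
Proof.
move=> hp; have [hi cE hq _ ht] := jones_base H; have hj := jones_star H.
have hp' : relcomm i (star p) by exact: relcommS hi _ hp.
have c0 : c != 0 by rewrite gt_eqF // jones_c_gt0.
rewrite [LHS]relcomm_expand; last by apply: (relcommS hj); exact: rmul_relcomm.
rewrite [RHS]/rmul_proj; apply: eq_bigr => k _; rewrite rmorphM -(mulrA (j (l k)) _ e);
  congr (_ * _ * _).
rewrite star_sum mulr_suml.
transitivity (\sum_k j (l k) * (j (i (E (star p * star (l k)))) * e)).
  apply: eq_bigr => m _; rewrite !starM (jones_adj H) -!(embed_star hj) starK.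
  by rewrite starM -!mulrA (mulrA e) (jones_sand H).
rewrite {2}(hq (star p)) rmorph_sum mulr_suml; apply: eq_bigr => m _.
by rewrite rmorphM mulrA (exp_trace hi cE hq c0 ht _ hp').
Qed.

Lemma rmul_projection p : relcomm i p -> projection p -> projection (rmul_proj p).
Proof.
move=> hp [pp ps]; split; last by rewrite rmul_star // ps.
have hR := rmul_relcomm hp.
rewrite [LHS]relcomm_expand; last exact: relcommM.
rewrite [RHS]relcomm_expand //; apply: eq_bigr => k _; congr (_ * _ * _).
by rewrite -mulrA rmul_e // mulrA hR -mulrA rmul_e // mulrA -rmorphM pp.
Qed.

Lemma pushdown_projection a : relcomm j a -> projection a -> projection (pushdown a).
Proof.
move=> ha [aa as_].
have hp := pushdown_relcomm ha; have [hi cE hq _ _] := jones_base H.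
have hp' : relcomm i (star (pushdown a)) by exact: relcommS hi _ hp.
split; apply/eqP; rewrite -subr_eq0; apply/eqP/jones_inj; rewrite rmorphB mulrBl.
  by rewrite rmorphM -mulrA -pushdownE mulrA -ha -mulrA -pushdownE mulrA aa subrr.
rewrite -rmul_e // -rmul_star // rmul_pushdown // as_ pushdownE.
by rewrite subrr.
Qed.

(** The factor [sqrt c] compensates [F e = 1 / c]. As to [mi_trace]: [e a e] is a multiple [z e] for
    [a] commuting with [A], so the sum is [c z] by [jones_one], and [F a = z] by [exp_rmul]. *)
Lemma dual_min_index : scalar_center B ->
  min_index j F (fun k => rc (Num.sqrt c) *: (j (l k) * e)) c.
Proof.
move=> ZB; have [hi cE hq hidx ht] := jones_base H; have hj := jones_star H.
have c0 := jones_c_gt0; have ee := jones_idem H; have es := jones_adj H.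
have sc : rc (Num.sqrt c) * rc (Num.sqrt c) = rc c :> R[i].
  by rewrite -rmorphM -expr2 sqr_sqrtr // ltW.
split=> //; first exact: jones_exp H.
- move=> x; rewrite -[LHS]mul1r -(jones_one H) mulr_suml; apply: eq_bigr => k _.
  have -> : star (rc (Num.sqrt c) *: (j (l k) * e)) * x
      = rc (Num.sqrt c) *: (e * star (j (l k)) * x) by rewrite starZr starM es -scalerAl.
  rewrite linearZ /= linearZ /= -scalerAl -scalerAr scalerA sc.
  have -> : j (l k) * e * j (star (l k)) * x = j (l k) * (e * (j (star (l k)) * x)).
    by rewrite !mulrA.
  by rewrite jones_pull_l -scalerAr (embed_star hj) !mulrA.
- transitivity (rc c *: \sum_k j (l k) * e * j (star (l k))).
    rewrite scaler_sumr; apply: eq_bigr => k _.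
    rewrite starZr starM es -scalerAl -scalerAr scalerA sc -(embed_star hj).
    by rewrite !mulrA -(mulrA _ e e) ee.
  by rewrite (jones_one H).
- move=> a ha; have hp := pushdown_relcomm ha.
  have Ep := trace_ofE cE ZB hp; set z := trace_of E _ in Ep.
  have eae : e * a * e = z *: e.
    rewrite -mulrA pushdownE mulrA (jones_sand H) Ep !embed_scalar.
    by rewrite mulr_algl.
  have -> : F a = z%:A.
    by rewrite -{1}(rmul_pushdown ha) exp_rmul // Ep embed_scalar.
  transitivity (rc c *: \sum_k z *: (j (l k) * e * j (star (l k)))).
    rewrite scaler_sumr; apply: eq_bigr => k _.
    rewrite starZr starM es -!scalerAl -scalerAr [LHS]scalerA sc -(embed_star hj).
    have -> : j (l k) * e * a * (e * j (star (l k)))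
        = j (l k) * (e * a * e) * j (star (l k)) by rewrite !mulrA.
    by rewrite eae -scalerAr -scalerAl.
  by rewrite -scaler_sumr (jones_one H) embed_scalar.
Qed.

End JonesProjection.

(** * Fourier transform and convolution *)

Section Tower.
Variables (R : realType) (B A A1 A2 : cstarAlgType R).
Variables (i0 : {lrmorphism B -> A}) (E0 : {linear A -> B}).
Variables (I : finType) (l : I -> A) (c : R).
Variables (i1 : {lrmorphism A -> A1}) (e1 : A1) (E1 : {linear A1 -> A}).
Variables (i2 : {lrmorphism A1 -> A2}) (e2 : A2) (E2 : {linear A2 -> A1}).
Variable (d : R[i]).
Hypotheses (d0 : d != 0) (ds : (d^* = d)%R) (rc_c : rc c = d ^+ 2 :> R[i]).
(** The quasi-basis of [E1] from [dual_min_index]. The square root [d] of the index is an abstract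
    self-conjugate scalar here, so that its powers are simplified by [field]. *)
Let m k := d *: (i1 (l k) * e1).
Hypothesis (J1 : jones i0 E0 l c i1 e1 E1).
Hypothesis (J2 : jones i1 E1 m c i2 e2 E2).
Let f : A2 := i2 e1.
Let J (a : A) : A2 := i2 (i1 a).
Let M1 : set A1 := relcomm (i1 \o i0).
Let L : set A2 := relcomm (i2 \o i1 \o i0).
Let N2 : set A2 := relcomm (i2 \o i1).

Let hi0 : star_embedding i0. Proof. by case: (jones_base J1). Qed.
Let cE0 : cond_exp i0 E0. Proof. by case: (jones_base J1). Qed.
Let hq : qbasis i0 E0 l. Proof. by case: (jones_base J1). Qed.
Let hi1 : star_embedding i1. Proof. exact: jones_star J1. Qed.
Let hi2 : star_embedding i2. Proof. exact: jones_star J2. Qed.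
Let cE1 : cond_exp i1 E1. Proof. exact: jones_exp J1. Qed.
Let cE2 : cond_exp i2 E2. Proof. exact: jones_exp J2. Qed.

Lemma rc_cV : rc c^-1 = d ^- 2 :> R[i].
Proof. by rewrite -rc_c fmorphV. Qed.

Lemma JM a b : J (a * b) = J a * J b.
Proof. by rewrite /J !rmorphM. Qed.

Lemma i2_comm x b : M1 x -> i2 x * J (i0 b) = J (i0 b) * i2 x.
Proof. by move=> hx; rewrite /J -!rmorphM hx. Qed.

Lemma one_l : \sum_k l k * i0 (E0 (star (l k))) = 1.
Proof. by rewrite [RHS]hq; apply: eq_bigr => k _; rewrite mulr1. Qed.

Lemma e2_comm u a : u * e2 * J a = u * J a * e2.
Proof. by rewrite -mulrA (jones_comm J2) mulrA. Qed.

Lemma e2_sand u x : u * e2 * i2 x * e2 = u * J (E1 x) * e2.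
Proof. by rewrite -2!mulrA mulrA -!mulrA (mulrA e2) (jones_sand J2) mulrA. Qed.

Lemma e1_sand a : e1 * i1 a * e1 = i1 (i0 (E0 a)) * e1.
Proof. exact: (jones_sand J1). Qed.

Lemma E1_e1 : E1 e1 = (d ^- 2)%:A.
Proof. by rewrite (jones_exp_e J1) rc_cV. Qed.

Lemma E1_sand a : E1 (e1 * i1 a * e1) = d ^- 2 *: i0 (E0 a).
Proof. by rewrite e1_sand (expMl cE1) E1_e1 mulr_algr. Qed.

Lemma E2_dual x y : E2 (i2 x * e2 * i2 y) = d ^- 2 *: (x * y).
Proof. by rewrite (jones_dual J2) rc_cV. Qed.

Lemma E2_dualr x : E2 (i2 x * e2) = d ^- 2 *: x.
Proof. by have := E2_dual x 1; rewrite rmorph1 !mulr1. Qed.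

Lemma e2_e1_e2 : e2 * f * e2 = d ^- 2 *: e2.
Proof. by rewrite (jones_sand J2) E1_e1 !embed_scalar mulr_algl. Qed.

Lemma f_comm b : f * J (i0 b) = J (i0 b) * f.
Proof. by rewrite /f /J -!rmorphM (jones_comm J1). Qed.

Lemma f_sand a : f * J a * f = J (i0 (E0 a)) * f.
Proof. by rewrite /f /J -!rmorphM e1_sand. Qed.

Lemma J_one : \sum_k J (l k) * f * J (star (l k)) = 1.
Proof.
rewrite -[RHS](rmorph1 i2) -(jones_one J1) rmorph_sum.
by apply: eq_bigr => k _; rewrite /J /f !rmorphM.
Qed.

(** While [e2_e1_e2] is immediate from [jones_sand], this relation comes from compressing the
    resolution of the identity [jones_one J2] by [f] on both sides; the sum over the quasi-basis
    then collapses by [one_l]. *)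
Lemma e1_e2_e1 : f * e2 * f = d ^- 2 *: f.
Proof.
pose g := f * e2 * f.
have h : d ^+ 2 *: \sum_k J (l k) * g * J (star (l k)) = 1.
  rewrite -(jones_one J2) scaler_sumr; apply: eq_bigr => k _.
  rewrite /m starZ ds starM (jones_adj J1) !linearZ /= !rmorphM -!scalerAl -scalerAr.
  by rewrite scalerA -(embed_star hi1) -expr2 /J /g -/f !mulrA.
have h2 : d ^+ 2 *: g = f.
  have := congr1 (fun t => f * t * f) h; rewrite mulr1.
  have -> : f * f = f by rewrite /f -rmorphM (jones_idem J1).
  move=> <-; rewrite -scalerAr -scalerAl; congr (_ *: _).
  rewrite mulr_sumr mulr_suml.
  have sJ : \sum_k J (i0 (E0 (l k * i0 (E0 (star (l k)))))) = 1.
    by rewrite /J -!rmorph_sum -linear_sum one_l (exp1 cE0) !rmorph1.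
  rewrite -[LHS]mul1r -sJ mulr_suml; apply: eq_bigr => k _.
  rewrite (expMr cE0) rmorphM JM.
  have -> : f * (J (l k) * g * J (star (l k))) * f
    = f * J (l k) * f * e2 * (f * J (star (l k)) * f) by rewrite /g !mulrA.
  by rewrite !f_sand [RHS]mulrA e2_comm -(mulrA _ f) f_comm /g !mulrA.
by rewrite -[in RHS]h2 scalerA mulVf ?scale1r // expf_neq0.
Qed.

(** The prefactor is [delta^3 tau = delta], where [tau] is that of [comm_exp];
    [trace_cond_exp_unique] identifies [comm_exp] with the given expectation on the relative
    commutant of [B]. *)
Definition fourier0 (x : A1) : A2 :=
  d *: \sum_k J (l k) * i2 x * e2 * f * J (star (l k)).

Definition inv_fourier0 (w : A2) : A1 := d ^+ 3 *: E2 (w * f * e2).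

Definition comm_exp (t : A2) : A2 := d ^- 2 *: \sum_k J (l k) * t * J (star (l k)).

Local Notation F := fourier0.
Local Notation G := inv_fourier0.
Local Notation P := comm_exp.

Lemma L_of_M1 x : M1 x -> L (i2 x).
Proof. by move=> hx b /=; rewrite -!rmorphM hx. Qed.

Lemma L_of_N2 w : N2 w -> L w.
Proof. by move=> hw b; exact: (hw (i0 b)). Qed.

Lemma L_e2 : L e2.
Proof. by move=> b /=; rewrite (jones_comm J2). Qed.

Lemma L_f : L f.
Proof. by move=> b; rewrite f_comm. Qed.

Lemma L_M s t : L s -> L t -> L (s * t).
Proof. exact: relcommM. Qed.

Lemma M1_E2 t : L t -> M1 (E2 t).
Proof. by move=> ht b; rewrite -(expMr cE2) -(expMl cE2); congr (E2 _); exact: ht. Qed.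

Lemma N2_P t : L t -> N2 (P t).
Proof.
move=> ht; apply: relcommZ.
exact: (@qbasis_sum_comm _ _ _ A2 i0 E0 (i2 \o i1 : {lrmorphism A -> A2}) hi0 cE0 _ l hq t ht).
Qed.

Lemma fourier0P x : F x = d ^+ 3 *: P (i2 x * e2 * f).
Proof.
rewrite /F /P scalerA.
have -> : d ^+ 3 / d ^+ 2 = d by field.
by congr (_ *: _); apply: eq_bigr => k _; rewrite !mulrA.
Qed.

Lemma N2_F x : M1 x -> N2 (F x).
Proof.
move=> hx; rewrite fourier0P; apply/relcommZ/N2_P/L_M; last exact: L_f.
by apply: L_M; [exact: L_of_M1|exact: L_e2].
Qed.

Lemma M1_G w : N2 w -> M1 (G w).
Proof.
move=> hw; apply/relcommZ/M1_E2/L_M; last exact: L_e2.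
by apply: L_M; [exact: L_of_N2|exact: L_f].
Qed.

(** The Fourier inversion formula before [E2] is applied. It eliminates the transform of [x] in
    [conv0E]. *)
Lemma fourier0_v x : M1 x -> F x * f * e2 = d^-1 *: (i2 x * e2).
Proof.
move=> hx; rewrite /F -!scalerAl !mulr_suml.
transitivity (d *: \sum_k d ^- 2 *: (J (l k * i0 (E0 (star (l k)))) * i2 x * e2)).
  congr (_ *: _); apply: eq_bigr => k _.
  have -> : J (l k) * i2 x * e2 * f * J (star (l k)) * f * e2
    = J (l k) * i2 x * e2 * (f * J (star (l k)) * f) * e2 by rewrite !mulrA.
  rewrite f_sand mulrA e2_comm -(mulrA _ e2) -(mulrA _ (e2 * f)) e2_e1_e2.
  rewrite -scalerAr; congr (_ *: (_ * _)); rewrite -mulrA.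
  by rewrite i2_comm // mulrA JM.
rewrite -scaler_sumr scalerA -!mulr_suml /J -!rmorph_sum one_l !rmorph1 mul1r.
by congr (_ *: _); field.
Qed.

Lemma conv0E x y : M1 x ->
  G (F y * F x) = d *: \sum_k i1 (l k) * y * i1 (E1 (e1 * i1 (star (l k)) * x)).
Proof.
move=> hx; rewrite /G -!mulrA (mulrA (F x)) fourier0_v //.
have -> : F y * (d^-1 *: (i2 x * e2))
    = \sum_k J (l k) * i2 y * e2 * f * J (star (l k)) * (i2 x * e2).
  by rewrite -scalerAr /F -scalerAl scalerA mulVf // scale1r mulr_suml.
rewrite linear_sum /=.
transitivity (d ^+ 3 *: \sum_k d ^- 2 *:
    (i1 (l k) * y * i1 (E1 (e1 * i1 (star (l k)) * x)))).
  congr (_ *: _); apply: eq_bigr => k _.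
  have -> : J (l k) * i2 y * e2 * f * J (star (l k)) * (i2 x * e2)
     = J (l k) * i2 y * e2 * i2 (e1 * i1 (star (l k)) * x) * e2.
    by rewrite /J /f !rmorphM !mulrA.
  by rewrite e2_sand /J -!rmorphM E2_dualr.
by rewrite -scaler_sumr scalerA; congr (_ *: _); field.
Qed.

Lemma e1_sand_rel x : exists b, e1 * x * e1 = i1 (i0 b) * e1.
Proof.
by exists (E0 (pushdown c e1 E1 x)); rewrite -mulrA (pushdownE J1) mulrA e1_sand.
Qed.

(** Inserting [jones_one] after [x] in [conv0E] creates the second index of the double sum on the
    right. Its middle factor [E1 (e1 ... e1)] lies in [B], so [star y2] can move across it. *)
Lemma conv_mulstar x y1 y2 : M1 x -> M1 y1 -> M1 y2 ->
  G (F (y1 * star y2) * F x) = d *: E2 (F y1 * i2 x * star (F y2)).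
Proof.
move=> hx h1 h2; rewrite conv0E //; congr (_ *: _).
have sF : star (F y2) = d *: \sum_k J (l k) * f * e2 * star (i2 y2) * J (star (l k)).
  rewrite /F starZ ds star_sum; congr (_ *: _); apply: eq_bigr => k _.
  rewrite !starM (jones_adj J2) /J -!(embed_star hi2) -!(embed_star hi1) starK.
  by rewrite (jones_adj J1) !mulrA.
rewrite sF /F -!scalerAl -scalerAr scalerA linearZ /= mulr_suml mulr_suml linear_sum.
rewrite scaler_sumr; apply: eq_bigr => k _.
rewrite mulr_sumr linear_sum scaler_sumr.
transitivity (\sum_k' i1 (l k) * y1 * i1 (E1 (e1 * i1 (star (l k)) * x * i1 (l k') * e1)) *
  star y2 * i1 (star (l k'))); last first.
  apply: eq_bigr => k' _.
  have -> : J (l k) * i2 y1 * e2 * f * J (star (l k)) * i2 x * (J (l k') * f * e2 * star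
    (i2 y2) * J (star (l k')))
    = J (l k) * i2 y1 * e2 * i2 (e1 * i1 (star (l k)) * x * i1 (l k') * e1) * e2 * star (i2
      y2) * J (star (l k')).
    by rewrite /J /f !rmorphM !mulrA.
  rewrite e2_sand -(embed_star hi2) -(mulrA _ (i2 (star y2))) /J -!rmorphM E2_dual scalerA.
  by rewrite -expr2 divff ?expf_neq0 // scale1r !mulrA.
transitivity (\sum_k' i1 (l k) * (y1 * star y2) * (i1 (E1 (e1 * i1 (star (l k)) * x * i1 (l
  k') * e1)) * i1 (star (l k')))).
  rewrite -mulr_sumr; congr (_ * _).
  transitivity (i1 (\sum_k' E1 (e1 * i1 (star (l k)) * x * i1 (l k') * e1) * star (l k'))).
    congr (i1 _); under eq_bigr do rewrite -(expMr cE1).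
    rewrite -linear_sum; congr (E1 _).
    under eq_bigr do rewrite -2!mulrA (mulrA (i1 _)).
    by rewrite -mulr_sumr (jones_one J1) mulr1.
  by rewrite rmorph_sum; apply: eq_bigr => k' _; rewrite rmorphM.
apply: eq_bigr => k' _.
have -> : e1 * i1 (star (l k)) * x * i1 (l k') * e1 = e1 * (i1 (star (l k)) * x * i1 (l
  k')) * e1 by rewrite !mulrA.
have [b ->] := e1_sand_rel (i1 (star (l k)) * x * i1 (l k')).
rewrite (expMl cE1) E1_e1 mulr_algr linearZ /= -!scalerAl -!scalerAr -!scalerAl; congr (_ *: _).
rewrite !mulrA; congr (_ * _); rewrite -!mulrA; congr (_ * (_ * _)).
exact: (relcommS (star_embedding_comp hi0 hi1) h2).
Qed.

Lemma fourier0Z (a : R[i]) x : F (a *: x) = a *: F x.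
Proof.
rewrite /F scalerA mulrC -scalerA; congr (_ *: _); rewrite scaler_sumr.
apply: eq_bigr => k _; rewrite linearZ /= -scalerAr -!scalerAl.
by [].
Qed.

Lemma inv_fourier0_e2 w : i2 (G w) * e2 = d *: (w * f * e2).
Proof.
rewrite [in RHS](jones_pull J2) rc_c scalerA -exprS /G linearZ /= -scalerAl.
by [].
Qed.

Lemma inv_fourier0K w : N2 w -> F (G w) = w.
Proof.
move=> hw; rewrite /F.
transitivity (d *: \sum_k d^-1 *: (w * (J (l k) * f * J (star (l k))))).
  congr (_ *: _); apply: eq_bigr => k _.
  have -> : J (l k) * i2 (G w) * e2 * f * J (star (l k))
    = J (l k) * (i2 (G w) * e2) * f * J (star (l k)) by rewrite !mulrA.
  rewrite inv_fourier0_e2 -scalerAr -!scalerAl.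
  have -> : J (l k) * (w * f * e2) * f * J (star (l k))
    = J (l k) * w * (f * e2 * f) * J (star (l k)) by rewrite !mulrA.
  rewrite e1_e2_e1 -scalerAr -scalerAl scalerA -hw !mulrA; congr (_ *: _).
  by field.
by rewrite -scaler_sumr scalerA divff // scale1r -mulr_sumr J_one mulr1.
Qed.

Lemma E1_rel x u : M1 x -> E1 (e1 * i1 u * x) = \sum_k E1 (e1 * i1 (l k) * x) * i0 (E0
  (star (l k) * u)).
Proof.
move=> hx; rewrite {1}(hq u) rmorph_sum mulr_sumr mulr_suml linear_sum.
apply: eq_bigr => k _; rewrite -(expMr cE1); congr (E1 _).
by rewrite rmorphM -!mulrA; congr (_ * (_ * _)); rewrite hx.
Qed.

(** [G] need not commute with [star]; the discrepancy is a rotation, visible as the passage of [e1]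
    from right to left. Writing [star w] as [F (G (star w))] reduces it to [E1_rel]. *)
Lemma inv_fourier0_rot w a : N2 w ->
  E1 (star (G w) * i1 a * e1) = E1 (e1 * i1 a * G (star w)).
Proof.
move=> hw; set x := G (star w).
have hw' : N2 (star w).
  exact: (relcommS (star_embedding_comp hi1 hi2) hw).
have hx : M1 x by exact: M1_G.
have -> : star (G w) = d ^+ 2 *: \sum_k i1 (E1 (e1 * i1 (l k) * x)) * e1 * i1 (star (l k)).
  rewrite /G starZ rmorphXn /= ds -(exp_star cE2) !starM (jones_adj J2).
  rewrite -(embed_star hi2) (jones_adj J1) -/f mulrA -{1}(inv_fourier0K hw') -/x.
  rewrite /F -scalerAr linearZ /= scalerA mulr_sumr linear_sum /=.
  transitivity (d ^+ 3 * d *: \sum_k d ^- 2 *: (i1 (E1 (e1 * i1 (l k) * x)) * e1 * i1 (star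
    (l k)))).
    congr (_ *: _); apply: eq_bigr => k _.
    have -> : e2 * f * (J (l k) * i2 x * e2 * f * J (star (l k)))
      = 1 * e2 * i2 (e1 * i1 (l k) * x) * e2 * i2 (e1 * i1 (star (l k))).
      by rewrite /f /J !rmorphM mul1r !mulrA.
    by rewrite e2_sand mul1r /J E2_dual mulrA.
  by rewrite -scaler_sumr scalerA; congr (_ *: _); field.
rewrite -!scalerAl linearZ /= !mulr_suml linear_sum (E1_rel _ hx) scaler_sumr.
apply: eq_bigr => k _ /=.
have -> : i1 (E1 (e1 * i1 (l k) * x)) * e1 * i1 (star (l k)) * i1 a * e1
  = i1 (E1 (e1 * i1 (l k) * x)) * (e1 * i1 (star (l k) * a) * e1).
  by rewrite rmorphM !mulrA.
rewrite (expMl cE1) E1_sand -scalerAr scalerA divff ?scale1r //.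
by rewrite expf_neq0.
Qed.

(** [star y * star (l k) * e1] pulls down to [A e1], and [A] commutes with [w]; what remains on the
    right is [w f e2], that is, [G w]. *)
Lemma inv_fourier0_P x y w : N2 w ->
  G (P (i2 x * w * star (i2 y)))
    = \sum_k i1 (l k) * x * i1 (E1 (star y * i1 (star (l k)) * e1)) * G w.
Proof.
move=> hw; rewrite /G /P -!scalerAl linearZ /= scalerA !mulr_suml linear_sum /=.
rewrite scaler_sumr; apply: eq_bigr => k _.
set a := E1 (star y * i1 (star (l k)) * e1).
have e : star y * i1 (star (l k)) * e1 = d ^+ 2 *: (i1 a * e1).
  by rewrite [LHS](jones_pull J1) rc_c.
have -> : J (l k) * (i2 x * w * star (i2 y)) * J (star (l k)) * f * e2
  = d ^+ 2 *: (i2 (i1 (l k) * x * i1 a) * (w * f * e2)).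
  transitivity (J (l k) * i2 x * w * i2 (star y * i1 (star (l k)) * e1) * e2).
    by rewrite -(embed_star hi2) /J /f !rmorphM !mulrA.
  rewrite e linearZ /= -scalerAr -scalerAl; congr (_ *: _).
  have -> : J (l k) * i2 x * w * i2 (i1 a * e1) * e2 = J (l k) * i2 x * (w * J a) * f * e2.
    by rewrite /J /f rmorphM !mulrA.
  by rewrite (hw a) /J /= !rmorphM !mulrA.
rewrite linearZ /= (expMl cE2) -scalerAr scalerA; congr (_ *: _).
by field.
Qed.

(** The two sides are compared before [F]: [inv_fourier0_P] computes the right one and [conv0E], for
    [G z1] and [G (star z2)], the left one. The factor [G w] splits off and [inv_fourier0_rot]
    matches the rest. *)
Lemma conv_mulstar_dual w z1 z2 : N2 w -> N2 z1 -> N2 z2 ->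
  F (G (z1 * star z2) * G w) = d *: P (i2 (G z1) * w * star (i2 (G z2))).
Proof.
move=> hw h1 h2.
have h2' : N2 (star z2) by exact: (relcommS (star_embedding_comp hi1 hi2) h2).
have hx1 := M1_G h1; have hx2 := M1_G h2; have hx2' := M1_G h2'.
have hM : N2 (P (i2 (G z1) * w * star (i2 (G z2)))).
  apply: N2_P; apply: L_M.
    by apply: L_M; [exact: L_of_M1|exact: L_of_N2].
  rewrite -(embed_star hi2); apply: L_of_M1.
  exact: (relcommS (star_embedding_comp hi0 hi1) hx2).
rewrite -[in RHS](inv_fourier0K hM) -fourier0Z; congr F.
rewrite inv_fourier0_P // -mulr_suml scalerAl; congr (_ * _).
have -> : G (z1 * star z2) = G (F (G z1) * F (G (star z2))) by rewrite !inv_fourier0K.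
rewrite conv0E //; congr (_ *: _); apply: eq_bigr => k _.
by rewrite inv_fourier0_rot.
Qed.

Lemma fourier0_1 : F 1 = d *: e2.
Proof.
rewrite /F; congr (_ *: _); rewrite -[RHS]mulr1 -J_one mulr_sumr.
apply: eq_bigr => k _; rewrite rmorph1 mulr1 !mulrA; congr (_ * _ * _).
by have := e2_comm 1 (l k); rewrite !mul1r.
Qed.

Lemma inv_fourier0_1 : G 1 = d *: e1.
Proof. by rewrite /G mul1r E2_dualr scalerA; congr (_ *: _); field. Qed.

Lemma E0E1_P t : E1 (E2 (P t)) = d ^- 2 *: \sum_k l k * E1 (E2 t) * star (l k).
Proof.
rewrite /P linearZ linearZ /=; congr (_ *: _); rewrite !linear_sum; apply: eq_bigr => k _.
by rewrite /= (expM cE2) (expM cE1).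
Qed.

Lemma exp_P t : L t -> E0 (E1 (E2 (P t))) = E0 (E1 (E2 t)).
Proof.
move=> ht; rewrite E0E1_P (mi_trace (jones_base J1)).
  by rewrite rc_c scalerA mulVf ?expf_neq0 // scale1r (expE cE0).
by move=> b; rewrite -(expMr cE1) -(expMl cE1) (M1_E2 ht).
Qed.

Lemma P_mulr n t : N2 n -> P (n * t) = n * P t.
Proof.
move=> hn; rewrite /P -scalerAr mulr_sumr; congr (_ *: _); apply: eq_bigr => k _.
by rewrite !mulrA; congr (_ * _ * _); rewrite hn.
Qed.

Lemma P_mull n t : N2 n -> P (t * n) = P t * n.
Proof.
move=> hn; rewrite /P -scalerAl mulr_suml; congr (_ *: _); apply: eq_bigr => k _.
by rewrite -!mulrA; congr (_ * (_ * _)); rewrite hn.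
Qed.

End Tower.

(** * Singular values in a tracial algebra *)

Section TracialAlgebra.
Variables (R : realType) (D : cstarAlgType R) (M : set D) (tr : D -> R[i]).
Hypothesis (HT : tracial_alg M tr).
Implicit Types (x y a u : D).

Let M1 := tracial_1 HT.
Let MD := tracial_D HT.
Let MZ := tracial_Z HT.
Let MM := tracial_M HT.
Let MS := tracial_S HT.

Lemma tracial_0 : M 0.
Proof. by rewrite -(scale0r (1 : D)); exact: MZ. Qed.

Lemma tracial_B x y : M x -> M y -> M (x - y).
Proof. by move=> hx hy; apply: MD => //; rewrite -scaleN1r; exact: MZ. Qed.

Lemma tracial_sum (I : Type) (r : seq I) (P : pred I) (F : I -> D) :
  (forall i, M (F i)) -> M (\sum_(i <- r | P i) F i).
Proof.
by move=> h; elim/big_rec: _ => [|i y _ hy]; [exact: tracial_0|exact: MD].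
Qed.

Lemma tracial_poly (P : {poly R}) x : M x -> M (poly_at P x).
Proof.
move=> hx; elim/poly_ind: P => [|P c IH]; first by rewrite poly_at0; exact: tracial_0.
by rewrite poly_atD poly_atM poly_atX poly_atC; apply: MD; [exact: MM|exact: MZ].
Qed.

Definition rtr x : R := complex.Re (tr x).

Lemma ReD (z w : R[i]) : complex.Re (z + w) = complex.Re z + complex.Re w.
Proof. by case: z w => [? ?] [? ?]. Qed.

Lemma Re_rcM (c : R) (z : R[i]) : complex.Re (rc c * z) = c * complex.Re z.
Proof. by case: z => a b /=; rewrite mul0r subr0. Qed.

Lemma rtrD x y : M x -> M y -> rtr (x + y) = rtr x + rtr y.
Proof. by move=> hx hy; rewrite /rtr (trD HT) // ReD. Qed.

Lemma rtrZ (c : R) x : M x -> rtr (rc c *: x) = c * rtr x.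
Proof. by move=> hx; rewrite /rtr (trZ HT) // Re_rcM. Qed.

Lemma rtrB x y : M x -> M y -> rtr (x - y) = rtr x - rtr y.
Proof.
move=> hx hy; have -> : x - y = x + rc (-1) *: y by rewrite rmorphN1 scaleN1r.
by rewrite rtrD ?rtrZ ?mulN1r //; exact: MZ.
Qed.

Lemma rtr0 : rtr 0 = 0.
Proof. by have := rtrB M1 M1; rewrite !subrr. Qed.

Lemma rtr_sum (I : Type) (r : seq I) (P : pred I) (F : I -> D) :
  (forall i, M (F i)) -> rtr (\sum_(i <- r | P i) F i) = \sum_(i <- r | P i) rtr (F i).
Proof.
move=> h; elim: r => [|i r IH]; first by rewrite !big_nil rtr0.
rewrite !big_cons; case: ifP => // _; rewrite rtrD // ?IH //.
exact: tracial_sum.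
Qed.

Lemma rtrC x y : M x -> M y -> rtr (x * y) = rtr (y * x).
Proof. by move=> hx hy; rewrite /rtr (trC HT). Qed.

Lemma rtr_ge0 x : M x -> 0 <= rtr (star x * x).
Proof. by move=> /(tr_ge0 HT); rewrite lecE => /andP[_]. Qed.

Lemma rtr_ge0' x : M x -> 0 <= rtr (x * star x).
Proof. by move=> hx; rewrite -{1}(starK x); apply: rtr_ge0; exact: MS. Qed.

Lemma tr_star x : M x -> tr (star x) = (tr x)^*%R.
Proof.
have H y : M y -> (tr y + tr (star y))^* = tr y + tr (star y).
  move=> hy; have hy' := MS hy; have hyy := MM hy' hy.
  have h1 : (tr (star y * y))^* = tr (star y * y) by rewrite geC0_conj // (tr_ge0 HT).
  have h2 : (tr (star (1 + y) * (1 + y)))^* = tr (star (1 + y) * (1 + y)).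
    by rewrite geC0_conj // (tr_ge0 HT) //; exact: MD.
  have e : tr (star (1 + y) * (1 + y)) = 1 + tr y + tr (star y) + tr (star y * y).
    rewrite starD star1 mulrDl !mulrDr !mul1r mulr1 !(trD HT) ?(tr1 HT) ?addrA //; exact: MD.
  move: h2; rewrite e !rmorphD rmorph1 /= h1 => /addIr; rewrite -!addrA => /addrI.
  by [].
move=> hx; have hx' := MS hx; have h1 := H _ hx; have := H ('i *: x) (MZ _ hx).
rewrite starZ conjCi !(trZ HT) // mulNr -mulrBr rmorphM /= conjCi mulNr -mulrN.
move=> /(mulfI (neq0Ci _)); move: h1; rewrite rmorphB rmorphD /= opprB.
set p := tr x; set q := tr (star x) => h1 h2.
apply: (@mulfI _ (2 : R[i])); first by rewrite pnatr_eq0.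
have -> : 2 * q = (p + q) - (p - q) by ring.
by rewrite -h1 -h2; ring.
Qed.

Lemma rtr_star x : M x -> rtr (star x) = rtr x.
Proof. by move=> hx; rewrite /rtr tr_star //; case: (tr x). Qed.

Lemma rtr_cauchy x y : M x -> M y ->
  rtr (x * star y) <= (rtr (x * star x) + rtr (y * star y)) / 2.
Proof.
move=> hx hy; have hx' := MS hx; have hy' := MS hy.
have h := rtr_ge0' (tracial_B hx hy).
have e : rtr (y * star x) = rtr (x * star y).
  by rewrite -rtr_star ?starM ?starK //; exact: MM.
move: h; rewrite starB mulrBl !mulrBr opprB addrA addrAC.
rewrite rtrD ?rtrB ?e; try by do ?[apply: tracial_B|apply: MD|apply: MM].
lra.
Qed.

Lemma rtr_gt0 x : M x -> x != 0 -> 0 < rtr (star x * x).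
Proof.
move=> hx x0; rewrite lt_neqAle rtr_ge0 // andbT eq_sym; apply: contra x0 => /eqP h.
apply/eqP; apply: (tr_eq0 HT) => //; have := tr_ge0 HT hx.
rewrite lecE => /andP[/eqP /= hi _]; move: h hi; rewrite /rtr.
by case: (tr _) => /= a b -> ->.
Qed.

Definition orthogonal_isometries (n : nat) (u : 'I_n -> D) : Prop :=
  [/\ forall i, M (u i), forall i j, i != j -> star (u i) * u j = 0 &
      forall i, u i * star (u i) * u i = u i].

(* A singular value decomposition; the partial isometries [u i] have pairwise
   orthogonal supports and pairwise orthogonal ranges. *)
Record svd (x : D) (n : nat) (s : 'I_n -> R) (u : 'I_n -> D) : Prop := Svd {
  svd_gt0 : forall i, 0 < s i;
  svd_tr_gt0 : forall i, 0 < rtr (star (u i) * u i);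
  svd_orth : orthogonal_isometries u;
  svd_orth' : orthogonal_isometries (fun i => star (u i));
  svd_sum : x = \sum_i rc (s i) *: u i;
  svd_pnorm : forall r : R, 1 <= r ->
    pnorm tr r%:E x = (\sum_i s i `^ r * rtr (star (u i) * u i)) `^ r^-1;
  svd_le : forall i, s i <= cnorm x;
  svd_max : x != 0 -> exists i, s i = cnorm x
}.

(** Cut [x] by the spectral projections [p t] of [star x * x] at the nonzero spectral points [t]:
    then [s = sqrt t] and [u = x p(t) / s]. Each [u] is [x] times a polynomial in [star x * x],
    hence stays in [M]. *)
Lemma svdP x : M x -> exists (n : nat) (s : 'I_n -> R) (u : 'I_n -> D), svd x s u.
Proof.
move=> hx; set a := star x * x.
have Ma : M a by apply: MM => //; exact: MS.
have sa : selfadj a by exact: selfadj_mulss.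
have [S fs] := tracial_finspec HT Ma sa; have [uS hS] := fs.
have S0 t : t \in S -> 0 <= t by move=> /hS; apply: (pos_mulss x).2.
pose p t := poly_at (lagrange S t) a.
have pM t : M (p t) by exact: tracial_poly.
have ps t : star (p t) = p t by exact: (selfadj_poly _ sa).
have pp t : t \in S -> p t * p t = p t by move=> tS; case: (proj_lagrange sa fs tS).
have pq t t' : t != t' -> p t * p t' = 0 by exact: proj_lagrange_orth.
have ap t : t \in S -> a * p t = rc t *: p t.
  move=> tS; rewrite -{1}(poly_atX a) -poly_atM -poly_atZ; apply: eq_poly_at => // k /hS kS.
  rewrite hornerM hornerX hornerZ lagrangeE //; case: eqP => [->|]//=.
  by rewrite !mulr0.
pose S' := [seq t <- S | 0 < t].
have S'S t : t \in S' -> t \in S by rewrite mem_filter => /andP[].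
have S'0 t : t \in S' -> 0 < t by rewrite mem_filter => /andP[].
pose n := size S'; pose t (i : 'I_n) := nth 0 S' i.
have tS' i : t i \in S' by exact: mem_nth.
have tS i : t i \in S by exact: S'S.
have t0 i : 0 < t i by exact: S'0.
have tinj i j : i != j -> t i != t j.
  by move=> ij; rewrite nth_uniq ?ltn_ord ?filter_uniq.
pose s i := Num.sqrt (t i).
have s0 i : 0 < s i by rewrite sqrtr_gt0.
have ss i : s i ^+ 2 = t i by rewrite sqr_sqrtr // ltW.
pose u i := rc (s i)^-1 *: (x * p (t i)).
have uM i : M (u i) by apply: MZ; exact: MM.
have uu i j : star (u i) * u j = rc ((s i)^-1 * (s j)^-1 * t j) *: (p (t i) * p (t j)).
  rewrite /u starZr starM ps -scalerAl -scalerAr scalerA.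
  have -> : p (t i) * star x * (x * p (t j)) = p (t i) * (a * p (t j)) by rewrite /a !mulrA.
  by rewrite ap // -scalerAr scalerA -!rmorphM.
have uui i : star (u i) * u i = p (t i).
  rewrite uu pp // (_ : _ * _ = 1) ?rmorph1 ?scale1r // -ss.
  by field; rewrite gt_eqF.
have up i : u i * p (t i) = u i by rewrite /u -scalerAl -mulrA pp.
(* The term at 0 vanishes in both uses: for the sum giving [x] because [x p(0) = 0], for the norm
   because [0 ^ r = 0] when [r >= 1]. *)
have sumS (V : zmodType) (F : R -> V) : (forall k, k \in S -> k = 0 -> F k = 0) ->
    \sum_(k <- S) F k = \sum_i F (t i).
  move=> F0; rewrite (bigID (fun k => 0 < k)) /= [X in _ + X]big1_seq ?addr0.
    by rewrite -big_filter (big_nth 0) big_mkord.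
  move=> k /andP[k0 kS]; apply: F0 => //; apply/eqP.
  by rewrite eq_le S0 // andbT leNgt.
have u0 i : u i != 0.
  apply/eqP => ui0; have := uui i; rewrite ui0 mulr0 => p0.
  have := spectrum_poly_at (P := lagrange S (t i)) ((hS _).2 (tS i)).
  rewrite lagrangeE // eqxx -/(p _) -p0.
  by move=> h; apply: h; exists 1; rewrite subr0 mul1r mulr1 rmorph1 scale1r.
have orth : orthogonal_isometries u.
  split=> // [i j ij|i]; first by rewrite uu pq ?scaler0 //; exact: tinj.
  by rewrite -mulrA uui.
have uup i j : i != j -> u i * star (u j) = 0.
  move=> ij; rewrite -(up i) -(up j) starM ps -mulrA (mulrA (p _)) pq ?tinj //.
  by rewrite mul0r mulr0.
have xsum : x = \sum_i rc (s i) *: u i.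
  rewrite -[LHS]mulr1 (spectral_resolution sa fs) mulr_sumr sumS.
    apply: eq_bigr => i _; rewrite /u scalerA -rmorphM divff ?gt_eqF //.
    by rewrite rmorph1 scale1r.
  move=> k kS k0; apply/eqP; rewrite -cnorm_eq0 -sqrf_eq0 -cstar_identity starM.
  have -> : star (poly_at (lagrange S k) a) * star x * (x * poly_at (lagrange S k) a)
     = p k * (a * p k) by rewrite ps /a /p !mulrA.
  by rewrite ap // k0 rmorph0 scale0r mulr0 cnorm0.
have aN : cnorm a = cnorm x ^+ 2 by exact: cstar_identity.
exists n, s, u; split=> //.
- by move=> i; apply: rtr_gt0 => //; exact: u0.
- split=> [i|i j ij|i]; first exact: MS.
    by rewrite starK uup.
  by rewrite starK -[in RHS]up starM ps uui.
- move=> r r1; rewrite /pnorm; congr (_ `^ _).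
  rewrite /cabs -/a (funcalc_comp _ _ sa fs) spectral_dec //.
  rewrite -[complex.Re _]/(rtr _) rtr_sum; last by move=> k; apply: MZ; exact: pM.
  rewrite sumS; last first.
    move=> k kS k0; rewrite k0 /= sqrtr0 powR0 ?rmorph0 ?scale0r ?rtr0 //.
    by rewrite gt_eqF // (lt_le_trans ltr01).
  by apply: eq_bigr => i _; rewrite rtrZ ?uui //; exact: pM.
- move=> i; rewrite -(ler_pXn2r (_ : 0 < 2)%N) ?nnegrE ?cnorm_ge0 ?(ltW (s0 i)) //.
  rewrite ss -aN; apply: le_trans (ler_norm _) _; apply: spectrum_le.
  exact/hS.
- move=> x0; have [k /hS kS hk] := spectral_radius sa.
  have k0 : 0 < k.
    rewrite -(ger0_norm (S0 _ kS)) hk aN exprn_gt0 // cnorm_gt0 //.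
  have kS' : k \in S' by rewrite mem_filter k0.
  have hi : (index k S' < n)%N by rewrite index_mem.
  exists (Ordinal hi); rewrite /s /t /= nth_index // -(ger0_norm (ltW k0)) hk aN.
  by rewrite sqrtr_sqr ger0_norm // cnorm_ge0.
Qed.

End TracialAlgebra.

(** * Young's inequality for kernels and tracial algebras *)

Section KernelYoung.
Variable R : realType.
Implicit Types (x y s t : R).

Lemma powR_add x s t : 0 <= s -> 0 <= t -> x `^ (s + t) = x `^ s * x `^ t.
Proof.
move=> s0 t0; have [->|x0] := eqVneq x 0; last by rewrite powRD // x0 implybT.
have [->|s1] := eqVneq s 0; first by rewrite add0r powRr0 mul1r.
by rewrite (powR0 s1) powR0 ?mul0r // paddr_eq0 // (negPf s1).
Qed.

Lemma powR_le_expR x t : 0 <= x -> 0 <= t -> x `^ t <= expR (t * (x - 1)).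
Proof.
move=> x0 t0; rewrite /powR; case: eqP => [->|/eqP xn].
  case: eqP => [->|_]; first by rewrite mul0r expR0.
  exact: expR_ge0.
rewrite ler_expR; apply: ler_wpM2l => //.
have -> : x = 1 + (x - 1) by ring.
rewrite [leRHS](_ : _ = x - 1); last by ring.
apply: le_ln1Dx; have : 0 < x by rewrite lt_neqAle eq_sym xn.
lra.
Qed.

(** After division by the weighted mean [s], the three bounds of [powR_le_expR] multiply to the
    exponential of [s / s - (a + b + c) = 0]. *)
Lemma weighted_amgm (a b c x y z : R) : 0 <= a -> 0 <= b -> 0 <= c ->
  a + b + c = 1 -> 0 <= x -> 0 <= y -> 0 <= z ->
  x `^ a * y `^ b * z `^ c <= a * x + b * y + c * z.
Proof.
move=> a0 b0 c0 abc x0 y0 z0; set s := a * x + b * y + c * z.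
have s0 : 0 <= s by rewrite !addr_ge0 // mulr_ge0.
(* If [s = 0], every variable of nonzero weight is 0, and some weight is nonzero, so the product
   vanishes. *)
have [s1|s1] := eqVneq s 0.
  have ax : a * x = 0.
    apply/eqP; rewrite eq_le mulr_ge0 // andbT -s1 /s -addrA lerDl.
    by rewrite addr_ge0 // mulr_ge0.
  have bx : b * y = 0.
    apply/eqP; rewrite eq_le mulr_ge0 // andbT -s1 /s ax add0r lerDl.
    by rewrite mulr_ge0.
  have cx : c * z = 0 by move: s1; rewrite /s ax bx !add0r.
  have H (u v : R) : u != 0 -> u * v = 0 -> v `^ u = 0.
    move=> u0 /eqP; rewrite mulf_eq0 (negPf u0) /= => /eqP ->.
    by rewrite powR0.
  have [a1|a1] := eqVneq a 0; last by rewrite (H a) // !mul0r.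
  have [b1|b1] := eqVneq b 0; last by rewrite (H b) // mulr0 mul0r.
  rewrite (H c) ?mulr0 //; move: abc; rewrite a1 b1 !add0r => ->.
  exact: oner_neq0.
have sp : 0 < s by rewrite lt_neqAle eq_sym s1.
have E u : u = s * (u / s) by rewrite mulrC divfK.
rewrite [in leLHS](E x) [in leLHS](E y) [in leLHS](E z) !(powRM _ s0) ?divr_ge0 //.
set x' := x / s; set y' := y / s; set z' := z / s.
have -> : s `^ a * x' `^ a * (s `^ b * y' `^ b) * (s `^ c * z' `^ c)
   = s `^ (a + b + c) * (x' `^ a * y' `^ b * z' `^ c).
  by rewrite !powR_add ?addr_ge0 //; ring.
rewrite abc powRr1 // -[leRHS]mulr1; apply: ler_wpM2l => //.
have x'0 : 0 <= x' by rewrite divr_ge0.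
have y'0 : 0 <= y' by rewrite divr_ge0.
have z'0 : 0 <= z' by rewrite divr_ge0.
apply: (@le_trans _ _ (expR (a * (x' - 1)) * expR (b * (y' - 1)) * expR (c * (z' - 1)))).
  by rewrite !ler_pM ?mulr_ge0 ?powR_ge0 ?powR_le_expR.
rewrite -!expRD -[leRHS]expR0 ler_expR.
have -> : a * (x' - 1) + b * (y' - 1) + c * (z' - 1) = s / s - (a + b + c).
  by rewrite /x' /y' /z' /s; field.
by rewrite divff // abc subrr.
Qed.

(* With [a = 1 / p], [b = 1 / q] and [c = 1 / r], AM-GM bounds [f ^ a g ^ b h ^ (1 - c)]
   by [(1 - b) f h + (1 - a) g h + c f g], so that each term involves one marginal of
   [K].  The bounds on [s], [t], [w] are inequalities because infinite exponents are
   covered by [f = 0], [f ^ 0 = 1]. *)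
Lemma kernel_young (I J L : finType) (K : I -> J -> L -> R)
    (m : I -> R) (n : J -> R) (o : L -> R) (C a b c : R)
    (f s : I -> R) (g t : J -> R) (h w : L -> R) :
  (forall i j k, 0 <= K i j k) ->
  (forall j k, \sum_i K i j k <= C * (n j * o k)) ->
  (forall i k, \sum_j K i j k <= C * (m i * o k)) ->
  (forall i j, \sum_k K i j k <= C * (m i * n j)) ->
  0 <= C -> 0 <= a <= 1 -> 0 <= b <= 1 -> 0 <= c -> a + b = c + 1 ->
  (forall i, [/\ 0 <= m i, 0 <= f i & 0 <= s i <= f i `^ a]) ->
  (forall j, [/\ 0 <= n j, 0 <= g j & 0 <= t j <= g j `^ b]) ->
  (forall k, [/\ 0 <= o k, 0 <= h k & 0 <= w k <= h k `^ (1 - c)]) ->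
  \sum_i f i * m i <= 1 -> \sum_j g j * n j <= 1 -> \sum_k h k * o k <= 1 ->
  \sum_i \sum_j \sum_k K i j k * (s i * t j * w k) <= C.
Proof.
have le_of_eq u v : u = v -> u <= v by move=> ->.
move=> K0 Ki Kj Kk C0 /andP[a0 a1] /andP[b0 b1] c0 abc hf hg hh f1 g1 h1.
have pw i j k : s i * t j * w k <=
    (1 - b) * (f i * h k) + (1 - a) * (g j * h k) + c * (f i * g j).
  have [m0 f0 /andP[s0 sf]] := hf i; have [n0 g0 /andP[t0 tg]] := hg j.
  have [l0 h0 /andP[w0 wh]] := hh k.
  apply: (@le_trans _ _ (f i `^ a * g j `^ b * h k `^ (1 - c))).
    by rewrite !ler_pM ?mulr_ge0.
  apply: le_trans (weighted_amgm _ _ _ _ _ _ _); rewrite ?mulr_ge0 ?subr_ge0 //; last first.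
    by rewrite addrACA; lra.
  (* These splittings regroup the product as [(f h)^(1 - b) (g h)^(1 - a) (f g)^c], whose exponents
     add up to 1. *)
  have -> : 1 - c = (1 - b) + (1 - a) by lra.
  have -> : f i `^ a = f i `^ (1 - b + c) by congr powR; lra.
  have -> : g j `^ b = g j `^ (1 - a + c) by congr powR; lra.
  rewrite 2?(powR_add _ (s := 1 - b)) 1?(powR_add _ (s := 1 - a)) ?subr_ge0 // !powRM //.
  by apply: le_of_eq; ring.
have sub (F G : I -> J -> L -> R) : (forall i j k, F i j k <= G i j k) ->
    \sum_i \sum_j \sum_k F i j k <= \sum_i \sum_j \sum_k G i j k.
  by move=> FG; apply: ler_sum => i _; apply: ler_sum => j _; apply: ler_sum => k _.
have prodle (A B : finType) (u v : A -> R) (u' v' : B -> R) :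
    (forall i, 0 <= u i) -> (forall i, 0 <= v i) ->
    (forall i, 0 <= u' i) -> (forall i, 0 <= v' i) ->
    \sum_i u i * v i <= 1 -> \sum_i u' i * v' i <= 1 ->
    \sum_i \sum_j (u i * u' j) * (C * (v i * v' j)) <= C.
  move=> u0 v0 u'0 v'0 uv uv'.
  have -> : \sum_i \sum_j (u i * u' j) * (C * (v i * v' j))
     = C * ((\sum_i u i * v i) * (\sum_j u' j * v' j)).
    rewrite mulr_suml mulr_sumr; apply: eq_bigr => i _.
    by rewrite mulrA mulr_sumr; apply: eq_bigr => j _; ring.
  rewrite -[leRHS]mulr1; apply: ler_wpM2l => //.
  rewrite -[leRHS]mulr1; apply: ler_pM => //.
    by apply: sumr_ge0 => i _; rewrite mulr_ge0.
  by apply: sumr_ge0 => i _; rewrite mulr_ge0.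
have S1 : \sum_i \sum_j \sum_k K i j k * (f i * h k) <= C.
  apply: le_trans (prodle _ _ f m h o _ _ _ _ f1 h1) => [|i|i|k|k];
    try by [case: (hf i)|case: (hh k)].
  apply: ler_sum => i _; rewrite exchange_big; apply: ler_sum => k _.
  rewrite -mulr_suml mulrC; apply: ler_wpM2l => //.
  by rewrite mulr_ge0 //; [case: (hf i)|case: (hh k)].
have S2 : \sum_i \sum_j \sum_k K i j k * (g j * h k) <= C.
  apply: le_trans (prodle _ _ g n h o _ _ _ _ g1 h1) => [|i|i|k|k];
    try by [case: (hg i)|case: (hh k)].
  rewrite exchange_big; apply: ler_sum => j _.
  rewrite exchange_big; apply: ler_sum => k _.
  rewrite -mulr_suml mulrC; apply: ler_wpM2l => //.
  by rewrite mulr_ge0 //; [case: (hg j)|case: (hh k)].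
have S3 : \sum_i \sum_j \sum_k K i j k * (f i * g j) <= C.
  apply: le_trans (prodle _ _ f m g n _ _ _ _ f1 g1) => [|i|i|k|k];
    try by [case: (hf i)|case: (hg k)].
  apply: ler_sum => i _; apply: ler_sum => j _.
  rewrite -mulr_suml mulrC; apply: ler_wpM2l => //.
  by rewrite mulr_ge0 //; [case: (hf i)|case: (hg j)].
apply: (@le_trans _ _ (\sum_i \sum_j \sum_k
   ((1 - b) * (K i j k * (f i * h k)) + (1 - a) * (K i j k * (g j * h k))
    + c * (K i j k * (f i * g j))))).
  apply: sub => i j k; apply: le_trans (ler_wpM2l (K0 i j k) (pw i j k)) _.
  by apply: le_of_eq; ring.
have e (F : I -> J -> L -> R) d : \sum_i \sum_j \sum_k d * F i j k
    = d * \sum_i \sum_j \sum_k F i j k.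
  rewrite mulr_sumr; apply: eq_bigr => i _; rewrite mulr_sumr.
  by apply: eq_bigr => j _; rewrite mulr_sumr.
have add (F G : I -> J -> L -> R) : \sum_i \sum_j \sum_k (F i j k + G i j k)
    = \sum_i \sum_j \sum_k F i j k + \sum_i \sum_j \sum_k G i j k.
  rewrite -big_split; apply: eq_bigr => i _; rewrite -big_split.
  by apply: eq_bigr => j _; rewrite -big_split.
rewrite !add !e.
have := ler_wpM2l (_ : 0 <= 1 - b) S1; have := ler_wpM2l (_ : 0 <= 1 - a) S2.
have := ler_wpM2l c0 S3; rewrite !subr_ge0 => h3 /(_ a1) h2 /(_ b1) h1'.
apply: le_trans (lerD (lerD h1' h2) h3) _; apply: le_of_eq.
have -> : (1 - b) * C + (1 - a) * C + c * C = (1 + c - (a + b) + 1) * C by ring.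
by rewrite abc (addrC 1) subrr add0r mul1r.
Qed.

End KernelYoung.

Section TracialYoung.
Variables (R : realType) (D : cstarAlgType R) (M : set D) (tr : D -> R[i]).
Hypothesis (HT : tracial_alg M tr).
Implicit Types (x y w : D).

Lemma svd_unit x n (s : 'I_n -> R) u (r : R) (i : 'I_n) :
  svd M tr x s u -> 1 <= r -> 0 < pnorm tr r%:E x /\
  \sum_i (s i / pnorm tr r%:E x) `^ r * rtr tr (star (u i) * u i) = 1.
Proof.
move=> hx r1; have r0 : r != 0 by rewrite gt_eqF // (lt_le_trans ltr01).
have s0 := svd_gt0 hx; have m0 := svd_tr_gt0 hx.
have e := svd_pnorm hx r1; set S := \sum_i _ in e; set N := pnorm tr r%:E x in e *.
have S0 : 0 < S.
  rewrite /S (bigD1 i) //= ltr_pwDl ?mulr_gt0 ?powR_gt0 // sumr_ge0 // => j _.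
  by rewrite mulr_ge0 ?powR_ge0 ?ltW.
have N0 : 0 < N by rewrite e powR_gt0.
have NS : N `^ r = S by rewrite e -powRrM mulVf ?powRr1 ?ltW.
split=> //; apply: (@mulfI _ S); first by rewrite gt_eqF.
rewrite mulr1 -{1}NS mulr_sumr; apply: eq_bigr => j _.
rewrite mulrA -powRM ?divr_ge0 ?ltW //.
by rewrite (mulrC N) divfK // gt_eqF.
Qed.

Lemma pnorm_ge0 x n (s : 'I_n -> R) u p : svd M tr x s u -> (1 <= p)%E ->
  0 <= pnorm tr p x.
Proof.
case: p => [p|_ _|//]; last exact: cnorm_ge0.
by rewrite lee_fin => hx p1; rewrite (svd_pnorm hx p1) powR_ge0.
Qed.

(** The normal form that [kernel_young] expects, with exponent [a = 1 / p]: for finite [p],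
    [f = t ^ p]; for [p = +oo], [t <= 1 = 0 ^ 0]. *)
Lemma svd_upper x n (s : 'I_n -> R) u p : svd M tr x s u -> (1 <= p)%E ->
  exists a (f t : 'I_n -> R),
  [/\ (p^-1 = a%:E)%E, 0 <= a <= 1,
      forall i, s i = pnorm tr p x * t i /\ 0 <= f i /\ 0 <= t i <= f i `^ a &
      \sum_i f i * rtr tr (star (u i) * u i) <= 1].
Proof.
move=> hx; have s0 := svd_gt0 hx; case: p => [p|_|//].
  rewrite lee_fin => p1; have p0 : 0 < p by rewrite (lt_le_trans ltr01).
  exists p^-1, (fun i => (s i / pnorm tr p%:E x) `^ p), (fun i => s i / pnorm tr p%:E x).
  split.
  - by rewrite inver gt_eqF.
  - by rewrite invr_ge0 ltW //= invf_le1.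
  - move=> i; have [N0 _] := svd_unit i hx p1.
    have t0 : 0 <= s i / pnorm tr p%:E x by rewrite divr_ge0 ?ltW.
    rewrite powR_ge0 t0 -powRrM mulfV ?gt_eqF // powRr1 // lexx.
    by rewrite mulrC divfK ?gt_eqF.
  case: n s u hx s0 => [|n] s u hx s0; first by rewrite big_ord0.
  by rewrite (svd_unit ord0 hx p1).2.
exists 0, (fun=> 0), (fun i => s i / cnorm x); split.
- by rewrite invey.
- by rewrite lexx ler01.
- move=> i; rewrite /= powRr0.
  have N0 : 0 < cnorm x by rewrite (lt_le_trans (s0 i)) // (svd_le hx).
  have t1 : s i / cnorm x <= 1 by rewrite ler_pdivrMr // mul1r (svd_le hx).
  rewrite lexx t1 divr_ge0 ?(ltW (s0 i)) ?(ltW N0) //.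
  by rewrite mulrC divfK ?gt_eqF.
by rewrite big1 ?ler01 // => i _; rewrite mul0r.
Qed.

(** [w] is the norming vector for duality: [(s / N) ^ (r - 1)] for finite [r], and for [r = +oo] a
    mass on one largest singular value, divided by its trace weight. In the latter case [x = 0] is
    separate, as it has no such value. *)
Lemma svd_lower x n (s : 'I_n -> R) u r : svd M tr x s u -> (1 <= r)%E ->
  exists c (h w : 'I_n -> R),
  [/\ (r^-1 = c%:E)%E, 0 <= c,
      forall i, 0 <= h i /\ 0 <= w i <= h i `^ (1 - c),
      \sum_i h i * rtr tr (star (u i) * u i) <= 1 &
      pnorm tr r x <= \sum_i s i * w i * rtr tr (star (u i) * u i)].
Proof.
move=> hx; have s0 := svd_gt0 hx; have m0 := svd_tr_gt0 hx; case: r => [r|_|//].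
  rewrite lee_fin => r1; have r0 : 0 < r by rewrite (lt_le_trans ltr01).
  set N := pnorm tr r%:E x.
  exists r^-1, (fun i => (s i / N) `^ r), (fun i => (s i / N) `^ (r - 1)); split.
  - by rewrite inver gt_eqF.
  - by rewrite invr_ge0 ltW.
  - move=> i; rewrite !powR_ge0 -powRrM mulrBr mulr1 mulfV ?gt_eqF // lexx //.
  - case: n s u hx s0 m0 => [|n] s u hx s0 m0; first by rewrite big_ord0.
    by rewrite (svd_unit ord0 hx r1).2.
  case: n s u hx s0 m0 => [|n] s u hx s0 m0.
    rewrite big_ord0 /N (svd_pnorm hx r1) big_ord0 powR0 // invr_eq0.
    by rewrite gt_eqF.
  have [N0 e] := svd_unit ord0 hx r1.
  rewrite -[leLHS]mulr1 -[X in _ * X <= _]e mulr_sumr; apply: ler_sum => i _.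
  have t0 : 0 < s i / N by rewrite divr_gt0.
  have -> : (s i / N) `^ r = s i / N * (s i / N) `^ (r - 1).
    by rewrite -{2}(powRr1 (ltW t0)) -powRD ?gt_eqF ?implybT // addrC subrK.
  have eN : N * (s i / N) = s i by rewrite mulrC divfK ?gt_eqF.
  by rewrite !mulrA -[N * s i / N]mulrA eN.
have [x0|/(svd_max hx) [k hk]] := eqVneq x 0.
  exists 0, (fun=> 0), (fun=> 0); split=> //.
  - by move=> i; rewrite subr0 powRr1 ?lexx.
  - by rewrite big1 ?ler01 // => i _; rewrite mul0r.
  by rewrite /= x0 cnorm0 sumr_ge0 // => i _; rewrite mulr0 mul0r.
pose h i := (i == k)%:R / rtr tr (star (u i) * u i).
have h0 i : 0 <= h i by rewrite divr_ge0 ?ler0n ?ltW.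
exists 0, h, h; split=> //.
- by move=> i; rewrite subr0 powRr1 // lexx h0.
- rewrite (bigD1 k) //= big1 ?addr0 /h ?eqxx ?mul1r ?mulVf ?gt_eqF // => i /negPf ->.
  by rewrite !mul0r.
rewrite (bigD1 k) //= big1 ?addr0 => [|i /negPf ik]; last by rewrite /h ik mul0r mulr0 mul0r.
by rewrite /h eqxx mul1r -mulrA mulVf ?gt_eqF // mulr1 hk.
Qed.

Lemma orthogonal_isometries_co n (u : 'I_n -> D) : orthogonal_isometries M u ->
  let e := 1 - \sum_i u i * star (u i) in M e /\ e = e * star e.
Proof.
move=> [hu ho h1] e.
have Mv i : M (u i * star (u i)) by apply: (tracial_M HT) => //; exact: (tracial_S HT).
split; first by apply: (tracial_B HT); [exact: (tracial_1 HT)|exact: (tracial_sum HT)].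
set v := \sum_i _ in e *.
have sv : star v = v by rewrite star_sum; apply: eq_bigr => i _; rewrite starM starK.
have vv : v * v = v.
  rewrite mulr_suml; apply: eq_bigr => i _.
  rewrite mulr_sumr (bigD1 i) //= big1 ?addr0 => [|j ji]; first by rewrite !mulrA h1.
  by rewrite -mulrA (mulrA (star _)) ho 1?eq_sym // mul0r mulr0.
by rewrite /e starB star1 sv mulrBl mul1r mulrBr mulr1 vv subrr subr0.
Qed.

Variables (conv : D -> D -> D) (C : R).
Hypothesis convM : forall x y, M x -> M y -> M (conv x y).
Hypothesis convDl : forall x x' y, conv (x + x') y = conv x y + conv x' y.
Hypothesis convDr : forall x y y', conv x (y + y') = conv x y + conv x y'.
Hypothesis convZl : forall (z : R[i]) x y, conv (z *: x) y = z *: conv x y.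
Hypothesis convZr : forall (z : R[i]) x y, conv x (z *: y) = z *: conv x y.

(** The third pair is reversed in [T_cauchy] because in [conv_trace] it is [star w] that multiplies
    from the left, whereas [x] itself multiplies from the right. *)
Let T x y w : R := rtr tr (conv x y * w).

Hypothesis T_cauchy : forall x x' y y' w w', M x -> M x' -> M y -> M y' ->
  M w -> M w' ->
  T (x * star x') (y * star y') (w' * star w) <=
  (T (x * star x) (y * star y) (w * star w) +
   T (x' * star x') (y' * star y') (w' * star w')) / 2.
Hypothesis T_ge0 : forall x y w, M x -> M y -> M w ->
  0 <= T (x * star x) (y * star y) (w * star w).
Hypothesis C_ge0 : 0 <= C.
Hypothesis T_1 : forall x y, M x -> M y ->
  T (x * star x) (y * star y) 1 <= C * (rtr tr (x * star x) * rtr tr (y * star y)).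
Hypothesis T_2 : forall x y, M x -> M y ->
  T (x * star x) 1 (y * star y) <= C * (rtr tr (x * star x) * rtr tr (y * star y)).
Hypothesis T_3 : forall x y, M x -> M y ->
  T 1 (x * star x) (y * star y) <= C * (rtr tr (x * star x) * rtr tr (y * star y)).

Let MS x : M x -> M (star x) := tracial_S HT (x := x).
Let MM x y : M x -> M y -> M (x * y) := tracial_M HT (x := x) (y := y).

Lemma T_sum1 (I : finType) (s : I -> R) (u : I -> D) y w :
  (forall i, M (u i)) -> M y -> M w ->
  T (\sum_i rc (s i) *: u i) y w = \sum_i s i * T (u i) y w.
Proof.
move=> hu hy hw; have c0 : conv 0 y = 0 by rewrite -(scale0r (0 : D)) convZl !scale0r.
rewrite /T (big_morph (conv^~ y) (fun x x' => convDl x x' y) c0) mulr_suml.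
rewrite (rtr_sum HT) => [|i]; last by apply: MM => //; apply: convM => //; exact: (tracial_Z HT).
apply: eq_bigr => i _; rewrite convZl -scalerAl (rtrZ HT) //.
by apply: MM => //; exact: convM.
Qed.

Lemma T_sum2 (I : finType) (s : I -> R) (u : I -> D) x w :
  (forall i, M (u i)) -> M x -> M w ->
  T x (\sum_i rc (s i) *: u i) w = \sum_i s i * T x (u i) w.
Proof.
move=> hu hx hw; have c0 : conv x 0 = 0 by rewrite -(scale0r (0 : D)) convZr !scale0r.
rewrite /T (big_morph _ (convDr x) c0) mulr_suml.
rewrite (rtr_sum HT) => [|i]; last by apply: MM => //; apply: convM => //; exact: (tracial_Z HT).
apply: eq_bigr => i _; rewrite convZr -scalerAl (rtrZ HT) //.
by apply: MM => //; exact: convM.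
Qed.

Lemma T_sum3 (I : finType) (s : I -> R) (u : I -> D) x y :
  (forall i, M (u i)) -> M x -> M y ->
  T x y (\sum_i rc (s i) *: u i) = \sum_i s i * T x y (u i).
Proof.
move=> hu hx hy; have hc := convM hx hy.
rewrite /T mulr_sumr (rtr_sum HT) => [|i]; last by apply: MM => //; exact: (tracial_Z HT).
by apply: eq_bigr => i _; rewrite -scalerAr (rtrZ HT) //; exact: MM.
Qed.

(** The complement of the ranges is a projection, on which [K] is nonnegative. This replaces a whole
    family by the argument 1, where [T_1], [T_2] and [T_3] apply. *)
Lemma sum_gram_le n (u : 'I_n -> D) (K : D -> R) : orthogonal_isometries M u ->
  (forall x, M x -> 0 <= K (x * star x)) ->
  (forall x y, M x -> M y -> K (x - y) = K x - K y) ->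
  (forall v : 'I_n -> D, (forall i, M (v i)) -> K (\sum_i v i) = \sum_i K (v i)) ->
  \sum_i K (u i * star (u i)) <= K 1.
Proof.
move=> ho K0 KB Ks; have [hu _ _] := ho; have [Me e] := orthogonal_isometries_co ho.
have Mv i : M (u i * star (u i)) by apply: MM => //; exact: MS.
rewrite -Ks // -subr_ge0 -KB; [by rewrite e; exact: K0|exact: (tracial_1 HT)|].
exact: (tracial_sum HT).
Qed.

Let sum_rc1 n (u : 'I_n -> D) : \sum_i u i = \sum_i rc 1 *: u i.
Proof. by apply: eq_bigr => i _; rewrite rmorph1 scale1r. Qed.

Lemma kernel_marginal1 n (u : 'I_n -> D) y w : orthogonal_isometries M u -> M y -> M w ->
  \sum_i T (u i * star (u i)) (y * star y) (w * star w)
    <= C * (rtr tr (y * star y) * rtr tr (w * star w)).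
Proof.
move=> ho hy hw; have [hu _ _] := ho; apply: le_trans (T_3 hy hw).
have hyy := MM hy (MS hy); have hww := MM hw (MS hw).
apply: (sum_gram_le (K := fun x => T x (y * star y) (w * star w))) => //.
- by move=> x hx; exact: T_ge0.
- move=> x x' hx hx'; rewrite /T convDl -scaleN1r convZl scaleN1r mulrBl (rtrB HT) //;
  by apply: MM => //; exact: convM.
move=> v hv; rewrite sum_rc1 T_sum1 //.
by apply: eq_bigr => i _; rewrite mul1r.
Qed.

Lemma kernel_marginal2 n (u : 'I_n -> D) x w : orthogonal_isometries M u -> M x -> M w ->
  \sum_i T (x * star x) (u i * star (u i)) (w * star w)
    <= C * (rtr tr (x * star x) * rtr tr (w * star w)).
Proof.
move=> ho hx hw; have [hu _ _] := ho; apply: le_trans (T_2 hx hw).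
have hxx := MM hx (MS hx); have hww := MM hw (MS hw).
apply: (sum_gram_le (K := fun y => T (x * star x) y (w * star w))) => //.
- by move=> y hy; exact: T_ge0.
- move=> y y' hy hy'; rewrite /T convDr -scaleN1r convZr scaleN1r mulrBl (rtrB HT) //;
  by apply: MM => //; exact: convM.
move=> v hv; rewrite sum_rc1 T_sum2 //.
by apply: eq_bigr => i _; rewrite mul1r.
Qed.

Lemma kernel_marginal3 n (u : 'I_n -> D) x y : orthogonal_isometries M u -> M x -> M y ->
  \sum_i T (x * star x) (y * star y) (u i * star (u i))
    <= C * (rtr tr (x * star x) * rtr tr (y * star y)).
Proof.
move=> ho hx hy; have [hu _ _] := ho; apply: le_trans (T_1 hx hy).
have hxx := MM hx (MS hx); have hyy := MM hy (MS hy).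
apply: (sum_gram_le (K := fun w => T (x * star x) (y * star y) w)) => //.
- by move=> w hw; exact: T_ge0.
- by move=> w w' hw hw'; rewrite /T mulrBr (rtrB HT) //; apply: MM => //; exact: convM.
move=> v hv; rewrite sum_rc1 T_sum3 //.
by apply: eq_bigr => i _; rewrite mul1r.
Qed.

Lemma young x y p q r : M x -> M y -> (1 <= p)%E -> (1 <= q)%E -> (1 <= r)%E ->
  (p^-1 + q^-1 = r^-1 + 1)%E ->
  pnorm tr r (conv x y) <= C * pnorm tr p x * pnorm tr q y.
Proof.
move=> hx hy p1 q1 r1 hpqr.
have [nx [s [u X]]] := svdP HT hx; have [ny [t [v Y]]] := svdP HT hy.
have [nz [s' [g Z]]] := svdP HT (convM hx hy).
have [a [f [s1 [ea ha hf f1]]]] := svd_upper X p1.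
have [b [f' [t1 [eb hb hf' f'1]]]] := svd_upper Y q1.
have [c [h [w [ec c0 hh h1 hw]]]] := svd_lower Z r1.
have abc : a + b = c + 1.
  by move: hpqr; rewrite ea eb ec -!EFinD => -[].
have [Mu _ iu] := svd_orth X; have [Mv _ iv] := svd_orth Y; have [Mg _ ig] := svd_orth Z.
have Nx := pnorm_ge0 X p1; have Ny := pnorm_ge0 Y q1.
set N1 := pnorm tr p x in Nx hf *; set N2 := pnorm tr q y in Ny hf' *.
have su i := MS (Mu i); have sv i := MS (Mv i); have sg i := MS (Mg i).
pose m n (u : 'I_n -> D) i := rtr tr (star (u i) * u i).
have me n (e : 'I_n -> D) (i : 'I_n) : (forall i, M (e i)) ->
    rtr tr (e i * star (e i)) = m n e i.
  by move=> he; rewrite /m (rtrC HT) //; exact: MS.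
have ms n (e : 'I_n -> D) i : m n e i = rtr tr (star (e i) * star (star (e i))).
  by rewrite starK.
(* [T_cauchy] for [u = u (u^* u)^*], [v = v (v^* v)^*] and [g^* = (g^* g) g^*]. *)
pose K i j k := (T (u i * star (u i)) (v j * star (v j)) (g k * star (g k)) +
  T (star (u i) * star (star (u i))) (star (v j) * star (star (v j)))
    (star (g k) * star (star (g k)))) / 2.
have half (P Q S : R) : P <= S -> Q <= S -> (P + Q) / 2 <= S by lra.
(* The adjoints form orthogonal families as well, with the same trace weights, so both halves of [K]
   obey the same marginal bounds. *)
have le1 : \sum_i \sum_j \sum_k K i j k * (s1 i * t1 j * w k) <= C.
  apply: (kernel_young (m := m _ u) (n := m _ v) (o := m _ g) (a := a) (b := b) (c := c)
     (f := f) (g := f') (h := h)) => //.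
  - by move=> i j k; rewrite divr_ge0 ?addr_ge0 ?T_ge0.
  - move=> j k; rewrite -mulr_suml big_split /=; apply: half.
      by rewrite -!me //; apply: kernel_marginal1 => //; case: X.
    by rewrite !ms; apply: (kernel_marginal1 (u := fun l => star (u l))) => //; case: X.
  - move=> i k; rewrite -mulr_suml big_split /=; apply: half.
      by rewrite -!me //; apply: kernel_marginal2 => //; case: Y.
    by rewrite !ms; apply: (kernel_marginal2 (u := fun l => star (v l))) => //; case: Y.
  - move=> i j; rewrite -mulr_suml big_split /=; apply: half.
      by rewrite -!me //; apply: kernel_marginal3 => //; case: Z.
    by rewrite !ms; apply: (kernel_marginal3 (u := fun l => star (g l))) => //; case: Z.
  - by move=> i; case: (hf i) => _ [? ?]; split=> //; exact: rtr_ge0 HT _ (Mu i).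
  - by move=> i; case: (hf' i) => _ [? ?]; split=> //; exact: rtr_ge0 HT _ (Mv i).
  - by move=> i; case: (hh i) => ? ?; split=> //; exact: rtr_ge0 HT _ (Mg i).
have isom (e : D) : e * star e * e = e -> star (star e * e) = star e * e /\
    star e * e * (star e * e) = star e * e.
  by move=> he; rewrite starM starK; split=> //; rewrite -mulrA (mulrA e) he.
have TK i j k : T (u i) (v j) (star (g k)) <= K i j k.
  have [u1 u2] := isom _ (iu i); have [v1 v2] := isom _ (iv j); have [g1 g2] := isom _ (ig k).
  have := T_cauchy (Mu i) (MM (su i) (Mu i)) (Mv j) (MM (sv j) (Mv j))
    (Mg k) (MM (sg k) (Mg k)).
  rewrite u1 v1 g1 u2 v2 g2 !mulrA iu iv.
  have -> : star (g k) * g k * star (g k) = star (g k).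
    by rewrite -[in RHS](ig k) !starM starK mulrA.
  by rewrite /K !starK.
(* The test element dual to [conv x y]: pairing it with the singular value decomposition of the
   convolution gives the lower bound of [svd_lower]. *)
pose W := \sum_k rc (w k) *: star (g k).
have MW : M W by apply: (tracial_sum HT) => k; exact: (tracial_Z HT).
have e1 : T x y W = \sum_k s' k * w k * m _ g k.
  rewrite /T (svd_sum Z) /W mulr_suml (rtr_sum HT); last first.
    move=> k; apply: MM => //; exact: (tracial_Z HT).
  apply: eq_bigr => k _; rewrite mulr_sumr (bigD1 k) //= big1 ?addr0.
    rewrite -scalerAl -scalerAr !(rtrZ HT) ?me ?mulrA //;
      do ?[apply: (tracial_Z HT)|apply: MM] => //.
  move=> l lk; have [_ ho _] := svd_orth' Z.
  have := ho k l; rewrite starK eq_sym => /(_ lk) h0.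
  by rewrite -scalerAl -scalerAr h0 !scaler0.
have e2 : T x y W = \sum_i \sum_j \sum_k T (u i) (v j) (star (g k)) * (s i * t j * w k).
  rewrite {1}(svd_sum X) T_sum1 //; apply: eq_bigr => i _.
  rewrite (svd_sum Y) T_sum2 // mulr_sumr; apply: eq_bigr => j _.
  rewrite T_sum3 // mulr_sumr mulr_sumr; apply: eq_bigr => k _.
  by ring.
apply: le_trans hw _; rewrite -[X in X <= _]/(\sum_k s' k * w k * m _ g k) -e1 e2.
apply: (@le_trans _ _ (\sum_i \sum_j \sum_k N1 * N2 * (K i j k * (s1 i * t1 j * w k)))).
  apply: ler_sum => i _; apply: ler_sum => j _; apply: ler_sum => k _.
  have [-> [_ /andP[a1 _]]] := hf i; have [-> [_ /andP[b1 _]]] := hf' j.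
  have [_ /andP[w0 _]] := hh k.
  have -> : N1 * s1 i * (N2 * t1 j) * w k = N1 * N2 * (s1 i * t1 j * w k) by ring.
  rewrite mulrCA; apply: ler_wpM2l; first exact: mulr_ge0.
  by apply: ler_wpM2r => //; rewrite !mulr_ge0.
under eq_bigr do under eq_bigr do rewrite -mulr_sumr.
under eq_bigr do rewrite -mulr_sumr.
rewrite -mulr_sumr (_ : C * N1 * N2 = N1 * N2 * C); last by ring.
by apply: ler_wpM2l le1; exact: mulr_ge0.
Qed.

End TracialYoung.

(** * Bounds on the convolution with the unit *)

Section Domination.
Variables (R : realType) (D : cstarAlgType R) (M : set D) (tr : D -> R[i]).
Hypothesis (HT : tracial_alg M tr).

(** On a nonzero spectral projection [p], [k f(p) <= tr p f(p) <= tr p f(1)], the last step because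
    [1 - p] is a projection; then sum with the nonnegative eigenvalues as weights. This is the
    origin of [1 / kappa]. *)
Lemma domination (k : R) (a : D) (f : D -> R) : M a -> pos a ->
  (forall p, M p -> p != 0 -> projection p -> k <= rtr tr p) ->
  (forall x y, M x -> M y -> f (x + y) = f x + f y) ->
  (forall (c : R) x, M x -> f (rc c *: x) = c * f x) ->
  (forall p, M p -> projection p -> 0 <= f p) ->
  k * f a <= rtr tr a * f 1.
Proof.
move=> Ma [sa pa] hk fD fZ f0; have [S fs] := tracial_finspec HT Ma sa.
pose p t := poly_at (lagrange S t) a.
have Mp t : M (p t) by exact: (tracial_poly HT).
have MZ t : M (rc t *: p t) by exact: (tracial_Z HT).
have Ms (s : seq R) : M (\sum_(t <- s) rc t *: p t) by exact: (tracial_sum HT).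
have f00 : f 0 = 0 by have := fD _ _ (tracial_0 HT) (tracial_0 HT); rewrite addr0; lra.
have fa (s : seq R) : f (\sum_(t <- s) rc t *: p t) = \sum_(t <- s) t * f (p t).
  by elim: s => [|t s IH]; rewrite ?big_nil ?big_cons // fD // IH fZ.
rewrite {1}(selfadj_spectral sa fs) {2}(selfadj_spectral sa fs) fa (rtr_sum HT) //
  mulr_sumr mulr_suml.
rewrite big_seq [leRHS]big_seq; apply: ler_sum => t tS.
have hp := proj_lagrange sa fs tS.
have t0 : 0 <= t by apply: pa; case: fs => _ ->.
rewrite -/(p t) (rtrZ HT _ (Mp t)) mulrCA -mulrA; apply: ler_wpM2l => //.
have fp := f0 _ (Mp t) hp.
have [p0|p0] := eqVneq (p t) 0; first by rewrite p0 f00 (rtr0 HT) mulr0 mul0r.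
apply: le_trans (ler_wpM2r fp (hk _ (Mp t) p0 hp)) _; apply: ler_wpM2l.
  by have := rtr_ge0 HT (Mp t); case: hp => pp ->; rewrite pp.
have h : f 1 = f (p t) + f (1 - p t).
  by rewrite -fD ?subrKC //; apply: (tracial_B HT) => //; exact: (tracial_1 HT).
rewrite h lerDl; apply: f0; first by apply: (tracial_B HT) => //; exact: (tracial_1 HT).
case: hp => pp ps; split; last by rewrite starB star1 ps.
by rewrite mulrBl mul1r mulrBr mulr1 pp subrr subr0.
Qed.

End Domination.

Section DominationMul.
Variables (R : realType) (D : cstarAlgType R) (M : set D) (tr : D -> R[i]).
Hypothesis (HT : tracial_alg M tr).

Lemma rtr_proj_ge0 p x : M p -> M x -> projection p ->
  0 <= rtr tr (p * (x * star x)).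
Proof.
move=> hp hx [pp ps]; have hx' := tracial_S HT hx; have hpx := tracial_M HT hp hx.
have := rtr_ge0 HT hpx; rewrite starM ps -mulrA (mulrA p) pp (rtrC HT) //.
by rewrite mulrA.
Qed.

(** The bound [k] concerns the projections of the subalgebra [N] that contains [a], while [b] ranges
    over [M]; [trace_prod_le] takes [A' \cap A_1] inside [B' \cap A_1]. *)
Lemma domination_mul (N : set D) (k : R) (a b : D) : tracial_alg N tr ->
  (forall x, N x -> M x) -> N a -> pos a -> M b ->
  (forall p, N p -> p != 0 -> projection p -> k <= rtr tr p) ->
  (forall p, N p -> projection p -> 0 <= rtr tr (p * b)) ->
  k * rtr tr (a * b) <= rtr tr a * rtr tr b.
Proof.
move=> HN NM Na pa Mb hk hb; rewrite -{2}(mul1r b).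
apply: (domination HN (f := fun x => rtr tr (x * b))) => //.
- by move=> x y hx hy; rewrite mulrDl (rtrD HT) //; apply: (tracial_M HT) => //; exact: NM.
- by move=> z x hx; rewrite -scalerAl (rtrZ HT) //; apply: (tracial_M HT) => //; exact: NM.
Qed.

End DominationMul.

(** * Relative commutants in the tower and their minimal traces *)

Section Vertices.
Variables (R : realType) (B A A1 A2 : cstarAlgType R).
Variables (i0 : {lrmorphism B -> A}) (E0 : {linear A -> B}).
Variables (I : finType) (l : I -> A) (c : R).
Variables (i1 : {lrmorphism A -> A1}) (e1 : A1) (E1 : {linear A1 -> A}).
Variables (i2 : {lrmorphism A1 -> A2}) (e2 : A2) (E2 : {linear A2 -> A1}).
Let d : R[i] := rc (Num.sqrt c).
Let m k := d *: (i1 (l k) * e1).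
Hypotheses (ZB : scalar_center B) (ZA : scalar_center A).
Hypothesis (J1 : jones i0 E0 l c i1 e1 E1).
Hypothesis (J2 : jones i1 E1 m c i2 e2 E2).
Let f : A2 := i2 e1.
Let M0 : set A := relcomm i0.
Let M1 : set A1 := relcomm (i1 \o i0).
Let N1 : set A1 := relcomm i1.
Let L : set A2 := relcomm (i2 \o i1 \o i0).
Let N2 : set A2 := relcomm (i2 \o i1).
Let t0 := trace_of E0.
Let t1 := trace_of (E0 \o E1).
Let t2 := trace_of (E0 \o E1 \o E2).
Local Notation F := (fourier0 l i1 e1 i2 e2 d).
Local Notation G := (inv_fourier0 e1 i2 e2 E2 d).
Local Notation P := (comm_exp l i1 i2 d).

Let hi0 : star_embedding i0. Proof. by case: (jones_base J1). Qed.
Let hi1 : star_embedding i1. Proof. exact: jones_star J1. Qed.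
Let hi2 : star_embedding i2. Proof. exact: jones_star J2. Qed.
Let cE0 : cond_exp i0 E0. Proof. by case: (jones_base J1). Qed.
Let cE1 : cond_exp i1 E1. Proof. exact: jones_exp J1. Qed.
Let cE2 : cond_exp i2 E2. Proof. exact: jones_exp J2. Qed.
Let c0 : 0 < c. Proof. exact: jones_c_gt0 J1. Qed.
Let s0 : 0 < Num.sqrt c. Proof. by rewrite sqrtr_gt0. Qed.
Let d0 : d != 0. Proof. by rewrite fmorph_eq0 gt_eqF. Qed.
Let ds : (d^* = d)%R. Proof. exact: conj_rc. Qed.
Let rc_c : rc c = d ^+ 2 :> R[i].
Proof. by rewrite /d -rmorphXn /= sqr_sqrtr // ltW. Qed.

Let mi10 := min_index_comp (jones_base J1) (jones_base J2).

Lemma tracial0 : tracial_alg M0 t0.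
Proof. exact: mi_tracial (jones_base J1) ZB. Qed.

Lemma tracial1 : tracial_alg M1 t1.
Proof. exact: mi_tracial mi10 ZB. Qed.

Lemma tracial2 : tracial_alg L t2.
Proof. exact: mi_tracial (min_index_comp mi10 (dual_min_index J2 ZA)) ZB. Qed.

Lemma tracial_sub (A' D : cstarAlgType R) (i : {lrmorphism A' -> D}) (M : set D) tr :
  star_embedding i -> tracial_alg M tr -> (forall x, relcomm i x -> M x) ->
  tracial_alg (relcomm i) tr.
Proof.
move=> hi [k1 k2 k3 k4 k5 k6 k7 k8 k9 k10 k11 k12] sub.
split; rewrite /= //; try by [move=> x hx; auto|move=> x y hx hy; auto|move=> z x hx; auto].
- exact: relcomm1.
- exact: relcommD.
- by move=> z x; exact: relcommZ.
- exact: relcommM.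
- by move=> x; exact: relcommS.
Qed.

Lemma M1_N1 x : N1 x -> M1 x.
Proof. by move=> hx b; exact: hx (i0 b). Qed.

Lemma M1_i1 x : M0 x -> M1 (i1 x).
Proof. by move=> hx b /=; rewrite -!rmorphM hx. Qed.

Lemma tracialN1 : tracial_alg N1 t1.
Proof. exact: tracial_sub hi1 tracial1 M1_N1. Qed.

Lemma tracialN2 : tracial_alg N2 t2.
Proof. by apply: tracial_sub (star_embedding_comp hi1 hi2) tracial2 _ => x; exact: L_of_N2. Qed.

Lemma rtr1E x : rtr t1 x = rtr t0 (E1 x).
Proof. by []. Qed.

Lemma rtr2E x : rtr t2 x = rtr t1 (E2 x).
Proof. by []. Qed.

Lemma M0_E1 x : M1 x -> M0 (E1 x).
Proof. by move=> hx b; rewrite -(expMr cE1) -(expMl cE1) [x * _]hx. Qed.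

Lemma N1_E2 x : N2 x -> N1 (E2 x).
Proof. by move=> hx b; rewrite -(expMr cE2) -(expMl cE2) [x * _]hx. Qed.

Definition min_trace0 (k : R) := forall p, M0 p -> p != 0 -> projection p -> k <= rtr t0 p.
Definition min_trace1 (k : R) := forall p, N1 p -> p != 0 -> projection p -> k <= rtr t1 p.

Lemma trace_pushdown p : N1 p -> rtr t1 p = rtr t0 (pushdown c e1 E1 p).
Proof.
move=> hp; rewrite -{1}(rmul_pushdown J1 hp) rtr1E (exp_rmul J1);
  last exact: pushdown_relcomm J1 _ hp.
by rewrite /rtr /t0 /trace_of (expE cE0).
Qed.

(** [pushdown] carries nonzero projections to nonzero projections of equal trace; [min_trace_10]
    goes back by [rmul_proj]. *)
Lemma min_trace_01 k : min_trace0 k -> min_trace1 k.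
Proof.
move=> hk p hp p0 pp; rewrite trace_pushdown //; apply: hk.
- exact: pushdown_relcomm J1 _ hp.
- apply: contra p0 => /eqP h; rewrite -(rmul_pushdown J1 hp) h /rmul_proj big1 //.
  by move=> k' _; rewrite mulr0 rmorph0 !mul0r.
- exact: pushdown_projection J1 _ hp pp.
Qed.

Lemma min_trace_10 k : min_trace1 k -> min_trace0 k.
Proof.
move=> hk p hp p0 pp.
have <- : rtr t1 (rmul_proj l i1 e1 p) = rtr t0 p.
  by rewrite rtr1E (exp_rmul J1) // /rtr /t0 /trace_of (expE cE0).
apply: hk; last exact: rmul_projection J1 _ hp pp.
  exact: rmul_relcomm J1 _ hp.
apply: contra p0 => /eqP h; apply/eqP/(jones_inj J1).
by rewrite -(rmul_e J1) // h mul0r.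
Qed.

Lemma fourier0D x y : F (x + y) = F x + F y.
Proof.
rewrite /fourier0 -scalerDr; congr (_ *: _); rewrite -big_split; apply: eq_bigr => k _.
by rewrite rmorphD mulrDr !mulrDl.
Qed.

Lemma inv_fourier0D x y : G (x + y) = G x + G y.
Proof. by rewrite /inv_fourier0 !mulrDl linearD scalerDr. Qed.

Lemma inv_fourier0Z (z : R[i]) x : G (z *: x) = z *: G x.
Proof. by rewrite /inv_fourier0 -!scalerAl linearZ /= !scalerA mulrC. Qed.

(** The case [x = 1] of [conv_mulstar]: by [conv0E], convolution with 1 is up to [delta] an average
    over the quasi-basis, which keeps the trace by [mi_trace]. *)
Lemma fourier0_isometry y1 y2 : M1 y1 -> M1 y2 ->
  rtr t2 (F y1 * star (F y2)) = rtr t1 (y1 * star y2).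
Proof.
move=> h1 h2; have M11 : M1 1 by exact: relcomm1.
have := conv_mulstar d0 ds rc_c J1 J2 M11 h1 h2; rewrite (conv0E d0 rc_c J1 J2) //.
move=> /(scalerI d0); rewrite rmorph1 mulr1 rtr2E => <-.
have -> : \sum_k i1 (l k) * (y1 * star y2) * i1 (E1 (e1 * i1 (star (l k)) * 1))
   = rc c^-1 *: \sum_k i1 (l k) * (y1 * star y2) * i1 (star (l k)).
  rewrite scaler_sumr; apply: eq_bigr => k _.
  by rewrite mulr1 (expMr cE1) (jones_exp_e J1) mulr_algl linearZ /= -scalerAr.
have h2' : M1 (star y2) by exact: (relcommS (star_embedding_comp hi0 hi1) h2).
have hy : M1 (y1 * star y2) by exact: relcommM.
rewrite rtr1E linearZ linear_sum /=.
under eq_bigr do rewrite (expM cE1).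
rewrite (mi_trace (jones_base J1)); last exact: M0_E1.
rewrite scalerA mulrC (jones_c_unit J1) scale1r.
by rewrite /rtr /t0 /trace_of (expE cE0).
Qed.

Let LS x : L x -> L (star x).
Proof. exact: (relcommS (star_embedding_comp (star_embedding_comp hi0 hi1) hi2)). Qed.

Let M1S x : M1 x -> M1 (star x).
Proof. exact: (relcommS (star_embedding_comp hi0 hi1)). Qed.

Let N2S x : N2 x -> N2 (star x).
Proof. exact: (relcommS (star_embedding_comp hi1 hi2)). Qed.

Let L_i2 x : M1 x -> L (i2 x). Proof. exact: L_of_M1. Qed.
Let L_N2 x : N2 x -> L x. Proof. exact: L_of_N2. Qed.
Let LM x y : L x -> L y -> L (x * y). Proof. exact: relcommM. Qed.
Let hF x : M1 x -> N2 (F x). Proof. exact: N2_F d0 J1 J2 x. Qed.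
Let hG x : N2 x -> M1 (G x). Proof. exact: M1_G J1 J2 x. Qed.

(** * Young's inequality on the two relative commutants *)

Section Bounds.
Variable (k : R).
Hypotheses (k0 : 0 < k) (hk0 : min_trace0 k) (hk1 : min_trace1 k).

(** [E2] takes [n * star n] into [A' \cap A_1], whose projections have trace at least [k], so
    domination applies inside [B' \cap A_1]. *)
Lemma trace_prod_le n m' : N2 n -> M1 m' ->
  k * rtr t2 (n * star n * i2 (m' * star m')) <= rtr t2 (n * star n) * rtr t1 (m' * star m').
Proof.
move=> hn hm; rewrite !rtr2E (expMr cE2).
apply: (domination_mul tracial1 tracialN1 M1_N1) => //.
- by apply/N1_E2/relcommM => //; exact: N2S.
- by have := exp_pos cE2 (star n); rewrite starK.
- by apply: relcommM => //; exact: M1S.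
by move=> p hp pp; apply: (rtr_proj_ge0 tracial1) => //; exact: M1_N1.
Qed.

(** Cyclicity collects the unprimed halves in one factor and the primed ones in the other. The
    result is an inner product, whence both positivity and Cauchy-Schwarz for the trilinear form. *)
Lemma conv_trace x x' y y' w w' : M1 x -> M1 x' -> M1 y -> M1 y' -> M1 w -> M1 w' ->
  rtr t1 (G (F (y * star y') * F (x * star x')) * (w' * star w))
  = Num.sqrt c * rtr t2 ((star (i2 w) * F y * i2 x) * star (star (i2 w') * F y' * i2 x')).
Proof.
move=> hx hx' hy hy' hw hw'; have hs := M1S hx'.
have hxx : M1 (x * star x') by exact: relcommM.
rewrite (conv_mulstar d0 ds rc_c J1 J2) // -scalerAl -(expMr cE2) (rtrZ tracial1); last first.
  apply: M1_E2 J2 _ _; have := hF hy; have := hF hy' => h1 h2.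
  apply: LM; last by apply/L_i2/relcommM => //; exact: M1S.
  by apply: LM; [apply: LM; [exact: L_N2|exact: L_i2]|apply/LS/L_N2].
rewrite -rtr2E; congr (_ * _).
transitivity (rtr t2 ((F y * i2 x * star (star (i2 w') * F y' * i2 x')) * star (i2 w))).
  by congr rtr; rewrite !starM starK -!(embed_star hi2) !rmorphM !mulrA.
rewrite (rtrC tracial2) ?mulrA //; last exact/LS/L_i2.
apply: LM; first by apply: LM; [apply/L_N2/hF|exact: L_i2].
by apply/LS/LM; [apply: LM; [exact/LS/L_i2|exact/L_N2/hF]|exact: L_i2].
Qed.

Lemma young_lower x y p q r : M1 x -> M1 y -> (1 <= p)%E -> (1 <= q)%E -> (1 <= r)%E ->
  (p^-1 + q^-1 = r^-1 + 1)%E ->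
  pnorm t1 r (G (F y * F x)) <= Num.sqrt c / k * pnorm t1 p x * pnorm t1 q y.
Proof.
have hP x' y' w' : M1 x' -> M1 y' -> M1 w' -> L (star (i2 w') * F y' * i2 x').
  move=> h1 h2 h3; apply: LM; last exact: L_i2.
  by apply: LM; [exact/LS/L_i2|exact/L_N2/hF].
have C0 : 0 <= Num.sqrt c / k by rewrite divr_ge0 // ltW.
have bound (u v : R) : k * u <= v -> Num.sqrt c * u <= Num.sqrt c / k * v.
  move=> h; rewrite -mulrA; apply: (ler_wpM2l (ltW s0)).
  by rewrite mulrC ler_pdivlMr // mulrC.
apply: (young tracial1 (conv := fun x y => G (F y * F x))) => //.
- by move=> x' y' h1 h2; apply/hG/relcommM; exact: hF.
- by move=> x1 x2 y'; rewrite fourier0D mulrDr inv_fourier0D.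
- by move=> x' y1 y2; rewrite fourier0D mulrDl inv_fourier0D.
- by move=> z x' y'; rewrite fourier0Z -scalerAr inv_fourier0Z.
- by move=> z x' y'; rewrite fourier0Z -scalerAl inv_fourier0Z.
- move=> x1 x2 y1 y2 w1 w2 *; rewrite !conv_trace // -mulrDr -[leRHS]mulrA;
  apply: (ler_wpM2l (ltW s0)).
  by apply: (rtr_cauchy tracial2); exact: hP.
- move=> x' y' w' *; rewrite conv_trace // mulr_ge0 ?(ltW s0) //;
  apply: (rtr_ge0' tracial2); exact: hP.
(* Third argument 1: the form is [delta] times the trace of [star (F y') * F y'] against
   [x' * star x'], to which [trace_prod_le] and the isometry apply. *)
- move=> x' y' hx hy.
  have -> : 1 = 1 * star 1 :> A1 by rewrite star1 mulr1.
  rewrite conv_trace //; try exact: relcomm1.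
  apply: bound; rewrite rmorph1 star1 !mul1r starM.
  have -> : F y' * i2 x' * (star (i2 x') * star (F y')) = F y' * (i2 (x' * star x') * star (F y')).
    by rewrite -(embed_star hi2) rmorphM !mulrA.
  have hFs := LS (L_N2 (hF hy)); have hxx : L (i2 (x' * star x')) by apply/L_i2/relcommM =>
    //; exact: M1S.
  rewrite (rtrC tracial2); [|exact/L_N2/hF|exact: LM].
  rewrite -mulrA (rtrC tracial2) //; last by apply: LM => //; exact/L_N2/hF.
  have := trace_prod_le (N2S (hF hy)) hx; rewrite starK => h; apply: le_trans h _.
  rewrite (rtrC tracial2) //; last exact/L_N2/hF.
  by rewrite fourier0_isometry // mulrC.
(* Second argument 1: [F 1] is a multiple of [e2], which compresses the first argument to its
   expectation in [B' \cap A], and domination takes place in that algebra. *)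
- move=> x' w' hx hw.
  have hxx : M1 (x' * star x') by apply: relcommM => //; exact: M1S.
  have hww : M1 (w' * star w') by apply: relcommM => //; exact: M1S.
  have h1 : M1 1 by exact: relcomm1.
  have e1' : 1 = 1 * star 1 :> A1 by rewrite star1 mulr1.
  have -> : rtr t1 (G (F 1 * F (x' * star x')) * (w' * star w'))
     = Num.sqrt c * rtr t0 (E1 (x' * star x') * E1 (w' * star w')).
    rewrite {1}e1' (conv_mulstar d0 ds rc_c J1 J2) // (fourier0_1 J1 J2).
    rewrite starZ ds (jones_adj J2) -!scalerAl -scalerAr linearZ /= linearZ /= !scalerA.
    rewrite (jones_sand J2) (E2_dualr rc_c J2).
    rewrite -!scalerAl !scalerA [X in X *: _](_ : _ = d); last by field.
    rewrite (rtrZ tracial1); last by apply: relcommM => //; apply/M1_i1/M0_E1.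
    by rewrite rtr1E (expMl cE1).
  apply: bound; rewrite !rtr1E.
  apply: (domination_mul tracial0 tracial0) => //.
  + exact: M0_E1.
  + by have := exp_pos cE1 (star x'); rewrite starK.
  + exact: M0_E1.
  move=> p' hp' pp; rewrite -(expMl cE1) -rtr1E; apply: (rtr_proj_ge0 tracial1) => //.
    exact: M1_i1.
  by case: pp => p1 p2; split; rewrite -?rmorphM ?p1 // -(embed_star hi1) p2.
- move=> y' w' hy hw.
  have -> : 1 = 1 * star 1 :> A1 by rewrite star1 mulr1.
  rewrite conv_trace //; try exact: relcomm1.
  apply: bound; rewrite rmorph1 !mulr1 !starM starK.
  have hFy := L_N2 (hF hy); have hw2 := L_i2 hw; have hFs := LS hFy.
  have -> : rtr t2 (star (i2 w') * F y' * (star (F y') * i2 w'))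
     = rtr t2 (F y' * star (F y') * i2 (w' * star w')).
    rewrite -mulrA (rtrC tracial2); [|exact: LS|by apply/LM/LM].
    by rewrite -(embed_star hi2) rmorphM !mulrA.
  by apply: le_trans (trace_prod_le (hF hy) hw) _; rewrite fourier0_isometry.
Qed.

Lemma tr2_P t : L t -> rtr t2 (P t) = rtr t2 t.
Proof.
move=> ht; have := exp_P d0 rc_c J1 J2 ht; rewrite /rtr /t2 /trace_of /= => ->.
by [].
Qed.

(** As for [conv_trace], after the trace has absorbed the averaging map [P], which is linear over
    [A' \cap A_2]. *)
Lemma conv_trace_dual w w' z z' u u' : N2 w -> N2 w' -> N2 z -> N2 z' -> N2 u -> N2 u' ->
  rtr t2 (F (G (z * star z') * G (w * star w')) * (u' * star u))
  = Num.sqrt c * rtr t2 ((star u * i2 (G z) * w) * star (star u' * i2 (G z') * w')).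
Proof.
move=> hw hw' hz hz' hu hu'.
have hww : N2 (w * star w') by apply: relcommM => //; exact: N2S.
have huu : N2 (u' * star u) by apply: relcommM => //; exact: N2S.
have hz1 := L_i2 (hG hz); have hz2 := L_i2 (hG hz').
have ht : L (i2 (G z) * (w * star w') * star (i2 (G z'))).
  by apply: LM; [apply: LM => //; exact: L_N2|exact: LS].
rewrite (conv_mulstar_dual d0 ds rc_c J1 J2) // -scalerAl (rtrZ tracial2); last first.
  by apply: LM; [apply/L_N2/(N2_P _ J1)|exact: L_N2].
congr (_ * _); rewrite -(P_mull _ _ _ huu) tr2_P; last by apply: LM => //; exact: L_N2.
transitivity (rtr t2 ((i2 (G z) * w * star (star u' * i2 (G z') * w')) * star u)).
  by congr rtr; rewrite !starM starK !mulrA.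
rewrite (rtrC tracial2) ?mulrA //; last exact/LS/L_N2.
apply: LM; first by apply: LM => //; exact: L_N2.
by apply/LS/LM; [apply: LM => //; exact/LS/L_N2|exact: L_N2].
Qed.

Lemma inv_fourier0_isometry z1 z2 : N2 z1 -> N2 z2 ->
  rtr t1 (G z1 * star (G z2)) = rtr t2 (z1 * star z2).
Proof.
move=> h1 h2; have := fourier0_isometry (hG h1) (hG h2).
by rewrite !(inv_fourier0K d0 ds rc_c J1 J2) // => <-.
Qed.

(** The counterpart of [E1] for the dual inequality: [G 1] is a multiple of [e1], so an argument
    next to it is seen through its corner [f w f], which [e2] brings down to [B' \cap A]. *)
Definition corner_exp (w : A2) : A := E1 (E2 (e2 * f * w * f * e2)).

Let Lf : L f. Proof. exact: L_f i2 J1. Qed.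
Let Le2 : L e2. Proof. by move=> b; exact: (jones_comm J2 (i0 b)). Qed.
Let ff : f * f = f. Proof. by rewrite /f -rmorphM (jones_idem J1). Qed.
Let sf : star f = f. Proof. by rewrite /f -(embed_star hi2) (jones_adj J1). Qed.
Let fe2f : f * e2 * f = rc c^-1 *: f.
Proof. by rewrite (rc_cV rc_c); exact: e1_e2_e1 d0 ds J1 J2. Qed.

Lemma corner_expE w : corner_exp w = E1 (E2 (f * w * f * e2)).
Proof.
have [h1 h2 h3 _ h5] := min_index_comp (jones_base J2) (dual_min_index J2 ZA).
have he2 : relcomm (i2 \o i1 : {lrmorphism A -> A2}) e2.
  by move=> b /=; rewrite (jones_comm J2).
have cc0 : c * c != 0 by rewrite mulf_neq0 // gt_eqF.
have tr_e2 x : E1 (E2 (x * e2)) = E1 (E2 (e2 * x)) := exp_trace h1 h2 h3 cc0 h5 x he2.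
by rewrite /corner_exp tr_e2 !mulrA (jones_idem J2) -!mulrA -tr_e2 !mulrA.
Qed.

(** Two pull-downs, along [e2] and then along [e1], contribute a factor [c] each. *)
Lemma corner_pull w : f * w * f * e2 = rc (c ^+ 2) *: (f * i2 (i1 (corner_exp w)) * e2).
Proof.
rewrite [LHS](jones_pull J2); set x := E2 _.
have e1x : e1 * x = x by rewrite -(expMl cE2) !mulrA -/f ff.
rewrite -{1}e1x (jones_pull_l J1) e1x linearZ /= -scalerAl scalerA -rmorphM.
rewrite /x -corner_expE -expr2; congr (_ *: (_ * e2)).
exact: rmorphM.
Qed.

Lemma M0_corner w : L w -> M0 (corner_exp w).
Proof. by move=> hw; apply/M0_E1/(M1_E2 J2)/LM/Le2/LM/Lf/LM/hw/LM/Lf/Le2. Qed.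

Lemma corner_mulstar w :
  corner_exp (w * star w) = E1 (E2 (e2 * f * w * star (e2 * f * w))).
Proof. by rewrite /corner_exp !starM sf (jones_adj J2) !mulrA. Qed.

Lemma pos_corner w : pos (corner_exp (w * star w)).
Proof.
rewrite corner_mulstar; have [_ cE _ _ _] := min_index_comp (jones_base J2) (dual_min_index J2 ZA).
by have := exp_pos cE (star (e2 * f * w)); rewrite starK.
Qed.

(** One factor [c] undoes [f e2 f = f / c], the other undoes [E1 e1 = 1 / c]. *)
Lemma rtr_corner w : N2 w -> rtr t2 w = c ^+ 2 * rtr t0 (corner_exp w).
Proof.
move=> hw; have hL := L_N2 hw; have hn := N1_E2 hw; set n := E2 w in hn.
have wf : rtr t2 (w * f) = c^-1 * rtr t2 w.
  rewrite !rtr2E (expMr cE2) -/n (pushdownE J1) rtr1E (expMl cE1) (jones_exp_e J1).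
  rewrite mulr_algr (rtrZ tracial0) ?trace_pushdown //.
  exact: pushdown_relcomm J1 _ hn.
have -> : rtr t0 (corner_exp w) = c^-1 * rtr t2 (w * f).
  rewrite corner_expE -rtr1E -rtr2E -!mulrA (rtrC tracial2) //; last by apply/LM/LM.
  by rewrite -!mulrA (mulrA f) fe2f -scalerAr (rtrZ tracial2) //; apply/LM.
by rewrite wf; field; rewrite gt_eqF.
Qed.

(** The power 3 arises as follows: writing [f] as [c f e2 f] gives one factor, the two uses of
    [corner_pull] give four, and the expectations of [e2] and [e1] remove two. *)
Lemma corner_trace w u : L w -> L u ->
  rtr t2 (f * w * f * star u) = c ^+ 3 * rtr t0 (corner_exp w * star (corner_exp u)).
Proof.
move=> hw hu; set a := corner_exp w; set b := corner_exp u.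
have Ma : M0 a by exact: M0_corner.
have Mb : M0 (star b) by apply: (relcommS hi0); exact: M0_corner.
have hL : L (f * w * f * star u) by apply/LM/LS/hu/LM/Lf/LM/hw.
transitivity (rtr t2 (f * w * f * star u * f)).
  by rewrite (rtrC tracial2 hL Lf) !mulrA ff.
have -> : f * w * f * star u * f = rc c *: ((f * w * f * e2) * star (f * u * f * e2)).
  have -> : star (f * u * f * e2) = e2 * f * star u * f.
    by rewrite !starM sf (jones_adj J2) !mulrA.
  have -> : (f * w * f * e2) * (e2 * f * star u * f) = f * w * (f * (e2 * e2) * f) * star u * f.
    by rewrite !mulrA.
  rewrite (jones_idem J2) fe2f -scalerAr -!scalerAl scalerA (jones_c_unit J1).
  by rewrite scale1r.
have Ja : M1 (i1 (a * star b)) by apply/M1_i1/relcommM.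
have hfe : L (i2 (i1 (a * star b)) * e2 * f) by apply/LM/Lf/LM/Le2/L_i2.
have ec : rc c * rc (c ^+ 2) * rc (c ^+ 2) = rc (c ^+ 5) :> R[i].
  by rewrite -!rmorphM; congr rc; ring.
rewrite !corner_pull -/a -/b starZr -scalerAl -scalerAr !scalerA ec.
have -> : f * i2 (i1 a) * e2 * star (f * i2 (i1 b) * e2)
   = f * (i2 (i1 (a * star b)) * e2 * f).
  rewrite !starM sf (jones_adj J2) -(embed_star hi2) -(embed_star hi1) !rmorphM.
  rewrite !mulrA -(mulrA _ e2 e2) (jones_idem J2); congr (_ * f).
  by have := e2_comm J2 (f * i2 (i1 a)) (star b); rewrite /= => ->.
rewrite (rtrZ tracial2); last by apply/LM.
rewrite (rtrC tracial2) // -mulrA ff rtr2E (jones_dual J2).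
rewrite (rtrZ tracial1); last first.
  apply: relcommM => // b'; rewrite /= (jones_comm J1).
  by [].
rewrite rtr1E (expMl cE1) (jones_exp_e J1) mulr_algr (rtrZ tracial0); last exact: relcommM.
by field; rewrite gt_eqF.
Qed.

Lemma young_upper x y p q r : N2 x -> N2 y -> (1 <= p)%E -> (1 <= q)%E -> (1 <= r)%E ->
  (p^-1 + q^-1 = r^-1 + 1)%E ->
  pnorm t2 r (F (G y * G x)) <= Num.sqrt c / k * pnorm t2 p x * pnorm t2 q y.
Proof.
have hP x' y' w' : N2 x' -> N2 y' -> N2 w' -> L (star w' * i2 (G y') * x').
  move=> h1 h2 h3; apply: LM; last exact: L_N2.
  by apply: LM; [exact/LS/L_N2|exact/L_i2/hG].
have C0 : 0 <= Num.sqrt c / k by rewrite divr_ge0 // ltW.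
have bound (u v : R) : k * u <= v -> Num.sqrt c * u <= Num.sqrt c / k * v.
  move=> h; rewrite -mulrA; apply: (ler_wpM2l (ltW s0)).
  by rewrite mulrC ler_pdivlMr // mulrC.
apply: (young tracialN2 (conv := fun x y => F (G y * G x))) => //.
- by move=> x' y' h1 h2; apply/hF/relcommM; exact: hG.
- by move=> x1 x2 y'; rewrite inv_fourier0D mulrDr fourier0D.
- by move=> x' y1 y2; rewrite inv_fourier0D mulrDl fourier0D.
- by move=> z x' y'; rewrite inv_fourier0Z -scalerAr fourier0Z.
- by move=> z x' y'; rewrite inv_fourier0Z -scalerAl fourier0Z.
- move=> x1 x2 y1 y2 w1 w2 *; rewrite !conv_trace_dual // -mulrDr -[leRHS]mulrA;
  apply: (ler_wpM2l (ltW s0)).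
  by apply: (rtr_cauchy tracial2); exact: hP.
- move=> x' y' w' *; rewrite conv_trace_dual // mulr_ge0 ?(ltW s0) //;
  apply: (rtr_ge0' tracial2); exact: hP.
- move=> x' y' hx hy.
  have -> : 1 = 1 * star 1 :> A2 by rewrite star1 mulr1.
  rewrite conv_trace_dual //; try exact: relcomm1.
  apply: bound; rewrite star1 !mul1r starM.
  have hx2 := L_N2 hx; have hGy := L_i2 (hG hy); have hGs := LS hGy.
  have -> : rtr t2 (i2 (G y') * x' * (star x' * star (i2 (G y'))))
      = rtr t2 (x' * star x' * i2 (star (G y') * G y')).
    rewrite -mulrA (rtrC tracial2) //; last by do 2?apply: LM => //; exact: LS.
    by rewrite -(embed_star hi2) rmorphM !mulrA.
  have := trace_prod_le hx (M1S (hG hy)); rewrite starK => h; apply: le_trans h _.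
  rewrite (rtrC tracial1 (M1S _)) ?inv_fourier0_isometry //; exact: hG.
- move=> x' w' hx hw.
  have -> : 1 = 1 * star 1 :> A2 by rewrite star1 mulr1.
  rewrite conv_trace_dual //; try exact: relcomm1.
  apply: bound; rewrite (inv_fourier0_1 d0 rc_c J2) linearZ /= -/f.
  have hx2 := L_N2 hx; have hw2 := L_N2 hw.
  have hxx : L (x' * star x') by apply: LM => //; exact: LS.
  have hww : L (w' * star w') by apply: LM => //; exact: LS.
  have nxx : N2 (x' * star x') by apply: relcommM => //; exact: N2S.
  have nww : N2 (w' * star w') by apply: relcommM => //; exact: N2S.
  (* Here [c^4] is [d^2 = c] times the [c^3] of [corner_trace]. It equals the product of the factors
     [c^2] that [rtr_corner] gives for the two traces, so no power of the index is left. *)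
  have -> : rtr t2 (star w' * (d *: f) * x' * star (star w' * (d *: f) * x'))
     = c ^+ 4 * rtr t0 (corner_exp (x' * star x') * corner_exp (w' * star w')).
    have [<- _] := pos_corner w'.
    rewrite exprS -[RHS]mulrA -corner_trace //.
    have hfx : L (f * (x' * star x') * f * w') by apply/LM/hw2/LM/Lf/LM/hxx.
    have -> : f * (x' * star x') * f * star (w' * star w') = f * (x' * star x') * f * w' * star w'.
      by rewrite starM starK !mulrA.
    rewrite [in RHS](rtrC tracial2 hfx (LS hw2)).
    rewrite -(rtrZ tracial2); last by apply: LM => //; exact: LS.
    have -> : star w' * (d *: f) * x' = d *: (star w' * f * x').
      by rewrite -scalerAr -scalerAl.
    by rewrite starZ ds -scalerAl -scalerAr scalerA rc_c expr2 !starM starK sf !mulrA.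
  rewrite !rtr_corner //.
  have h : k * rtr t0 (corner_exp (x' * star x') * corner_exp (w' * star w'))
     <= rtr t0 (corner_exp (x' * star x')) * rtr t0 (corner_exp (w' * star w')).
    apply: (domination_mul tracial0 tracial0) => //; try exact: M0_corner.
      exact: pos_corner.
    move=> p' hp' pp; rewrite corner_mulstar -(expMl cE1) -(expMl cE2) -rtr1E -rtr2E.
    apply: (rtr_proj_ge0 tracial2); first by apply/L_i2/M1_i1.
      by apply/LM/hw2/LM/Lf.
    case: pp => p1 p2; split; first by rewrite -!rmorphM p1.
    by rewrite -(embed_star hi2) -(embed_star hi1) p2.
  have -> : c ^+ 2 * rtr t0 (corner_exp (x' * star x')) * (c ^+ 2 * rtr t0 (corner_exp (w'
    * star w')))
     = c ^+ 4 * (rtr t0 (corner_exp (x' * star x')) * rtr t0 (corner_exp (w' * star w'))) by ring.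
  by rewrite mulrCA; apply: ler_wpM2l => //; rewrite exprn_ge0 // ltW.
- move=> y' w' hy hw.
  have -> : 1 = 1 * star 1 :> A2 by rewrite star1 mulr1.
  rewrite conv_trace_dual //; try exact: relcomm1.
  apply: bound; rewrite !mulr1 !starM starK.
  have hy2 := L_i2 (hG hy); have hw2 := L_N2 hw; have hs := LS hw2; have hGs := LS hy2.
  have -> : rtr t2 (star w' * i2 (G y') * (star (i2 (G y')) * w'))
     = rtr t2 (w' * star w' * i2 (G y' * star (G y'))).
    rewrite mulrA (rtrC tracial2) //; last by apply/LM/hGs/LM/hy2.
    by rewrite -(embed_star hi2) rmorphM !mulrA.
  apply: le_trans (trace_prod_le hw (hG hy)) _.
  by rewrite inv_fourier0_isometry // mulrC.
Qed.

End Bounds.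

(** Put [u = Q t - P t]. Both maps preserve the trace and are linear over [A' \cap A_2], so
    [star u * Q t] and [star u * P t] both have the trace of [star u * t]; faithfulness gives
    [u = 0]. *)
Lemma trace_cond_exp_unique (Q : A2 -> A2) t :
  trace_cond_exp t2 L N2 Q -> L t -> Q t = P t.
Proof.
move=> [[QN QN' _ Qm] [_ Qt]] ht.
have htP := N2_P d J1 ht; have htQ := QN _ ht.
have Pt x : L x -> t2 (P x) = t2 x.
  by move=> hx; have := exp_P d0 rc_c J1 J2 hx; rewrite /t2 /trace_of /= => ->.
have hu : N2 (Q t - P t) by apply: (tracial_B tracialN2).
set u := Q t - P t in hu *; have hu' := N2S hu.
apply/eqP; rewrite -subr_eq0 -/u; apply/eqP/(tr_eq0 tracialN2 hu).
have M1' : N2 1 by exact: relcomm1.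
have hut : L (star u * t) by apply: LM ht; exact: L_N2.
have e1' : t2 (star u * Q t) = t2 (star u * P t).
  have := Qm _ _ _ hu' ht M1'; rewrite !mulr1 => <-.
  by rewrite Qt // -Pt // (P_mulr _ _ _ hu').
rewrite {2}/u mulrBr -scaleN1r.
have hQ : N2 (star u * Q t) by exact: relcommM.
have hP : N2 (star u * P t) by exact: relcommM.
rewrite (trD tracialN2) //; last exact: relcommZ.
by rewrite (trZ tracialN2) // e1' mulN1r subrr.
Qed.

End Vertices.

(** * Constants and conclusion *)

Lemma delta_cube (R : realType) (c : R) : 0 < c ->
  c^-1 `^ (- (3 / 2)) = Num.sqrt c ^+ 3.
Proof.
move=> c0; have s0 : 0 < Num.sqrt c by rewrite sqrtr_gt0.
have -> : c^-1 = Num.sqrt c `^ (- 2).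
  by rewrite powRN -[2]/(2%:R) powR_mulrn ?ltW // sqr_sqrtr // ltW.
rewrite -powRrM -powR_mulrn ?ltW //; congr powR.
by field.
Qed.

Lemma min_proj_trace_gt0 (R : realType) (D : cstarAlgType R) (M : set D) tr k :
  tracial_alg M tr -> is_min (proj_traces tr M) k -> 0 < k.
Proof.
move=> HT [[p [hp p0 [pp ps] ->]] _].
by have := rtr_gt0 HT hp p0; rewrite ps pp.
Qed.

Theorem theoremB (R : realType) (B A A1 A2 : cstarAlgType R)
  (simpleB : simple_cstar B) (simpleA : simple_cstar A)
  (i0 : {lrmorphism B -> A}) (hi0 : star_embedding i0)
  (E0 : {linear A -> B}) (index : R) (hE0 : minimal_cond_exp i0 E0 index)
  (i1 : {lrmorphism A -> A1}) (hi1 : star_embedding i1) (e1 : A1)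
  (hA1 : basic_construction i0 E0 i1 e1)
  (E1 : {linear A1 -> A}) (hE1 : dual_cond_exp i1 e1 index^-1 E1)
  (i2 : {lrmorphism A1 -> A2}) (hi2 : star_embedding i2) (e2 : A2)
  (hA2 : basic_construction i1 E1 i2 e2)
  (E2 : {linear A2 -> A1}) (hE2 : dual_cond_exp i2 e2 index^-1 E2)
  (P : A2 -> A2)
  (hP : trace_cond_exp (trace_of (E0 \o E1 \o E2))
          (relcomm (i2 \o i1 \o i0)) (relcomm (i2 \o i1)) P)
  (kappa_plus kappa_minus : R)
  (hkp : is_min (proj_traces (trace_of E0) (relcomm i0)) kappa_plus)
  (hkm : is_min (proj_traces (trace_of (E0 \o E1)) (relcomm i1)) kappa_minus)
  (p q r : \bar R)
  (hp : (1 <= p)%E) (hq : (1 <= q)%E) (hr : (1 <= r)%E)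
  (hpqr : (p^-1 + q^-1 = r^-1 + 1)%E) :
  let tau := index^-1 in
  let delta := Num.sqrt index in
  let tr1 := trace_of (E0 \o E1) in
  let tr2 := trace_of (E0 \o E1 \o E2) in
  let v2 := e2 * i2 e1 in
  let F := fourier tau i2 P v2 in
  let Finv := inv_fourier tau E2 v2 in
  (forall x y : A1, relcomm (i1 \o i0) x -> relcomm (i1 \o i0) y ->
     pnorm tr1 r (convolution F Finv x y) <=
       delta / kappa_plus * pnorm tr1 p x * pnorm tr1 q y) /\
  (forall w z : A2, relcomm (i2 \o i1) w -> relcomm (i2 \o i1) z ->
     pnorm tr2 r (convolution Finv F w z) <=
       delta / kappa_minus * pnorm tr2 p w * pnorm tr2 q z).
Proof.
move=> tau delta tr1 tr2 v2 F Finv.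
have ZB : scalar_center B by exact: center_of_simple.
have ZA : scalar_center A by exact: center_of_simple.
have [m [l H0]] := minimal_min_index hi0 hE0 ZB ZA.
have J1 := jones_of_basic_construction H0 hi1 hA1 hE1.
have J2 := jones_of_basic_construction (dual_min_index J1 ZB) hi2 hA2 hE2.
have c0 := jones_c_gt0 J1; have s0 : 0 < Num.sqrt index by rewrite sqrtr_gt0.
set d : R[i] := rc (Num.sqrt index) in J2.
have d0 : d != 0 by rewrite fmorph_eq0 gt_eqF.
have rc_c : rc index = d ^+ 2 :> R[i] by rewrite -rmorphXn /= sqr_sqrtr // ltW.
have e3 : rc (tau `^ (- (3 / 2))) = d ^+ 3 :> R[i].
  by rewrite /tau delta_cube // rmorphXn.
(* [P] is prescribed on the relative commutant of [B] only, so the identification is restricted to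
   [x] there. *)
have FE x : relcomm (i1 \o i0) x -> F x = fourier0 l i1 e1 i2 e2 d x.
  move=> hx; rewrite (fourier0P _ _ _ _ _ d0) /F /fourier e3 mulrA; congr (_ *: _).
  apply: (trace_cond_exp_unique ZB ZA J1 J2) => //.
  apply: L_M (L_f i2 J1); apply: L_M; first exact: L_of_M1.
  by move=> b; exact: (jones_comm J2 (i0 b)).
have GE w : Finv w = inv_fourier0 e1 i2 e2 E2 d w.
  rewrite /Finv /inv_fourier e3 /inv_fourier0 /v2 starM (jones_adj J2).
  by rewrite -(embed_star hi2) (jones_adj J1) mulrA.
have kp0 := min_proj_trace_gt0 (tracial0 ZB J1) hkp.
have km0 := min_proj_trace_gt0 (tracialN1 ZB J1 J2) hkm.
have kp1 : min_trace0 i0 E0 kappa_plus.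
  by move=> x hx x0 px; apply: (proj2 hkp); exists x.
have km1 : min_trace1 E0 i1 E1 kappa_minus.
  by move=> x hx x0 px; apply: (proj2 hkm); exists x.
(* Each half uses a lower bound for the projections of both [B' \cap A] and [A' \cap A_1]; one is
   given by the [kappa] in its statement, the other is transferred from it. *)
split=> [x y hx hy|w z hw hz]; rewrite /convolution.
  rewrite !FE // GE.
  exact: (young_lower ZB ZA J1 J2 kp0 kp1 (min_trace_01 J1 kp1)).
rewrite !GE FE; last by apply: relcommM; exact: M1_G J1 J2 _ _.
exact: (young_upper ZB ZA J1 J2 km0 (min_trace_10 J1 km1) km1).
Qed.
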